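(* Let $A$ be a finite dimensional algebra over a field and $U=\bigoplus_{i=1}^mU_i\in2\text{-}\mathsf{psilt}\,A$ with each $U_i$ indecomposable. For each facet $F$ of $D(U)$, there uniquely exists $(i,\epsilon)\in\{1,\ldots,m\}\times\{\pm\}$ such that $F\in\mathsf{Facet}_i^\epsilon D(U)$. Thus there is a decomposition $$\mathsf{Facet}\,D(U)=\bigsqcup_{i=1}^m\bigl(\mathsf{Facet}_i^+D(U)\sqcup\mathsf{Facet}_i^-D(U)\bigr).$$
   Context: Let $K$ be a field and $A$ a finite dimensional $K$-algebra. $\mathsf{mod}\,A$, $\mathsf{proj}\,A$, $\mathsf{inj}\,A$ are the categories of finitely generated (f.g.), f.g. projective, f.g. injective right $A$-modules; $\mathsf K^{\mathrm b}(\mathsf{proj}\,A)$ is the homotopy category of bounded complexes; $\nu\colon\mathsf K^{\mathrm b}(\mathsf{proj}\,A)\to\mathsf K^{\mathrm b}(\mathsf{inj}\,A)$ is the Nakayama functor. $n:=|A|$ is the number of isoclasses of indecomposable projective $A$-modules. $U\in\mathsf K^{\mathrm b}(\mathsf{proj}\,A)$ is presilting if $\mathrm{Hom}(U,U[\ell])=0$ for all $\ell\ge1$, and 2-term if it is isomorphic to a complex concentrated in degrees $-1,0$. $2\text{-}\mathsf{psilt}\,A$ is the set of isoclasses of basic 2-term presilting complexes. $K_0(\mathsf{proj}\,A)_{\mathbb R}:=K_0(\mathsf{proj}\,A)\otimes_{\mathbb Z}\mathbb R\cong\mathbb R^n$. Each $\theta\in K_0(\mathsf{proj}\,A)_{\mathbb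 R}$ is a linear form on $K_0(\mathsf{mod}\,A)_{\mathbb R}$ via the Euler bilinear form, determined by $\langle[P],[M]\rangle=\dim_K\mathrm{Hom}_A(P,M)$ for $P\in\mathsf{proj}\,A$, $M\in\mathsf{mod}\,A$; write $\theta(M):=\langle\theta,[M]\rangle$. Define subcategories of $\mathsf{mod}\,A$: $M\in\overline{\mathcal T}_\theta$ (resp. $\mathcal T_\theta$) iff $\theta(X)\ge0$ (resp. $>0$) for all nonzero factor modules $X$ of $M$; $M\in\overline{\mathcal F}_\theta$ (resp. $\mathcal F_\theta$) iff $\theta(Y)\le0$ (resp. $<0$) for all nonzero submodules $Y$ of $M$. $D(U):=\{\theta\mid H^0(U)\in\overline{\mathcal T}_\theta,\ H^{-1}(\nu U)\in\overline{\mathcal F}_\theta\}$, a full-dimensional rational polyhedral cone in $K_0(\mathsf{proj}\,A)_{\mathbb R}$. A facet of $D(U)$ is a face of dimension $n-1$; $\mathsf{Facet}\,D(U)$ is the set of facets. For $i\in\{1,\ldots,m\}$, with $\mathrm{rad}_A(-,-)$ the radical of the category $\mathsf{mod}\,A$, $$Y_i^+:=H^0(U_i)\Big/\sum_{f\in\mathrm{rad}_A(H^0(U),H^0(U_i))}\mathrm{Im}\,f,\qquad X_i^-:=\bigcap_{f\in\mathrm{rad}_A(H^{-1}(\nu U_i),H^{-1}(\nu U))}\mathrm{Ker}\,f.$$ Put $\partial_i^+:=\{\theta\in D(U)\mid Y_i^+\notin\mathcal T_\theta\}$, $\partial_i^-:=\{\theta\in D(U)\mid X_i^-\notin\mathcal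 F_\theta\}$, and $\mathsf{Facet}_i^\epsilon D(U):=\{F\in\mathsf{Facet}\,D(U)\mid F\subset\partial_i^\epsilon\}$ for $\epsilon\in\{\pm\}$. *)

(* Defs.v *)
From HB Require Import structures.
From mathcomp Require Import all_boot all_order all_algebra all_field.
From mathcomp Require Import boolp classical_sets reals.

Set Implicit Arguments.
Unset Strict Implicit.
Unset Printing Implicit Defensive.

Import Order.TTheory GRing.Theory Num.Theory.
Local Open Scope classical_set_scope.
Local Open Scope ring_scope.

Section Vspan.
Variables (F : fieldType) (V : vectType F).
Implicit Types (S : set V) (U W : {vspace V}).

Definition is_vspan S U : Prop :=
  (forall x, S x -> x \in U) /\
  (forall W, (forall x, S x -> x \in W) -> (U <= W)%VS).

(* The default value [fullv] is never used, see [vspanP]. *)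
Definition vspan S : {vspace V} := xget fullv (is_vspan S).

Lemma vspan_exists S : exists U, is_vspan S U.
Proof.
pose good U := (forall W, (forall x, S x -> x \in W) -> (U <= W)%VS).
suff H k U : good U -> (\dim {:V} - \dim U <= k)%N -> exists U', is_vspan S U'.
  by apply: (H (\dim {:V}) 0%VS) => [W _|]; rewrite ?sub0v ?leq_subr.
elim: k U => [|k IH] U gU dU.
  exists U; split => // x _.
  suff -> : U = fullv by rewrite memvf.
  apply/eqP; rewrite -(dimv_leqif_eq (subvf U)) eqn_leq dimvS ?subvf //=.
  by rewrite -subn_eq0 -leqn0.
have [SU|] := pselect (forall x, S x -> x \in U); first by exists U.
move=> /existsNP[x] /not_implyP[Sx /negP xU].
apply: (IH (U + <[x]>)%VS) => [W SW|].
  by rewrite subv_add gU //= -memvE SW.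
have lt : (\dim U < \dim (U + <[x]>))%N.
  rewrite ltn_neqAle (dimvS (addvSl _ _)) andbT.
  rewrite (dimv_leqif_eq (addvSl U <[x]>)).
  apply: contra xU => /eqP ->; by rewrite memvE addvSr.
have le : (\dim (U + <[x]>) <= \dim {:V})%N by rewrite dimvS ?subvf.
by rewrite -ltnS; apply: leq_trans dU; apply: ltn_sub2l => //; apply: leq_trans le.
Qed.

Lemma vspanP S : is_vspan S (vspan S).
Proof. exact: xgetPex (vspan_exists S). Qed.

Lemma sub_vspan S x : S x -> x \in vspan S.
Proof. exact: (vspanP S).1. Qed.

Lemma vspan_min S W : (forall x, S x -> x \in W) -> (vspan S <= W)%VS.
Proof. exact: (vspanP S).2. Qed.

Lemma vspan_ind S (Q : V -> Prop) : Q 0 ->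
  (forall k x y, Q x -> Q y -> Q (k *: x + y)) ->
  (forall x, S x -> Q x) -> forall x, x \in vspan S -> Q x.
Proof.
move=> Q0 QD SQ.
have [W [WQ maxW]] : exists W : {vspace V}, (forall x, x \in W -> Q x) /\
    (forall W' : {vspace V},
       (forall x, x \in W' -> Q x) -> (W <= W')%VS -> W' = W).
  suff H k (U : {vspace V}) : (forall x, x \in U -> Q x) ->
      (\dim {:V} - \dim U <= k)%N ->
      exists W : {vspace V}, (forall x, x \in W -> Q x) /\
      (forall W' : {vspace V},
         (forall x, x \in W' -> Q x) -> (W <= W')%VS -> W' = W).
    apply: (H (\dim {:V}) 0%VS) => [x|]; last by rewrite leq_subr.
    by rewrite memv0 => /eqP ->.
  elim: k U => [|k IH] U QU dU.
    exists U; split => // W' _ UW'; apply/eqP; rewrite eq_sym -(dimv_leqif_eq UW').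
    rewrite eqn_leq dimvS //=; apply: (@leq_trans (\dim {:V})).
      by rewrite dimvS ?subvf.
    by rewrite -subn_eq0 -leqn0.
  have [M|] := pselect (forall W' : {vspace V},
         (forall x, x \in W' -> Q x) -> (U <= W')%VS -> W' = U).
    by exists U.
  move=> /existsNP[W'] /not_implyP[QW' /not_implyP[UW' /eqP neW']].
  apply: (IH W') => //.
  have lt : (\dim U < \dim W')%N.
    by rewrite ltn_neqAle (dimvS UW') andbT (dimv_leqif_eq UW') eq_sym.
  have le : (\dim W' <= \dim {:V})%N by rewrite dimvS ?subvf.
  by rewrite -ltnS; apply: leq_trans dU; apply: ltn_sub2l => //; apply: leq_trans le.
suff SW : forall x, S x -> x \in W.
  by move=> x /(subvP (vspan_min SW)); apply: WQ.
move=> x Sx; suff <- : (<[x]> + W)%VS = W by rewrite memvE addvSl.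
apply: maxW; last exact: addvSr.
move=> y /memv_addP[_ /vlineP[k ->] [w Ww ->]].
by apply: QD; [exact: SQ|exact: WQ].
Qed.

End Vspan.

Lemma vsval_inj (F : fieldType) (V : vectType F) (U : {vspace V}) :
  injective (@vsval F V U).
Proof. exact: val_inj. Qed.

Section Modules.
Variables (K : fieldType) (A : falgType K).

(* [ract a v] is [v a]. *)
Record rmod := RMod {
  carrier :> vectType K;
  ract : A -> 'End(carrier);
  ract_linear : linear ract;
  ract1 : ract 1 = \1%VF;
  ractM : forall a b, ract (a * b) = (ract b \o ract a)%VF }.
Arguments ract : clear implicits.

Definition is_mhom (M N : rmod) (f : 'Hom(M, N)) : Prop :=
  forall a v, f (ract M a v) = ract N a (f v).

Record mhom (M N : rmod) := MHom {
  mfun :> 'Hom(M, N);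
  mhomP : is_mhom mfun }.

Lemma is_mhom_lin (M N : rmod) k (f g : 'Hom(M, N)) :
  is_mhom f -> is_mhom g -> is_mhom (k *: f + g).
Proof.
by move=> hf hg a v; rewrite !add_lfunE !scale_lfunE hf hg linearD linearZ.
Qed.

Lemma is_mhom0 (M N : rmod) : is_mhom (0 : 'Hom(M, N)).
Proof. by move=> a v; rewrite !zero_lfunE linear0. Qed.

Lemma is_mhom1 (M : rmod) : is_mhom (\1%VF : 'Hom(M, M)).
Proof. by move=> a v; rewrite !id_lfunE. Qed.

Lemma is_mhom_comp (L M N : rmod) (g : 'Hom(M, N)) (f : 'Hom(L, M)) :
  is_mhom g -> is_mhom f -> is_mhom (g \o f)%VF.
Proof. by move=> hg hf a v; rewrite !comp_lfunE hf hg. Qed.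

Lemma is_mhomZ (M N : rmod) k (f : 'Hom(M, N)) :
  is_mhom f -> is_mhom (k *: f).
Proof. by move=> hf; rewrite -[_ *: _]addr0; exact: is_mhom_lin (@is_mhom0 _ _). Qed.

Definition mod_zero (M : rmod) : Prop := (fullv : {vspace M}) = 0%VS.

Definition mod_iso (M N : rmod) : Prop :=
  exists (f : mhom M N) (g : mhom N M),
    (g \o f)%VF = \1%VF /\ (f \o g)%VF = \1%VF.

Definition hom_space (M N : rmod) : {vspace 'Hom(M, N)} := vspan (@is_mhom M N).

Lemma hom_spaceP (M N : rmod) (f : 'Hom(M, N)) : f \in hom_space M N <-> is_mhom f.
Proof.
split; last exact: sub_vspan.
by apply: vspan_ind => //; [exact: is_mhom0|move=> *; exact: is_mhom_lin].
Qed.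

Record submodule (M : rmod) := Submodule {
  subspace_of :> {vspace M};
  submodP : forall a v, v \in subspace_of -> ract M a v \in subspace_of }.

Section SubFactor.
Variables (M : rmod) (V : submodule M).

Definition sub_ract (a : A) : 'End(subvs_of V) :=
  (linfun (@vsproj K M V) \o ract M a \o linfun (@vsval K M V))%VF.

Lemma val_sub_ract a u : vsval (sub_ract a u) = ract M a (vsval u).
Proof. by rewrite !comp_lfunE !lfunE /= vsprojK // submodP // subvsP. Qed.

Fact sub_ract_linear : linear sub_ract.
Proof.
move=> k a b; apply/lfunP => u; apply: vsval_inj; rewrite add_lfunE scale_lfunE linearP /=.
by rewrite !val_sub_ract ract_linear add_lfunE scale_lfunE.
Qed.

Fact sub_ract1 : sub_ract 1 = \1%VF.
Proof.
by apply/lfunP => u; apply: vsval_inj; rewrite val_sub_ract ract1 !id_lfunE.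
Qed.

Fact sub_ractM a b : sub_ract (a * b) = (sub_ract b \o sub_ract a)%VF.
Proof.
apply/lfunP => u; apply: vsval_inj.
by rewrite (comp_lfunE (sub_ract b)) !val_sub_ract ractM comp_lfunE.
Qed.

Definition sub_mod : rmod := RMod sub_ract_linear sub_ract1 sub_ractM.

Fact sub_incl_mhom : @is_mhom sub_mod M (linfun (@vsval K M V)).
Proof. by move=> a v; rewrite !(lfunE (@vsval K M V)); exact: val_sub_ract. Qed.

Definition sub_incl : mhom sub_mod M := MHom sub_incl_mhom.

(* The factor module M / V is carried by a vector space complement of V, onto *)
(* which [factor_lfun] projects with kernel V.                                *)
Definition factor_lfun : 'Hom(M, subvs_of (V^C)%VS) :=
  (linfun (@vsproj K M (V^C)%VS) \o daddv_pi (V^C)%VS V)%VF.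

Definition factor_ract (a : A) : 'End(subvs_of (V^C)%VS) :=
  (factor_lfun \o ract M a \o linfun (@vsval K M (V^C)%VS))%VF.

Lemma factor_lfunK u : factor_lfun (vsval u) = u.
Proof.
rewrite comp_lfunE lfunE /= daddv_pi_id ?vsvalK ?subvsP //.
by rewrite capvC capv_compl.
Qed.

Lemma factor_lfun_sub v : v - vsval (factor_lfun v) \in (V : {vspace M}).
Proof.
rewrite comp_lfunE lfunE /= vsprojK ?memv_pi //.
have VC0 : ((V^C)%VS :&: V = 0)%VS by rewrite capvC capv_compl.
have vT : v \in ((V^C)%VS + V)%VS by rewrite addvC addv_complf memvf.
have E := daddv_pi_add VC0 vT.
suff -> : v - daddv_pi (V^C)%VS V v = daddv_pi V (V^C)%VS v by exact: memv_pi.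
by apply/eqP; rewrite subr_eq addrC E.
Qed.

Lemma lker_factor_lfun : lker factor_lfun = V.
Proof.
apply/vspaceP => v; rewrite memv_ker; apply/eqP/idP => [v0|Vv].
  by have := factor_lfun_sub v; rewrite v0 -{2}[v]subr0.
have := factor_lfun_sub v; move: (factor_lfun v) => u Vu.
apply: vsval_inj => /=; apply/eqP; rewrite -memv0 -(capv_compl V) memv_cap subvsP.
by rewrite andbT -[vsval u](subKr v) rpredB.
Qed.

Lemma factor_lfun_mhom a v :
  factor_lfun (ract M a v) = factor_ract a (factor_lfun v).
Proof.
have -> : factor_ract a (factor_lfun v) =
    factor_lfun (ract M a (vsval (factor_lfun v))).
  by rewrite (comp_lfunE (factor_lfun \o ract M a)%VF) comp_lfunE
    (lfunE (@vsval K M (V^C)%VS)).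
apply/eqP; rewrite -subr_eq0; move: (vsval _) (factor_lfun_sub v) => w Vvw.
rewrite -(linearB factor_lfun) -(linearB (ract M a)) -memv_ker lker_factor_lfun.
exact: submodP.
Qed.

Fact factor_ract_linear : linear factor_ract.
Proof.
move=> k a b; apply/lfunP => u; rewrite -(factor_lfunK u) add_lfunE scale_lfunE.
rewrite -!factor_lfun_mhom ract_linear add_lfunE scale_lfunE.
by rewrite linearD linearZ.
Qed.

Fact factor_ract1 : factor_ract 1 = \1%VF.
Proof.
apply/lfunP => u.
by rewrite -(factor_lfunK u) -factor_lfun_mhom ract1 !id_lfunE.
Qed.

Fact factor_ractM a b : factor_ract (a * b) = (factor_ract b \o factor_ract a)%VF.
Proof.
apply/lfunP => u.
by rewrite -(factor_lfunK u) (comp_lfunE (factor_ract b)) -!factor_lfun_mhom ractM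
  comp_lfunE.
Qed.

Definition factor_mod : rmod :=
  RMod factor_ract_linear factor_ract1 factor_ractM.

Definition factor_proj : mhom M factor_mod :=
  @MHom M factor_mod factor_lfun factor_lfun_mhom.

End SubFactor.

Section KernelImage.
Variables (M N : rmod) (f : mhom M N).

Fact ker_subP a v : v \in lker f -> ract M a v \in lker f.
Proof. by rewrite !memv_ker mhomP => /eqP ->; rewrite linear0. Qed.
Definition ker_sub : submodule M := Submodule ker_subP.

Fact img_subP a v : v \in limg f -> ract N a v \in limg f.
Proof. by case/memv_imgP=> u _ ->; rewrite -mhomP memv_img ?memvf. Qed.
Definition img_sub : submodule N := Submodule img_subP.

Variable W : submodule N.
Fact preim_subP a v :
  v \in (f @^-1: W)%VS -> ract M a v \in (f @^-1: W)%VS.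
Proof. by rewrite -!memv_preim mhomP; apply: submodP. Qed.
Definition preim_sub : submodule M := Submodule preim_subP.

End KernelImage.

Section SpanSubmodule.
Variables (M : rmod) (S : set M).
Hypothesis stabS : forall a x, S x -> S (ract M a x).

Fact span_subP a v : v \in vspan S -> ract M a v \in vspan S.
Proof.
move: v; apply: vspan_ind => [|k x y Sx Sy|x Sx].
- by rewrite linear0 mem0v.
- by rewrite linearD linearZ rpredD // rpredZ.
- by apply: sub_vspan; apply: stabS.
Qed.
Definition span_sub : submodule M := Submodule span_subP.

End SpanSubmodule.

Definition rad_hom (M N : rmod) (f : mhom M N) : Prop :=
  forall g : mhom N M, exists h : mhom M M,
    (h \o (\1 - (g \o f)) = \1)%VF /\ ((\1 - (g \o f)) \o h = \1)%VF.

Section RadicalTraces.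
Variables M N : rmod.

Fact rad_image_stable a x :
  (exists f : mhom M N, rad_hom f /\ exists y, x = f y) ->
  exists f : mhom M N, rad_hom f /\ exists y, ract N a x = f y.
Proof.
by case=> f [rf [y ->]]; exists f; split=> //; exists (ract M a y); rewrite mhomP.
Qed.

(* The sum of the Im f, for f in rad(M, N). *)
Definition rad_image : submodule N := span_sub rad_image_stable.

Fact rad_kernel_stable a x :
  (forall f : mhom M N, rad_hom f -> f x = 0) ->
  forall f : mhom M N, rad_hom f -> f (ract M a x) = 0.
Proof. by move=> H f rf; rewrite mhomP H // linear0. Qed.

(* The intersection of the Ker f, for f in rad(M, N). *)
Definition rad_kernel : submodule M := span_sub rad_kernel_stable.

Lemma rad_kernelP x :
  x \in (rad_kernel : {vspace M}) <->
  forall f : mhom M N, rad_hom f -> f x = 0.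
Proof.
split; last exact: sub_vspan.
move: x; apply: vspan_ind => // [f _|k x y Hx Hy f rf]; first exact: linear0.
by rewrite linearD linearZ /= Hx // Hy // scaler0 addr0.
Qed.

End RadicalTraces.

Definition mod_proj (P : rmod) : Prop :=
  forall (M N : rmod) (g : mhom M N) (f : mhom P N),
    limg g = fullv -> exists h : mhom P M, (g \o h)%VF = f.

Definition mod_indec (M : rmod) : Prop :=
  ~ mod_zero M /\
  forall V W : submodule M, (V + W)%VS = fullv -> (V :&: W)%VS = 0%VS ->
    (V : {vspace M}) = 0%VS \/ (W : {vspace M}) = 0%VS.

(* P_1, ..., P_n represent the isoclasses of indecomposable projectives; their *)
(* classes form a basis of K_0(proj A), so that n = |A|.                       *)
Definition indec_projectives (n : nat) (P : 'I_n -> rmod) : Prop :=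
  [/\ forall j, mod_proj (P j) /\ mod_indec (P j),
      forall i j, mod_iso (P i) (P j) -> i = j
    & forall Q, mod_proj Q -> mod_indec Q -> exists j, mod_iso Q (P j)].

Fact amulr_linear : linear (@amulr K A).
Proof. exact: linearP. Qed.

Fact amulr_one : @amulr K A 1 = \1%VF.
Proof. by apply/lfunP => x; rewrite lfunE /= mulr1 id_lfunE. Qed.

Fact amulr_mul a b : @amulr K A (a * b) = (amulr b \o amulr a)%VF.
Proof. by apply/lfunP => x; rewrite comp_lfunE !lfunE /= mulrA. Qed.

Definition reg_mod : rmod := RMod amulr_linear amulr_one amulr_mul.

Section Dual.
Variables (V W : vectType K) (f : 'Hom(V, W)).

Definition dual_fun (phi : 'Hom(W, K^o)) : 'Hom(V, K^o) := (phi \o f)%VF.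
Fact dual_fun_linear : linear dual_fun.
Proof. by move=> k x y; rewrite /dual_fun comp_lfunDl comp_lfunZl. Qed.
HB.instance Definition _ := GRing.isSemilinear.Build K _ _ _ dual_fun
  (GRing.semilinear_linear dual_fun_linear).

Definition dual_lfun : 'Hom('Hom(W, K^o), 'Hom(V, K^o)) := linfun dual_fun.
Lemma dual_lfunE phi : dual_lfun phi = (phi \o f)%VF.
Proof. by rewrite lfunE. Qed.

End Dual.

(* Hom_A(P, A) is a left A-module via (a f)(p) = a f(p); its K-dual [nak_mod P] *)
(* is the right A-module nu P, with (phi a)(f) = phi (a f).                      *)
Definition homA (P : rmod) : vectType K := subvs_of (hom_space P reg_mod).

Section LeftAction.
Variables (P : rmod) (a : A).

Definition homA_lact_fun (f : homA P) : homA P :=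
  vsproj _ (amull a \o (vsval f : 'Hom(P, reg_mod)))%VF.
Fact homA_lact_linear : linear homA_lact_fun.
Proof.
by move=> k x y; rewrite /homA_lact_fun linearP comp_lfunDr -comp_lfunZr linearP.
Qed.
HB.instance Definition _ := GRing.isSemilinear.Build K _ _ _ homA_lact_fun
  (GRing.semilinear_linear homA_lact_linear).
Definition homA_lact : 'End(homA P) := linfun homA_lact_fun.

Lemma val_homA_lact f p :
  (vsval (homA_lact f) : 'Hom(P, reg_mod)) p =
  a * (vsval f : 'Hom(P, reg_mod)) p :> A.
Proof.
rewrite lfunE /= /homA_lact_fun vsprojK; first by rewrite comp_lfunE lfunE.
apply: (@hom_spaceP P reg_mod _).2 => b v; rewrite !comp_lfunE.
have -> := (hom_spaceP _).1 (subvsP f) b v.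
by rewrite !lfunE /= mulrA.
Qed.

End LeftAction.

Section Precomposition.
Variables (P Q : rmod) (g : mhom P Q).

Definition homA_pre_fun (f : homA Q) : homA P :=
  vsproj _ ((vsval f : 'Hom(Q, reg_mod)) \o g)%VF.
Fact homA_pre_linear : linear homA_pre_fun.
Proof.
by move=> k x y; rewrite /homA_pre_fun linearP comp_lfunDl -comp_lfunZl linearP.
Qed.
HB.instance Definition _ := GRing.isSemilinear.Build K _ _ _ homA_pre_fun
  (GRing.semilinear_linear homA_pre_linear).
Definition homA_pre : 'Hom(homA Q, homA P) := linfun homA_pre_fun.

Lemma val_homA_pre f :
  vsval (homA_pre f) = ((vsval f : 'Hom(Q, reg_mod)) \o g)%VF.
Proof.
rewrite lfunE /= /homA_pre_fun vsprojK //; apply: (@hom_spaceP P reg_mod _).2.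
apply: is_mhom_comp; last exact: mhomP.
exact: (@hom_spaceP Q reg_mod _).1 (subvsP f).
Qed.

End Precomposition.

Section NakayamaModule.
Variable P : rmod.

Definition nak_ract (a : A) : 'End('Hom(homA P, K^o)) := dual_lfun (homA_lact P a).

Lemma homA_inj (f g : homA P) :
  (forall p, (vsval f : 'Hom(P, reg_mod)) p = (vsval g : 'Hom(P, reg_mod)) p) ->
  f = g.
Proof. by move=> H; apply/vsval_inj/lfunP. Qed.

Fact nak_ract_linear : linear nak_ract.
Proof.
move=> k a b; apply/lfunP => phi; apply/lfunP => f.
rewrite !(add_lfunE, scale_lfunE, dual_lfunE, comp_lfunE) -linearZ -linearD.
congr (phi _); apply: homA_inj => p.
rewrite val_homA_lact linearD linearZ /= add_lfunE scale_lfunE.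
by rewrite !val_homA_lact mulrDl scalerAl.
Qed.

Fact nak_ract1 : nak_ract 1 = \1%VF.
Proof.
apply/lfunP => phi; apply/lfunP => f; rewrite dual_lfunE comp_lfunE id_lfunE.
by congr (phi _); apply: homA_inj => p; rewrite val_homA_lact mul1r.
Qed.

Fact nak_ractM a b : nak_ract (a * b) = (nak_ract b \o nak_ract a)%VF.
Proof.
apply/lfunP => phi; apply/lfunP => f; rewrite !(dual_lfunE, comp_lfunE).
by congr (phi _); apply: homA_inj => p; rewrite !val_homA_lact mulrA.
Qed.

Definition nak_mod : rmod := RMod nak_ract_linear nak_ract1 nak_ractM.

End NakayamaModule.

Fact nak_hom_mhom (P Q : rmod) (g : mhom P Q) :
  @is_mhom (nak_mod P) (nak_mod Q) (dual_lfun (homA_pre g)).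
Proof.
move=> a phi; apply/lfunP => f; rewrite !(dual_lfunE, comp_lfunE).
congr (phi _); apply: homA_inj => p.
rewrite val_homA_lact !val_homA_pre !comp_lfunE.
by rewrite val_homA_lact.
Qed.

Definition nak_hom (P Q : rmod) (g : mhom P Q) : mhom (nak_mod P) (nak_mod Q) :=
  MHom (nak_hom_mhom g).

(* Differentials are indexed by pairs of degrees and vanish unless the second *)
(* degree is the successor of the first one.                                  *)
Record complex := Complex {
  cobj :> int -> rmod;
  cdiff : forall i j, mhom (cobj i) (cobj j);
  cdiff_shape : forall i j, j != i + 1 -> (cdiff i j : 'Hom(_, _)) = 0;
  cdiff2 : forall i j k, (cdiff j k \o cdiff i j)%VF = 0 }.
Arguments cdiff : clear implicits.

Definition is_cmap (C D : complex) (f : forall i, mhom (C i) (D i)) : Prop :=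
  forall i j, (f j \o cdiff C i j)%VF = (cdiff D i j \o f i)%VF.

Record cmap (C D : complex) := CMap {
  cfun :> forall i, mhom (C i) (D i);
  cmapP : is_cmap cfun }.

Definition homotopic (C D : complex) (f g : forall i, 'Hom(C i, D i)) : Prop :=
  exists h : forall i j, mhom (C i) (D j), forall i,
    f i - g i = (cdiff D (i - 1) i \o h i (i - 1))%VF
              + (h (i + 1) i \o cdiff C i (i + 1))%VF.

Definition cpx_iso (C D : complex) : Prop :=
  exists (f : cmap C D) (g : cmap D C),
    homotopic (fun i => g i \o f i)%VF (fun i => \1%VF) /\
    homotopic (fun i => f i \o g i)%VF (fun i => \1%VF).

Definition cpx_zero (C : complex) : Prop :=
  @homotopic C C (fun i => \1%VF) (fun i => 0).

(* Biproduct relations, up to homotopy. *)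
Definition is_direct_sum (I : finType) (U : complex) (V : I -> complex) : Prop :=
  exists (inj : forall i, cmap (V i) U) (pr : forall i, cmap U (V i)),
    [/\ forall i, homotopic (fun k => pr i k \o inj i k)%VF (fun k => \1%VF),
        forall i j, i != j ->
          homotopic (fun k => pr j k \o inj i k)%VF (fun k => 0)
      & homotopic (fun k => \sum_i (inj i k \o pr i k)%VF) (fun k => \1%VF)].

Section Shift.
Variables (l : int) (C : complex).

Definition shift_obj (i : int) : rmod := C (i + l).
Definition shift_diff i j : mhom (shift_obj i) (shift_obj j) :=
  MHom (is_mhomZ ((-1) ^+ `|l|%N) (mhomP (cdiff C (i + l) (j + l)))).

Fact shift_shape i j : j != i + 1 -> (shift_diff i j : 'Hom(_, _)) = 0.
Proof.
move=> ne; rewrite /= cdiff_shape ?scaler0 //.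
by rewrite addrAC (inj_eq (addIr l)).
Qed.

Fact shift_diff2 i j k : (shift_diff j k \o shift_diff i j)%VF = 0.
Proof. by rewrite /= -comp_lfunZl -comp_lfunZr cdiff2 !scaler0. Qed.

Definition shift : complex := Complex shift_shape shift_diff2.

End Shift.

Definition cohomology (k : int) (C : complex) : rmod :=
  let Z := ker_sub (cdiff C k (k + 1)) in
  let B := img_sub (cdiff C (k - 1) k) in
  factor_mod (preim_sub (sub_incl Z) B).

Section NakayamaComplex.
Variable C : complex.

Definition nak_obj (i : int) : rmod := nak_mod (C i).
Definition nak_diff i j : mhom (nak_obj i) (nak_obj j) := nak_hom (cdiff C i j).

Fact nak_shape i j : j != i + 1 -> (nak_diff i j : 'Hom(_, _)) = 0.
Proof.
move=> ne; apply/lfunP => phi; apply/lfunP => f.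
rewrite dual_lfunE comp_lfunE !zero_lfunE.
suff -> : homA_pre (cdiff C i j) f = 0 by rewrite linear0.
by apply: vsval_inj; rewrite val_homA_pre cdiff_shape // comp_lfun0r linear0.
Qed.

Fact nak_diff2 i j k : (nak_diff j k \o nak_diff i j)%VF = 0.
Proof.
apply/lfunP => phi; apply/lfunP => f.
rewrite !(dual_lfunE, comp_lfunE) !zero_lfunE.
suff -> : homA_pre (cdiff C i j) (homA_pre (cdiff C j k) f) = 0.
  by rewrite linear0.
apply: vsval_inj.
by rewrite !val_homA_pre -comp_lfunA cdiff2 comp_lfun0r linear0.
Qed.

Definition nak_complex : complex := Complex nak_shape nak_diff2.

End NakayamaComplex.

Record kproj := KProj {
  kcpx :> complex;
  kproj_proj : forall i, mod_proj (kcpx i);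
  kproj_bounded : exists b : nat, forall i : int,
    (b < `|i|)%N -> mod_zero (kcpx i) }.

Definition presilting (U : kproj) : Prop :=
  forall l : int, 1 <= l -> forall f : cmap U (shift l U),
    homotopic (fun i => f i : 'Hom(_, _)) (fun i => 0).

Definition two_term (U : kproj) : Prop :=
  exists C : kproj, cpx_iso U C /\
    forall i : int, i != - 1 -> i != 0 -> mod_zero (C i).

Definition indecomposable (U : kproj) : Prop :=
  ~ cpx_zero U /\
  forall V : bool -> kproj, is_direct_sum U V -> exists b, cpx_zero (V b).

(* By Krull-Schmidt, one such decomposition has this property iff all have. *)
Definition basic (U : kproj) : Prop :=
  forall (m : nat) (V : 'I_m -> kproj), (forall i, indecomposable (V i)) ->
    is_direct_sum U V -> forall i j, cpx_iso (V i) (V j) -> i = j.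

Definition two_psilt (U : kproj) : Prop :=
  [/\ basic U, two_term U & presilting U].

End Modules.

Section Faces.
Variables (R : realType) (n : nat).
Implicit Types C F : set 'rV[R]_n.

Definition face C F : Prop :=
  exists l : 'Hom('rV[R]_n, R^o),
    (forall x, C x -> 0 <= l x :> R) /\ F = [set x | C x /\ l x = 0].

Definition facet C : set (set 'rV[R]_n) :=
  [set F | face C F /\ (\dim (vspan F)).+1 = n].

End Faces.

Section Cones.
Variables (K : fieldType) (A : falgType K) (R : realType).
Variables (n : nat) (P : 'I_n -> rmod A).
(* theta stands for the element sum_j theta_j [P_j] of K_0(proj A) (x) R. *)
Implicit Types (theta : 'rV[R]_n) (M : rmod A).

Definition pairing theta M : R :=
  \sum_j theta 0 j * (\dim (hom_space (P j) M))%:R.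

Definition Tbar theta M : Prop :=
  forall V : submodule M, ~ mod_zero (factor_mod V) ->
    0 <= pairing theta (factor_mod V).

Definition Tors theta M : Prop :=
  forall V : submodule M, ~ mod_zero (factor_mod V) ->
    0 < pairing theta (factor_mod V).

Definition Fbar theta M : Prop :=
  forall V : submodule M, ~ mod_zero (sub_mod V) ->
    pairing theta (sub_mod V) <= 0.

Definition Free theta M : Prop :=
  forall V : submodule M, ~ mod_zero (sub_mod V) ->
    pairing theta (sub_mod V) < 0.

Definition H0 (U : complex A) : rmod A := cohomology 0 U.
Definition Hm1nu (U : complex A) : rmod A := cohomology (- 1) (nak_complex U).

Definition Dcone (U : complex A) : set 'rV[R]_n :=
  [set theta | Tbar theta (H0 U) /\ Fbar theta (Hm1nu U)].

(* Y_i^+ and X_i^-, where [Ui] is U_i. *)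
Definition Yplus (U Ui : complex A) : rmod A :=
  factor_mod (rad_image (H0 U) (H0 Ui)).

Definition Xminus (U Ui : complex A) : rmod A :=
  sub_mod (rad_kernel (Hm1nu Ui) (Hm1nu U)).

(* The sign + is encoded by [true] and - by [false]. *)
Definition boundary (U Ui : complex A) (eps : bool) : set 'rV[R]_n :=
  [set theta | Dcone U theta /\
     if eps then ~ Tors theta (Yplus U Ui) else ~ Free theta (Xminus U Ui)].

Definition facet_part (U Ui : complex A) (eps : bool) : set (set 'rV[R]_n) :=
  [set F | facet (Dcone U) F /\ F `<=` boundary U Ui eps].

End Cones.

(* Main.v *)
Require Import Defs.
From HB Require Import structures.
From mathcomp Require Import all_boot all_order all_algebra all_field.
From mathcomp Require Import boolp classical_sets reals.
From mathcomp Require Import zify ring lra.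

(** Write M, N for the modules [H0 U], [Hm1nu U], and M_i, N_i for those of U_i.
    Three facts about them carry the proof.

    (a) Hom(M, N) = 0.
    (b) There are vectors g_i, the classes of the U_i, such that every module X
        satisfies <g_i, X> = dim Hom(M_i, X) - dim Hom(X, N_i).
    (c) For i <> j all maps M_j -> M_i and N_i -> N_j are radical.

    Existence. If theta lies in D(U) and some nonzero quotient X of M pairs to 0
    with theta, then so does a nonzero quotient of some Y_i^+: it is the image
    of a suitable map M_i -> X that kills the radical image [not_Tors_top].
    Dually, submodules of N give submodules of some X_i^- [not_Free_socle]. A
    facet F contains a generic point theta, where no quotient of M and no
    submodule of N pairs to 0 unless it does so on all of F [generic_point]. As
    theta is not interior to D(U), some module pairs to 0 with it
    [facet_touches]; the one found below Y_i^+ or X_i^- then pairs to 0 with all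
    of F, which places F in a part of the boundary [facet_in_wall].

    Uniqueness. If F lies in the part with index (i, +), a generic theta in F has
    a quotient X = M_i / V of Y_i^+ that pairs to 0 with it and satisfies
    Hom(V, N) = 0 [semistable_top_quotient]. Counting dimensions with (a), (b)
    and (c) gives <g_i, X> > 0, and <g_j, X> = 0 for j <> i [top_quotient_values].
    For (i, -) there is a submodule of X_i^- with <g_i, X> < 0 instead. The
    dimension vector of X is orthogonal to F, so it is determined by F up to a
    positive factor, and it determines i and the sign [facet_in_one_wall].

    The facts. Each U_i is equivalent to a complex C of projectives in degrees -1
    and 0, by the Fitting decomposition of a chain map that is idempotent up to
    homotopy [summand_equiv_subcomplex]. The duality between Hom(P, X) and
    Hom(X, nu P), for P projective, identifies Hom(X, Hm1nu C) with the dual of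
    the cokernel of Hom(C 0, X) -> Hom(C (-1), X). This gives (b), as the class
    of a projective module determines the dimension of its maps to X
    [hdim_euler], [proj_class]; and it gives (a), as the presilting condition
    makes this cokernel vanish for X = H0 C [presilting_hdim]. For (c), both
    functors are full on such complexes [H0_full], [Hm1nu_full], and an
    endomorphism of an indecomposable complex is nilpotent or invertible up to
    homotopy [indecomposable_dichotomy]; so the composite of two maps between
    non-isomorphic U_i and U_j, in opposite directions, is nilpotent
    [hmap_nilpotent]. *)

Set Implicit Arguments.
Unset Strict Implicit.
Unset Printing Implicit Defensive.

Import Order.TTheory GRing.Theory Num.Theory.
Local Open Scope classical_set_scope.
Local Open Scope ring_scope.

(** * Linear maps *)
Section LinearAlgebra.
Variables (K : fieldType).
Implicit Types V W X : vectType K.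

Section Composition.
Variables (V W X : vectType K).

Definition lcomp_fun (g : 'Hom(V, W)) (h : 'Hom(X, V)) : 'Hom(X, W) := (g \o h)%VF.
Fact lcomp_fun_linear g : linear (lcomp_fun g).
Proof. by move=> k x y; rewrite /lcomp_fun comp_lfunDr comp_lfunZr. Qed.
HB.instance Definition _ g := GRing.isSemilinear.Build K _ _ _ (lcomp_fun g)
  (GRing.semilinear_linear (lcomp_fun_linear g)).
Definition lcomp g := linfun (lcomp_fun g).
Lemma lcompE g h : lcomp g h = (g \o h)%VF.
Proof. by rewrite lfunE. Qed.

Definition rcomp_fun (f : 'Hom(V, W)) (h : 'Hom(W, X)) : 'Hom(V, X) := (h \o f)%VF.
Fact rcomp_fun_linear f : linear (rcomp_fun f).
Proof. by move=> k x y; rewrite /rcomp_fun comp_lfunDl comp_lfunZl. Qed.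
HB.instance Definition _ f := GRing.isSemilinear.Build K _ _ _ (rcomp_fun f)
  (GRing.semilinear_linear (rcomp_fun_linear f)).
Definition rcomp f := linfun (rcomp_fun f).
Lemma rcompE f h : rcomp f h = (h \o f)%VF.
Proof. by rewrite lfunE. Qed.

End Composition.

Lemma lfun_factor V W X (t : 'Hom(V, W)) (f : 'Hom(V, X)) :
  (lker t <= lker f)%VS -> exists f' : 'Hom(W, X), (f' \o t)%VF = f.
Proof.
move=> /subvP sub; exists (f \o t^-1)%VF; apply/lfunP => v.
rewrite !comp_lfunE; apply/eqP; rewrite -subr_eq0 -linearB -memv_ker; apply: sub.
by rewrite memv_ker linearB /= limg_lfunVK ?memv_img ?memvf // subrr.
Qed.

Lemma lker_eq0P V W (f : 'Hom(V, W)) :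
  lker f = 0%VS <-> forall x, f x = 0 -> x = 0.
Proof.
split=> [f0 x fx|H]; first by apply/eqP; rewrite -memv0 -f0 memv_ker fx.
by apply/eqP; rewrite -subv0; apply/subvP => x; rewrite memv_ker memv0 => /eqP/H ->.
Qed.

Lemma limg_fullP V W (f : 'Hom(V, W)) :
  limg f = fullv <-> forall y, exists x, f x = y.
Proof.
split=> [f1 y|H]; first by have := memvf y; rewrite -f1 => /memv_imgP[x _ ->]; exists x.
by apply/vspaceP => y; rewrite memvf; have [x <-] := H y; rewrite memv_img ?memvf.
Qed.

End LinearAlgebra.

(** * Modules and short exact sequences *)
Section Modules.
Variables (K : fieldType) (A : falgType K).
Local Notation rmod := (rmod A).
Implicit Types L M N X Y Q : rmod.

Definition idm M : mhom M M := MHom (@is_mhom1 _ _ M).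
Definition compm L M N (g : mhom M N) (f : mhom L M) : mhom L N :=
  MHom (is_mhom_comp (mhomP g) (mhomP f)).
Definition zerom M N : mhom M N := MHom (@is_mhom0 _ _ M N).
Definition linm M N k (f g : mhom M N) : mhom M N :=
  MHom (is_mhom_lin k (mhomP f) (mhomP g)).

Lemma mem_hom M N (f : mhom M N) : (f : 'Hom(M, N)) \in hom_space M N.
Proof. by apply/hom_spaceP/mhomP. Qed.

Lemma hom_mhom M N (f : 'Hom(M, N)) :
  f \in hom_space M N -> exists f' : mhom M N, (f' : 'Hom(M, N)) = f.
Proof. by move=> /hom_spaceP h; exists (MHom h). Qed.

Lemma is_mhom_sum M N (I : Type) (r : seq I) (p : pred I) (f : I -> 'Hom(M, N)) :
  (forall i, is_mhom (f i)) -> is_mhom (\sum_(i <- r | p i) f i).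
Proof.
move=> h; apply/hom_spaceP; apply: memv_suml => i _; exact/hom_spaceP.
Qed.

Lemma is_mhomN M N (f : 'Hom(M, N)) : is_mhom f -> is_mhom (- f).
Proof. by move=> h; apply/hom_spaceP; rewrite memvN; apply/hom_spaceP. Qed.

Lemma is_mhomD M N (f g : 'Hom(M, N)) : is_mhom f -> is_mhom g -> is_mhom (f + g).
Proof. by move=> hf hg; apply/hom_spaceP; apply: memvD; apply/hom_spaceP. Qed.

Lemma is_mhomB M N (f g : 'Hom(M, N)) : is_mhom f -> is_mhom g -> is_mhom (f - g).
Proof. by move=> hf hg; apply: is_mhomD => //; apply: is_mhomN. Qed.

Lemma mod_zeroP M : mod_zero M <-> forall x : M, x = 0.
Proof.
split=> [z x|z]; first by apply/eqP; rewrite -memv0 -z memvf.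
by apply/vspaceP => x; rewrite (z x) !mem0v.
Qed.

Lemma mhom_lift_inj L M Q (f : mhom L M) (h : mhom Q M) :
  lker f = 0%VS -> (limg h <= limg f)%VS ->
  exists h' : mhom Q L, (f \o h')%VF = h.
Proof.
move=> /lker_eq0P f0 /subvP hf.
have fK x : f ((f^-1)%VF (h x)) = h x by rewrite limg_lfunVK // hf // memv_img ?memvf.
have P : @is_mhom _ _ Q L (f^-1 \o h)%VF.
  move=> a v; rewrite !comp_lfunE; apply/eqP; rewrite -subr_eq0; apply/eqP; apply: f0.
  by rewrite linearB /= fK !mhomP fK subrr.
by exists (MHom P); apply/lfunP => x; rewrite !comp_lfunE fK.
Qed.

Lemma mhom_factor_surj L M Q (g : mhom L M) (h : mhom L Q) :
  limg g = fullv -> (lker g <= lker h)%VS ->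
  exists h' : mhom M Q, (h' \o g)%VF = h.
Proof.
move=> /limg_fullP g1 /lfun_factor[h' E].
have E' x : h' (g x) = h x by rewrite -E comp_lfunE.
have P : @is_mhom _ _ M Q h'.
  by move=> a v; have [x <-] := g1 v; rewrite -mhomP !E' mhomP.
by exists (MHom P).
Qed.

Lemma limg_factor_proj M (V : submodule M) : limg (factor_proj V) = fullv.
Proof. by apply/limg_fullP => y; exists (vsval y); exact: factor_lfunK. Qed.

Lemma lker_factor_proj M (V : submodule M) : lker (factor_proj V) = V.
Proof. exact: lker_factor_lfun. Qed.

Lemma sub_inclE M (V : submodule M) (x : sub_mod V) : sub_incl V x = vsval x.
Proof. by rewrite lfunE. Qed.

Lemma lker_sub_incl M (V : submodule M) : lker (sub_incl V) = 0%VS.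
Proof. by apply/lker_eq0P => x; rewrite sub_inclE => h; apply: vsval_inj. Qed.

Lemma limg_sub_incl M (V : submodule M) : limg (sub_incl V) = V.
Proof.
apply/vspaceP => x; apply/memv_imgP/idP => [[u _ ->]|Vx].
  by rewrite sub_inclE subvsP.
by exists (vsproj V x); rewrite ?memvf // sub_inclE vsprojK.
Qed.

Lemma mhom_corestrict M X (g : mhom M X) :
  exists2 g' : mhom M (sub_mod (img_sub g)),
    (sub_incl (img_sub g) \o g')%VF = g & limg g' = fullv.
Proof.
have [|g' E] := @mhom_lift_inj _ _ _ (sub_incl (img_sub g)) g (lker_sub_incl _).
  by rewrite limg_sub_incl.
exists g' => //; apply/limg_fullP => y.
have := subvsP y; rewrite /= => /memv_imgP[x _ yx]; exists x.
apply: vsval_inj; rewrite yx; move/lfunP: E => /(_ x) <-; rewrite comp_lfunE.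
by rewrite lfunE.
Qed.

Definition short_exact L M N (f : mhom L M) (g : mhom M N) :=
  [/\ lker f = 0%VS, limg f = lker g & limg g = fullv].

Lemma short_exact_ker M N (g : mhom M N) :
  limg g = fullv -> short_exact (sub_incl (ker_sub g)) g.
Proof. by split; rewrite ?lker_sub_incl ?limg_sub_incl. Qed.

Lemma short_exact_factor M (V : submodule M) :
  short_exact (sub_incl V) (factor_proj V).
Proof.
by split; rewrite ?lker_sub_incl ?limg_sub_incl ?lker_factor_proj ?limg_factor_proj.
Qed.

Lemma short_exact_coker L M (f : mhom L M) :
  lker f = 0%VS -> short_exact f (factor_proj (img_sub f)).
Proof. by split; rewrite ?lker_factor_proj ?limg_factor_proj. Qed.

Local Notation hdim M N := (\dim (hom_space M N)).

(** The second summand is the rank of Hom(Q, M) -> Hom(Q, N). Projectivity of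
    [Q] turns it into the dimension of Hom(Q, N), see [hdim_proj_exact]. *)
Lemma hdim_left_exact Q L M N (f : mhom L M) (g : mhom M N) :
  lker f = 0%VS -> limg f = lker g ->
  hdim Q M = (hdim Q L + \dim (lcomp Q g @: hom_space Q M))%N.
Proof.
move=> f0 fg; rewrite -(limg_ker_dim (lcomp Q g) (hom_space Q M)); congr (_ + _)%N.
have -> : (hom_space Q M :&: lker (lcomp Q g))%VS = (lcomp Q f @: hom_space Q L)%VS.
  apply/vspaceP => h; rewrite memv_cap memv_ker lcompE; apply/andP/memv_imgP.
    move=> [/hom_mhom[h' <-] /eqP E].
    have [|k kE] := @mhom_lift_inj _ _ _ f h' f0.
      rewrite fg; apply/subvP => _ /memv_imgP[x _ ->].
      by rewrite memv_ker -comp_lfunE E zero_lfunE.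
    by exists (mfun k); rewrite ?mem_hom // lcompE.
  move=> [k /hom_mhom[k' <-] ->]; rewrite lcompE.
  split; first exact: (mem_hom (compm f k')).
  apply/eqP/lfunP => x; rewrite !comp_lfunE zero_lfunE; apply/eqP.
  by rewrite -memv_ker -fg memv_img ?memvf.
apply: limg_dim_eq; apply/eqP; rewrite -subv0; apply/subvP => k.
rewrite memv_cap memv_ker lcompE memv0 => /andP[_ /eqP E]; apply/eqP/lfunP => x.
by rewrite zero_lfunE; apply: ((lker_eq0P f).1 f0); rewrite -comp_lfunE E zero_lfunE.
Qed.

Lemma hdim_right_exact Q L M N (f : mhom L M) (g : mhom M N) :
  limg f = lker g -> limg g = fullv ->
  hdim M Q = (hdim N Q + \dim (rcomp Q f @: hom_space M Q))%N.
Proof.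
move=> fg g1; rewrite -(limg_ker_dim (rcomp Q f) (hom_space M Q)); congr (_ + _)%N.
have -> : (hom_space M Q :&: lker (rcomp Q f))%VS = (rcomp Q g @: hom_space N Q)%VS.
  apply/vspaceP => h; rewrite memv_cap memv_ker rcompE; apply/andP/memv_imgP.
    move=> [/hom_mhom[h' <-] /eqP E].
    have [|k kE] := @mhom_factor_surj _ _ _ g h' g1.
      rewrite -fg; apply/subvP => _ /memv_imgP[x _ ->].
      by rewrite memv_ker -comp_lfunE E zero_lfunE.
    by exists (mfun k); rewrite ?mem_hom // rcompE.
  move=> [k /hom_mhom[k' <-] ->]; rewrite rcompE.
  split; first exact: (mem_hom (compm k' g)).
  apply/eqP/lfunP => x; rewrite !comp_lfunE zero_lfunE.
  have /eqP -> : g (f x) == 0 by rewrite -memv_ker -fg memv_img ?memvf.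
  exact: linear0.
apply: limg_dim_eq; apply/eqP; rewrite -subv0; apply/subvP => k.
rewrite memv_cap memv_ker rcompE memv0 => /andP[_ /eqP E]; apply/eqP/lfunP => y.
have [x <-] := (limg_fullP g).1 g1 y.
by rewrite zero_lfunE -comp_lfunE E zero_lfunE.
Qed.

Lemma hdim_proj_exact Q L M N (f : mhom L M) (g : mhom M N) :
  mod_proj Q -> short_exact f g -> hdim Q M = (hdim Q L + hdim Q N)%N.
Proof.
move=> Qp [f0 fg g1]; rewrite (hdim_left_exact Q f0 fg); congr (_ + \dim _)%N.
apply/vspaceP => h; apply/memv_imgP/idP => [[k /hom_mhom[k' <-] ->]|/hom_mhom[h' <-]].
  by rewrite lcompE; exact: (mem_hom (compm g k')).
by have [k kE] := Qp _ _ g h' g1; exists (mfun k); rewrite ?mem_hom // lcompE.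
Qed.

Lemma hdim_zeroP M N : hdim M N = 0%N <-> forall f : mhom M N, (f : 'Hom(M, N)) = 0.
Proof.
split=> [/eqP|H].
  rewrite dimv_eq0 => /eqP E f; apply/eqP; rewrite -memv0 -E; exact: mem_hom.
apply/eqP; rewrite dimv_eq0 -subv0; apply/subvP => f /hom_mhom[f' <-].
by rewrite H mem0v.
Qed.

Lemma hdim_isoR Q M N : mod_iso M N -> hdim Q M = hdim Q N.
Proof.
have le M' N' (f : mhom M' N') (g : mhom N' M') :
    (g \o f)%VF = \1%VF -> (hdim Q M' <= hdim Q N')%N.
  move=> gf; rewrite -(@limg_dim_eq _ _ _ (lcomp Q f)).
    apply: dimvS; apply/subvP => _ /memv_imgP[k /hom_mhom[k' <-] ->].
    by rewrite lcompE; exact: (mem_hom (compm f k')).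
  apply/eqP; rewrite -subv0; apply/subvP => k.
  rewrite memv_cap memv_ker lcompE memv0 => /andP[_ /eqP E].
  by rewrite -[k]comp_lfun1l -gf -comp_lfunA E comp_lfun0r.
by move=> [f [g [gf fg]]]; apply/eqP; rewrite eqn_leq (le _ _ f g) ?(le _ _ g f).
Qed.

Lemma hdim_isoL Q M N : mod_iso M N -> hdim M Q = hdim N Q.
Proof.
have le M' N' (f : mhom M' N') (g : mhom N' M') :
    (g \o f)%VF = \1%VF -> (hdim M' Q <= hdim N' Q)%N.
  move=> gf; rewrite -(@limg_dim_eq _ _ _ (rcomp Q g)).
    apply: dimvS; apply/subvP => _ /memv_imgP[k /hom_mhom[k' <-] ->].
    by rewrite rcompE; exact: (mem_hom (compm k' g)).
  apply/eqP; rewrite -subv0; apply/subvP => k.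
  rewrite memv_cap memv_ker rcompE memv0 => /andP[_ /eqP E].
  by rewrite -[k]comp_lfun1r -gf comp_lfunA E comp_lfun0l.
by move=> [f [g [gf fg]]]; apply/eqP; rewrite eqn_leq (le _ _ f g) ?(le _ _ g f).
Qed.

Lemma mhom_inverse M N (f : mhom M N) :
  lker f = 0%VS -> limg f = fullv ->
  exists g : mhom N M, (g \o f)%VF = \1%VF /\ (f \o g)%VF = \1%VF.
Proof.
move=> f0 f1; have [|g gE] := @mhom_lift_inj _ _ _ f (idm N) f0.
  by rewrite f1 subvf.
exists g; split=> //; apply/lfunP => x; apply/eqP; rewrite -subr_eq0; apply/eqP.
apply: ((lker_eq0P f).1 f0); rewrite linearB /= -[X in X - _]comp_lfunE comp_lfunA gE.
by rewrite comp_lfun1l id_lfunE subrr.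
Qed.

Lemma bij_mod_iso M N (f : mhom M N) :
  lker f = 0%VS -> limg f = fullv -> mod_iso M N.
Proof. by move=> f0 f1; have [g gf] := mhom_inverse f0 f1; exists f, g. Qed.

(** * Stability conditions as statements about quotients and submodules *)
Section Stability.
Variables (R : realType) (n : nat) (P : 'I_n -> rmod).
Hypothesis Pp : forall j, mod_proj (P j).
Implicit Type theta : 'rV[R]_n.

Lemma pairing_iso theta M N : mod_iso M N -> pairing P theta M = pairing P theta N.
Proof. by move=> MN; apply: eq_bigr => j _; rewrite (hdim_isoR _ MN). Qed.

Lemma pairing_zero theta M : mod_zero M -> pairing P theta M = 0.
Proof.
move=> /mod_zeroP M0; rewrite /pairing big1 // => j _.
suff -> : hdim (P j) M = 0%N by rewrite mulr0.
by apply/hdim_zeroP => f; apply/lfunP => x; rewrite [LHS]M0 [RHS]M0.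
Qed.

Lemma pairing_exact theta L M N (f : mhom L M) (g : mhom M N) :
  short_exact f g -> pairing P theta M = pairing P theta L + pairing P theta N.
Proof.
move=> e; rewrite /pairing -big_split /=; apply: eq_bigr => j _.
by rewrite (hdim_proj_exact (@Pp j) e) natrD mulrDr.
Qed.

Lemma factor_iso M N (V : submodule M) (p : mhom M N) :
  limg p = fullv -> lker p = V -> mod_iso (factor_mod V) N.
Proof.
move=> p1 pV.
have [|q qE] := @mhom_factor_surj _ _ _ (factor_proj V) p (limg_factor_proj V).
  by rewrite lker_factor_proj pV.
have qE' x : q (factor_proj V x) = p x by rewrite -qE comp_lfunE.
apply: (@bij_mod_iso _ _ q); last first.
  by apply/limg_fullP => y; have [x <-] := (limg_fullP p).1 p1 y; exists (factor_proj V x).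
apply/lker_eq0P => y; have [x <-] := (limg_fullP _).1 (limg_factor_proj V) y.
rewrite qE' => /eqP; rewrite -memv_ker pV => Vx; apply/eqP.
by rewrite -memv_ker lker_factor_proj.
Qed.

Lemma sub_iso M N (V : submodule M) (j : mhom N M) :
  lker j = 0%VS -> limg j = V -> mod_iso N (sub_mod V).
Proof.
move=> j0 jV.
have [|q qE] := @mhom_lift_inj _ _ _ (sub_incl V) j (lker_sub_incl V).
  by rewrite limg_sub_incl jV.
have qE' x : sub_incl V (q x) = j x by rewrite -qE comp_lfunE.
apply: (@bij_mod_iso _ _ q).
  by apply/lker_eq0P => x qx; apply: ((lker_eq0P j).1 j0); rewrite -qE' qx linear0.
apply/limg_fullP => y; have : vsval y \in limg j by rewrite jV subvsP.
move=> /memv_imgP[x _ yx]; exists x.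
by apply: vsval_inj; rewrite yx -qE' lfunE.
Qed.

Lemma mod_zero_iso M N : mod_iso M N -> mod_zero M -> mod_zero N.
Proof.
move=> [f [g [_ fg]]] /mod_zeroP M0; apply/mod_zeroP => y.
by rewrite -[y]id_lfunE -fg comp_lfunE (M0 (g y)) linear0.
Qed.

(** The definitions quantify over the models [factor_mod V] and [sub_mod V].
    The pairing only depends on the isomorphism class, so arbitrary surjections
    and injections do as well; those can be composed. *)
Lemma TbarP theta M : Tbar P theta M <->
  forall X (p : mhom M X), limg p = fullv -> 0 <= pairing P theta X.
Proof.
split=> [H X p p1|H V _]; last exact: H (limg_factor_proj V).
have iso := @factor_iso _ _ (ker_sub p) p p1 erefl; rewrite -(pairing_iso _ iso).
have [/pairing_zero ->//|] := pselect (mod_zero (factor_mod (ker_sub p))); exact: H.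
Qed.

Lemma FbarP theta M : Fbar P theta M <->
  forall Y (j : mhom Y M), lker j = 0%VS -> pairing P theta Y <= 0.
Proof.
split=> [H X p p1|H V _]; last exact: H (lker_sub_incl V).
have iso := @sub_iso _ _ (img_sub p) p p1 erefl; rewrite (pairing_iso _ iso).
have [/pairing_zero ->//|] := pselect (mod_zero (sub_mod (img_sub p))); exact: H.
Qed.

(** Quotients of M / W are the quotients of M whose kernel contains W. *)
Lemma not_TorsP theta M (W : submodule M) : ~ Tors P theta (factor_mod W) <->
  exists X (p : mhom M X), [/\ limg p = fullv, (W <= lker p)%VS, ~ mod_zero X &
    pairing P theta X <= 0].
Proof.
split=> [/existsNP[V /not_implyP[V0 /negP]]|[X [p [p1 Wp X0 pX]]] T].
  rewrite -leNgt => VX; exists (factor_mod V), (compm (factor_proj V) (factor_proj W)).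
  split=> //=.
    apply/limg_fullP => y; have [z zE] := (limg_fullP _).1 (limg_factor_proj V) y.
    have [x xE] := (limg_fullP _).1 (limg_factor_proj W) z; exists x.
    by rewrite comp_lfunE /= -zE -xE.
  apply/subvP => x Wx; rewrite memv_ker comp_lfunE.
  by move: Wx; rewrite -{1}(lker_factor_proj W) memv_ker => /eqP ->; rewrite linear0.
have [|q qE] := @mhom_factor_surj _ _ _ (factor_proj W) p (limg_factor_proj W).
  by rewrite lker_factor_proj.
have q1 : limg q = fullv.
  apply/limg_fullP => y; have [x <-] := (limg_fullP _).1 p1 y; exists (factor_proj W x).
  by rewrite -qE comp_lfunE.
have iso := @factor_iso _ _ (ker_sub q) q q1 erefl.
suff: 0 < pairing P theta X by rewrite ltNge pX.
by rewrite -(pairing_iso _ iso); apply: T => /(mod_zero_iso iso).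
Qed.

Lemma not_FreeP theta M (W : submodule M) : ~ Free P theta (sub_mod W) <->
  exists Y (j : mhom Y M), [/\ lker j = 0%VS, (limg j <= W)%VS, ~ mod_zero Y &
    0 <= pairing P theta Y].
Proof.
split=> [/existsNP[V /not_implyP[V0 /negP]]|[X [p [p1 Wp X0 pX]]] T].
  rewrite -leNgt => VX; exists (sub_mod V), (compm (sub_incl W) (sub_incl V)).
  split=> //=.
    apply/lker_eq0P => x; rewrite comp_lfunE => /((lker_eq0P _).1 (lker_sub_incl W)).
    exact: ((lker_eq0P _).1 (lker_sub_incl V)).
  apply/subvP => _ /memv_imgP[x _ ->]; rewrite comp_lfunE /= lfunE; exact: subvsP.
have [|q qE] := @mhom_lift_inj _ _ _ (sub_incl W) p (lker_sub_incl W).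
  by rewrite limg_sub_incl.
have q0 : lker q = 0%VS.
  by apply/lker_eq0P => x qx; apply: ((lker_eq0P _).1 p1); rewrite -qE comp_lfunE qx linear0.
have iso := @sub_iso _ _ (img_sub q) q q0 erefl.
suff: pairing P theta X < 0 by rewrite ltNge pX.
rewrite (pairing_iso _ iso); apply: T => z; apply: X0; apply: (mod_zero_iso _ z).
by have [f [g [fg gf]]] := iso; exists g, f.
Qed.

End Stability.
End Modules.

(** * Functionals *)
Section Functionals.
Variables (K : fieldType).
Implicit Types V W : vectType K.

Lemma dim_functionals V : dim 'Hom(V, K^o) = dim V.
Proof. exact: muln1. Qed.

Definition annihilator V (S : {vspace V}) : {vspace 'Hom(V, K^o)} :=
  lker (rcomp K^o (linfun (@vsval K V S))).

Lemma annihilatorP V (S : {vspace V}) (psi : 'Hom(V, K^o)) :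
  psi \in annihilator S <-> forall x, x \in S -> psi x = 0.
Proof.
rewrite memv_ker rcompE; split=> [/eqP E x Sx|H].
  have /lfunP/(_ (vsproj S x)) := E.
  by rewrite comp_lfunE lfunE /= vsprojK // zero_lfunE.
by apply/eqP/lfunP => u; rewrite comp_lfunE lfunE /= zero_lfunE H ?subvsP.
Qed.

Lemma dim_annihilator V (S : {vspace V}) :
  (\dim (annihilator S) + \dim S)%N = dim V.
Proof.
set i := linfun (@vsval K V S).
have e1 : limg (rcomp K^o i) = fullv.
  apply/limg_fullP => f; have [|g gE] := @lfun_factor _ _ _ _ i f.
    suff -> : lker i = 0%VS by rewrite sub0v.
    by apply/lker_eq0P => x; rewrite lfunE => h; apply: vsval_inj.
  by exists g; rewrite rcompE.
have := limg_ker_dim (rcomp K^o i) fullv.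
by rewrite capfv e1 !dimvf !dim_functionals => <-.
Qed.

Lemma functional_separates V (x : V) : (forall psi : 'Hom(V, K^o), psi x = 0) -> x = 0.
Proof.
move=> H; rewrite (coord_vbasis (memvf x)) big1 // => i _.
have := H (linfun (coord (vbasis {:V}) i : V -> K^o)).
by rewrite lfunE /= => ->; rewrite scale0r.
Qed.

Lemma double_dual V (L : 'Hom('Hom(V, K^o), K^o)) :
  exists v : V, forall psi, L psi = psi v.
Proof.
pose c i := linfun (coord (vbasis {:V}) i : V -> K^o).
exists (\sum_(i < \dim {:V}) L (c i) *: (vbasis {:V})`_i) => psi.
have -> : psi = \sum_(i < \dim {:V}) psi (vbasis {:V})`_i *: c i.
  apply/lfunP => x; rewrite [in LHS](coord_vbasis (memvf x)) linear_sum sum_lfunE.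
  apply: eq_bigr => i _; rewrite linearZ scale_lfunE lfunE /=.
  by rewrite -[LHS]/(_ * _) mulrC.
rewrite linear_sum sum_lfunE; apply: eq_bigr => i _.
rewrite linearZ scale_lfunE linear_sum /=; congr (_ *: _).
rewrite (bigD1 i) //= big1 ?addr0 => [|j ji].
  rewrite linearZ /= lfunE /= coord_free ?eqxx ?(basis_free (vbasisP _)) //.
  by rewrite -[RHS]/(_ * _) mulr1.
rewrite linearZ /= lfunE /= coord_free ?(basis_free (vbasisP _)) //.
by move: ji; rewrite -val_eqE eq_sym => /negPf ->; rewrite scaler0.
Qed.

End Functionals.

(** * Direct summands, and functionals on Hom(P, X) *)
Section ProjectiveModules.
Variables (K : fieldType) (A : falgType K).
Local Notation rmod := (rmod A).
Implicit Types M N X Y P Q : rmod.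
Local Notation hdim M N := (\dim (hom_space M N)).

Lemma mod_proj_retract P Q (i : mhom Q P) (p : mhom P Q) :
  mod_proj P -> (p \o i)%VF = \1%VF -> mod_proj Q.
Proof.
move=> Pp pi M N g f g1; have [h hE] := Pp _ _ g (compm f p) g1.
exists (compm h i); rewrite /= comp_lfunA hE /= -comp_lfunA pi.
exact: comp_lfun1r.
Qed.

Lemma complement_bijective M (V W : submodule M) (f := compm (factor_proj W) (sub_incl V)) :
  (V + W)%VS = fullv -> (V :&: W)%VS = 0%VS -> lker f = 0%VS /\ limg f = fullv.
Proof.
move=> VW1 VW0; split.
  apply/lker_eq0P => x; rewrite comp_lfunE sub_inclE => /eqP.
  rewrite -memv_ker lker_factor_proj => Wx; apply: vsval_inj; apply/eqP.
  by rewrite -memv0 -VW0 memv_cap subvsP.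
apply/limg_fullP => y; have [x <-] := (limg_fullP _).1 (limg_factor_proj W) y.
have : x \in (V + W)%VS by rewrite VW1 memvf.
move=> /memv_addP[v Vv [w Ww ->]]; exists (vsproj V v).
rewrite comp_lfunE sub_inclE vsprojK // linearD /=.
by move: Ww; rewrite -{1}(lker_factor_proj W) memv_ker => /eqP ->; rewrite addr0.
Qed.

Lemma direct_summand_retraction M (V W : submodule M) :
  (V + W)%VS = fullv -> (V :&: W)%VS = 0%VS ->
  exists p : mhom M (sub_mod V), (p \o sub_incl V)%VF = \1%VF.
Proof.
move=> VW1 VW0; have [f0 f1] := complement_bijective VW1 VW0.
have [g [gf _]] := mhom_inverse f0 f1.
by exists (compm g (factor_proj W)); rewrite -gf /= comp_lfunA.
Qed.

Lemma hdim_direct_sum M X (V W : submodule M) :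
  (V + W)%VS = fullv -> (V :&: W)%VS = 0%VS ->
  hdim M X = (hdim (sub_mod V) X + hdim (sub_mod W) X)%N.
Proof.
move=> VW1 VW0; have [_ fg g1] := short_exact_factor W.
have [q qE] : exists q : mhom M (sub_mod W), (q \o sub_incl W)%VF = \1%VF.
  by apply: (@direct_summand_retraction M W V); rewrite 1?addvC 1?capvC.
have [f0 f1] := complement_bijective VW1 VW0.
rewrite (hdim_isoL _ (bij_mod_iso f0 f1)) (hdim_right_exact X fg g1).
congr (_ + \dim _)%N.
apply/vspaceP => h; apply/memv_imgP/idP => [[k /hom_mhom[k' <-] ->]|/hom_mhom[h' <-]].
  by rewrite rcompE; exact: (mem_hom (compm k' (sub_incl W))).
exists (mfun (compm h' q)); rewrite ?mem_hom // rcompE /= -comp_lfunA qE.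
by rewrite comp_lfun1r.
Qed.

Section NakayamaDuality.
Variable P : rmod.

Definition act_fun (X : rmod) (x : X) (a : A) : X := ract X a x.
Fact act_fun_linear X x : linear (@act_fun X x).
Proof. by move=> k a b; rewrite /act_fun ract_linear add_lfunE scale_lfunE. Qed.
HB.instance Definition _ X x := GRing.isSemilinear.Build K _ _ _ (@act_fun X x)
  (GRing.semilinear_linear (@act_fun_linear X x)).
Definition act X (x : X) : 'Hom(A, X) := linfun (@act_fun X x).
Lemma actE X (x : X) a : act x a = ract X a x.
Proof. by rewrite lfunE. Qed.
Lemma act_linear X : linear (@act X).
Proof.
move=> k x y; apply/lfunP => a.
by rewrite add_lfunE scale_lfunE !actE linearP.
Qed.

Section Alpha.
Variables (X : rmod) (psi : 'Hom('Hom(P, X), K^o)).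

Definition nak_form_fun (x : X) (f : homA P) : K^o :=
  psi (act x \o (vsval f : 'Hom(P, reg_mod A)))%VF.
Fact nak_form_fun_linear x : linear (nak_form_fun x).
Proof.
by move=> k f g; rewrite /nak_form_fun linearP comp_lfunDr -comp_lfunZr linearP.
Qed.
HB.instance Definition _ x := GRing.isSemilinear.Build K _ _ _ (nak_form_fun x)
  (GRing.semilinear_linear (nak_form_fun_linear x)).
Definition nak_form (x : X) : nak_mod P := linfun (nak_form_fun x).
Lemma nak_formE x f : nak_form x f = psi (act x \o (vsval f : 'Hom(P, reg_mod A)))%VF.
Proof. by rewrite lfunE. Qed.
Fact nak_form_linear : linear nak_form.
Proof.
move=> k x y; apply/lfunP => f; rewrite add_lfunE scale_lfunE !nak_formE.
by rewrite act_linear comp_lfunDl -comp_lfunZl linearP.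
Qed.
HB.instance Definition _ := GRing.isSemilinear.Build K _ _ _ nak_form
  (GRing.semilinear_linear nak_form_linear).
(** For projective [P] this is the isomorphism D Hom(P, X) -> Hom(X, nu P). As
    [psi] is defined on all linear maps, and not only on homomorphisms, there is
    a kernel: the annihilator of [hom_space P X], see [nak_rep_eq0]. *)
Definition nak_rep : 'Hom(X, nak_mod P) := linfun nak_form.
Lemma nak_repE x f :
  nak_rep x f = psi (act x \o (vsval f : 'Hom(P, reg_mod A)))%VF.
Proof. by rewrite lfunE /= nak_formE. Qed.

Lemma nak_rep_mhom : is_mhom nak_rep.
Proof.
move=> a x; apply/lfunP => f; rewrite nak_repE /= dual_lfunE comp_lfunE nak_repE.
congr (psi _); apply/lfunP => p; rewrite !comp_lfunE !actE val_homA_lact.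
by rewrite ractM comp_lfunE.
Qed.

End Alpha.

Lemma nak_rep_linear X : linear (@nak_rep X).
Proof.
move=> k x y; apply/lfunP => z; apply/lfunP => f.
by rewrite !add_lfunE !scale_lfunE !nak_repE !add_lfunE !scale_lfunE.
Qed.
HB.instance Definition _ X := GRing.isSemilinear.Build K _ _ _ (@nak_rep X)
  (GRing.semilinear_linear (@nak_rep_linear X)).

End NakayamaDuality.
End ProjectiveModules.

(** * Free modules *)
Section FreeModules.
Variables (K : fieldType) (A : falgType K) (r : nat).

Definition free_act_fun (a : A) (x : {ffun 'I_r -> A}) : {ffun 'I_r -> A} :=
  [ffun i => x i * a].
Fact free_act_fun_linear a : linear (free_act_fun a).
Proof. by move=> k x y; apply/ffunP => i; rewrite !ffunE mulrDl scalerAl. Qed.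
HB.instance Definition _ a := GRing.isSemilinear.Build K _ _ _ (free_act_fun a)
  (GRing.semilinear_linear (free_act_fun_linear a)).
Definition free_act a : 'End({ffun 'I_r -> A}) := linfun (free_act_fun a).

Fact free_act_linear : linear free_act.
Proof.
move=> k a b; apply/lfunP => x; rewrite add_lfunE scale_lfunE !lfunE /=.
by apply/ffunP => i; rewrite !ffunE mulrDr scalerAr.
Qed.
Fact free_act1 : free_act 1 = \1%VF.
Proof. by apply/lfunP => x; rewrite lfunE id_lfunE; apply/ffunP => i; rewrite ffunE mulr1. Qed.
Fact free_actM a b : free_act (a * b) = (free_act b \o free_act a)%VF.
Proof.
apply/lfunP => x; rewrite comp_lfunE !lfunE /=.
by apply/ffunP => i; rewrite !ffunE mulrA.
Qed.
Definition free_mod : rmod A := RMod free_act_linear free_act1 free_actM.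

Definition free_coord_fun (i : 'I_r) (x : {ffun 'I_r -> A}) : A := x i.
Fact free_coord_linear i : linear (free_coord_fun i).
Proof. by move=> k x y; rewrite /free_coord_fun !ffunE. Qed.
HB.instance Definition _ i := GRing.isSemilinear.Build K _ _ _ (free_coord_fun i)
  (GRing.semilinear_linear (free_coord_linear i)).
Fact free_coord_mhom i : @is_mhom _ _ free_mod (reg_mod A) (linfun (free_coord_fun i)).
Proof. move=> a x; rewrite !lfunE /= /free_coord_fun. by rewrite ffunE. Qed.
Definition free_coord i : mhom free_mod (reg_mod A) := MHom (free_coord_mhom i).

Variables (M : rmod A) (e : 'I_r -> M).
Definition free_comb_fun (x : {ffun 'I_r -> A}) : M := \sum_i ract M (x i) (e i).
Fact free_comb_linear : linear free_comb_fun.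
Proof.
move=> k x y; rewrite /free_comb_fun linear_sum -big_split /=; apply: eq_bigr => i _.
by rewrite !ffunE ract_linear add_lfunE scale_lfunE.
Qed.
HB.instance Definition _ := GRing.isSemilinear.Build K _ _ _ free_comb_fun
  (GRing.semilinear_linear free_comb_linear).
Fact free_comb_mhom : @is_mhom _ _ free_mod M (linfun free_comb_fun).
Proof.
move=> a x; rewrite !lfunE /= /free_comb_fun linear_sum.
by apply: eq_bigr => i _; rewrite ffunE ractM comp_lfunE.
Qed.
Definition free_comb : mhom free_mod M := MHom free_comb_mhom.
End FreeModules.

(** * Nakayama duality *)
Section Nakayama.
Variables (K : fieldType) (A : falgType K).
Local Notation rmod := (rmod A).
Implicit Types M N X Y P Q : rmod.
Local Notation hdim M N := (\dim (hom_space M N)).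

Definition is_dual_basis P r (e : 'I_r -> P) (f : 'I_r -> mhom P (reg_mod A)) :=
  forall x, x = \sum_i ract P (f i x) (e i).

(** A section of the map onto [P] from the free module on a basis of [P] has
    the [f i] as coordinates. *)
Lemma dual_basis_exists P : mod_proj P ->
  exists r (e : 'I_r -> P) (f : 'I_r -> mhom P (reg_mod A)), is_dual_basis e f.
Proof.
move=> Pp; pose e i := (vbasis {:P})`_(nat_of_ord (i : 'I_(\dim {:P}))).
have [|h hE] := Pp _ _ (free_comb e) (idm P).
  apply/limg_fullP => y.
  exists [ffun i => (coord (vbasis {:P}) i y)%:A].
  rewrite lfunE /= [RHS](coord_vbasis (memvf y)); apply: eq_bigr => i _.
  have L := ract_linear P (coord (vbasis {:P}) i y) 1 0.
  have L0 : ract P 0 = 0 by have := ract_linear P (-1) 1 1; rewrite !scaleN1r !addNr.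
  by rewrite ffunE; move: L; rewrite !addr0 L0 addr0 ract1 => ->; rewrite scale_lfunE id_lfunE.
exists _, e, (fun i => compm (free_coord A i) h) => x.
have /lfunP/(_ x) := hE; rewrite comp_lfunE id_lfunE lfunE /= => E.
by rewrite -[LHS]E; apply: eq_bigr => i _; rewrite comp_lfunE lfunE.
Qed.

Definition hom_lift P (f : mhom P (reg_mod A)) : homA P := vsproj _ (f : 'Hom(_, _)).
Lemma val_hom_lift P (f : mhom P (reg_mod A)) : vsval (hom_lift f) = f.
Proof. by rewrite vsprojK // mem_hom. Qed.

Lemma homA_mhom P (f : homA P) : @is_mhom _ _ P (reg_mod A) (vsval f).
Proof. apply/hom_spaceP; exact: subvsP. Qed.

Section Trace.
Variables (P : rmod) (r : nat) (e : 'I_r -> P) (f : 'I_r -> mhom P (reg_mod A)).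
Hypothesis ef : is_dual_basis e f.

Lemma dual_basis_hom (g : homA P) :
  g = \sum_i homA_lact P ((vsval g : 'Hom(P, reg_mod A)) (e i)) (hom_lift (f i)).
Proof.
apply: homA_inj => x; rewrite [in LHS](ef x) linear_sum /= linear_sum sum_lfunE.
by apply: eq_bigr => i _; rewrite val_homA_lact val_hom_lift homA_mhom lfunE.
Qed.

Lemma mhom_dual_basis X (h : mhom P X) :
  (h : 'Hom(P, X)) = \sum_i (act (h (e i)) \o f i)%VF.
Proof.
apply/lfunP => x; rewrite sum_lfunE [in LHS](ef x) linear_sum; apply: eq_bigr => i _.
by rewrite comp_lfunE actE; exact: mhomP.
Qed.

Lemma nak_rep_trace X (psi : 'Hom('Hom(P, X), K^o)) (h : mhom P X) :
  psi h = \sum_i nak_rep psi (h (e i)) (hom_lift (f i)).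
Proof.
rewrite {1}(mhom_dual_basis h) linear_sum; apply: eq_bigr => i _.
by rewrite nak_repE val_hom_lift.
Qed.

(** The trace form of phi h : P -> nu P, written in a dual basis. It inverts
    [nak_rep], see [nak_rep_traceK] and [nak_rep_trace]. *)
Definition nak_trace_fun X (phi : 'Hom(X, nak_mod P)) (h : 'Hom(P, X)) : K^o :=
  \sum_i (phi (h (e i)) : 'Hom(homA P, K^o)) (hom_lift (f i)).
Fact nak_trace_linear X phi : linear (@nak_trace_fun X phi).
Proof.
move=> k g h; rewrite /nak_trace_fun linear_sum -big_split /=; apply: eq_bigr => i _.
by rewrite !add_lfunE !scale_lfunE linearP add_lfunE scale_lfunE.
Qed.
HB.instance Definition _ X phi := GRing.isSemilinear.Build K _ _ _ (@nak_trace_fun X phi)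
  (GRing.semilinear_linear (@nak_trace_linear X phi)).
Definition nak_trace X phi := linfun (@nak_trace_fun X phi).
Lemma nak_traceE X phi h : @nak_trace X phi h =
  \sum_i (phi (h (e i)) : 'Hom(homA P, K^o)) (hom_lift (f i)).
Proof. by rewrite lfunE. Qed.

Lemma nak_rep_traceK X (phi : mhom X (nak_mod P)) : nak_rep (nak_trace phi) = phi.
Proof.
apply/lfunP => x; apply/lfunP => g; rewrite nak_repE nak_traceE.
rewrite [in RHS](dual_basis_hom g) linear_sum; apply: eq_bigr => i _.
by rewrite comp_lfunE actE mhomP /= dual_lfunE comp_lfunE.
Qed.

End Trace.

Section Consequences.
Variables (P : rmod) (Pp : mod_proj P).

Lemma nak_rep_surj X (phi : mhom X (nak_mod P)) :
  exists psi : 'Hom('Hom(P, X), K^o), nak_rep psi = phi.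
Proof.
have [r [e [f ef]]] := dual_basis_exists Pp.
by exists (nak_trace e f phi); rewrite (nak_rep_traceK ef).
Qed.

Lemma nak_rep_eq0 X (psi : 'Hom('Hom(P, X), K^o)) :
  nak_rep psi = 0 <-> psi \in annihilator (hom_space P X).
Proof.
have [r [e [f ef]]] := dual_basis_exists Pp; rewrite annihilatorP; split=> [E h|H].
  move=> /hom_mhom[h' <-]; rewrite (nak_rep_trace ef) big1 // => i _.
  by rewrite E !zero_lfunE.
apply/lfunP => x; apply/lfunP => g; rewrite nak_repE !zero_lfunE; apply: H.
apply/hom_spaceP => a p; rewrite !comp_lfunE !actE homA_mhom lfunE /=.
by rewrite ractM comp_lfunE.
Qed.

(** nu P is injective because Hom(-, nu P) is dual to Hom(P, -): a functional on
    Hom(P, X) that vanishes on the h with d h = 0 extends along composition with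
    [d]. The condition on kernels, in place of injectivity of [d], allows
    extension along differentials as well as along inclusions. *)
Lemma nak_mod_extend X Y (d : mhom X Y) (g : mhom X (nak_mod P)) :
  (lker d <= lker g)%VS -> exists g' : mhom Y (nak_mod P), (g' \o d)%VF = g.
Proof.
move=> /subvP sub; have [psi E] := nak_rep_surj g.
have [r [e [f ef]]] := dual_basis_exists Pp.
pose i := linfun (@vsval K _ (hom_space P X)).
have [|psi' E'] := @lfun_factor _ _ _ _ (lcomp P d \o i)%VF (psi \o i)%VF.
  apply/subvP => h; rewrite !memv_ker !comp_lfunE lcompE lfunE /= => /eqP dh.
  apply/eqP; have [h' hE] := hom_mhom (subvsP h); rewrite -hE (nak_rep_trace ef).
  rewrite big1 // => j _; rewrite E.
  suff /eqP -> : g (h' (e j)) == 0 by rewrite zero_lfunE.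
  by rewrite -memv_ker sub // memv_ker hE -comp_lfunE dh zero_lfunE.
exists (MHom (nak_rep_mhom psi')); apply/lfunP => x; apply/lfunP => h.
rewrite comp_lfunE /= nak_repE -E nak_repE.
have xh : (act x \o (vsval h : 'Hom(P, reg_mod A)))%VF \in hom_space P X.
  apply/hom_spaceP => a p; rewrite !comp_lfunE !actE homA_mhom lfunE /=.
  by rewrite ractM comp_lfunE.
have /lfunP/(_ (vsproj _ (act x \o (vsval h : 'Hom(P, reg_mod A)))%VF)) := E'.
rewrite !comp_lfunE lcompE lfunE /= vsprojK // => <-.
by congr (psi' _); apply/lfunP => p; rewrite !comp_lfunE !actE mhomP.
Qed.

End Consequences.

Lemma nak_homE P Q (d : mhom P Q) (eta : nak_mod P) (f : homA Q) :
  (nak_hom d eta : 'Hom(homA Q, K^o)) f = (eta : 'Hom(homA P, K^o)) (homA_pre d f).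
Proof. by rewrite /= dual_lfunE comp_lfunE. Qed.

Lemma nak_hom_rep P Q X (d : mhom P Q) (psi : 'Hom('Hom(P, X), K^o)) :
  (nak_hom d \o nak_rep psi)%VF = nak_rep (psi \o rcomp X d)%VF.
Proof.
apply/lfunP => x; apply/lfunP => f; rewrite comp_lfunE nak_homE !nak_repE comp_lfunE.
by congr (psi _); rewrite val_homA_pre rcompE comp_lfunA.
Qed.

(** The kernel of Hom(X, nu P) -> Hom(X, nu Q) is dual to the cokernel of
    Hom(Q, X) -> Hom(P, X). *)
Lemma dim_nak_kernel P Q X (d : mhom P Q) : mod_proj P -> mod_proj Q ->
  (\dim (hom_space X (nak_mod P) :&: lker (lcomp X (nak_hom d)))
    + \dim (rcomp X d @: hom_space Q X))%N = hdim P X.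
Proof.
move=> Pp Qp; set T := (rcomp X d @: hom_space Q X)%VS.
pose al := linfun (@nak_rep _ A P X).
have TS : (T <= hom_space P X)%VS.
  apply/subvP => _ /memv_imgP[k /hom_mhom[k' <-] ->].
  by rewrite rcompE; exact: (mem_hom (compm k' d)).
have -> : (hom_space X (nak_mod P) :&: lker (lcomp X (nak_hom d)))%VS =
    (al @: annihilator T)%VS.
  apply/vspaceP => g; rewrite memv_cap memv_ker lcompE; apply/andP/memv_imgP.
    move=> [/hom_mhom[g' <-] /eqP E]; have [psi psiE] := nak_rep_surj Pp g'.
    exists psi; rewrite ?lfunE //; apply/annihilatorP => _ /memv_imgP[k kh ->].
    move: E; rewrite -psiE nak_hom_rep => /(nak_rep_eq0 Qp)/annihilatorP/(_ k kh).
    by rewrite comp_lfunE.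
  move=> [psi /annihilatorP psiT ->]; rewrite lfunE /=; split.
    exact: (mem_hom (MHom (nak_rep_mhom psi))).
  rewrite nak_hom_rep; apply/eqP/(nak_rep_eq0 Qp); apply/annihilatorP => k kh.
  by rewrite comp_lfunE psiT // memv_img.
have alE psi : (psi \in lker al) = (nak_rep psi == 0) by rewrite memv_ker lfunE.
have := limg_ker_dim al (annihilator T).
have -> : (annihilator T :&: lker al)%VS = annihilator (hom_space P X).
  apply/vspaceP => psi; rewrite memv_cap alE; apply/andP/idP.
    by move=> [_ /eqP E]; apply/(nak_rep_eq0 Pp).
  move=> ps; split; last by apply/eqP; apply/(nak_rep_eq0 Pp).
  by apply/annihilatorP => x Tx; apply: ((annihilatorP _ _).1 ps); apply: (subvP TS).
have := dim_annihilator (hom_space P X); have := dim_annihilator T.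
move=> e1 e2 e3.
apply: (@addnI (\dim (annihilator (hom_space P X)))).
by rewrite addnA e3 e1 -e2.
Qed.

(** Functionals separate the elements of Hom(Q, A), and these separate the
    elements of a projective module [Q]. *)
Lemma nak_hom_inj P Q (d d' : mhom P Q) : mod_proj Q ->
  (nak_hom d : 'Hom(_, _)) = nak_hom d' -> (d : 'Hom(P, Q)) = d'.
Proof.
move=> Qp E; have [r [e [f ef]]] := dual_basis_exists Qp; apply/lfunP => x.
suff fE i : f i (d x) = f i (d' x).
  by rewrite (ef (d x)) [RHS](ef (d' x)); apply: eq_bigr => i _; rewrite fE.
suff : homA_pre d (hom_lift (f i)) = homA_pre d' (hom_lift (f i)).
  move=> /(congr1 (fun g => (vsval g : 'Hom(P, reg_mod A)) x)).
  by rewrite !val_homA_pre !comp_lfunE val_hom_lift.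
apply/eqP; rewrite -subr_eq0; apply/eqP; apply: functional_separates => psi.
by rewrite linearB /= -(nak_homE d psi) -(nak_homE d' psi) E subrr.
Qed.

(** Hom(nu P, nu Q) is dual to Hom(Q, nu P), which is dual to Hom(P, Q). So [g]
    is a functional on the dual of Hom(P, Q), that is, evaluation at some [d]. *)
Lemma nak_hom_full P Q (g : mhom (nak_mod P) (nak_mod Q)) :
  mod_proj Q -> exists d : mhom P Q, (nak_hom d : 'Hom(_, _)) = g.
Proof.
move=> Qp; have [psi psiE] := nak_rep_surj Qp g.
pose S := hom_space P Q.
have [v vE] := @double_dual K (subvs_of S)
  (psi \o linfun (@nak_rep _ A P Q) \o rcomp K^o (linfun (@vsproj K _ S)))%VF.
have [d dE] := hom_mhom (subvsP v); exists d.
apply/lfunP => eta; apply/lfunP => f; rewrite nak_homE -psiE nak_repE.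
pose xi := (eta \o linfun (@vsproj K _ (hom_space P (reg_mod A)))
  \o lcomp P (vsval f : 'Hom(Q, reg_mod A)) \o linfun (@vsval K _ S))%VF.
have -> : (eta : 'Hom(homA P, K^o)) (homA_pre d f) = xi v.
  rewrite !comp_lfunE lcompE !lfunE /= -dE; congr (eta _).
rewrite -vE !comp_lfunE rcompE [linfun _ _]lfunE /=; congr (psi _).
apply/lfunP => q; apply/lfunP => f'.
have qf : (act q \o (vsval f' : 'Hom(P, reg_mod A)))%VF \in S.
  rewrite /S; apply/hom_spaceP => a p; rewrite !comp_lfunE !actE homA_mhom lfunE /=.
  by rewrite ractM comp_lfunE.
rewrite nak_repE !comp_lfunE actE /= dual_lfunE comp_lfunE lcompE.
rewrite !lfunE /= vsprojK //; congr (eta _); apply: homA_inj => p.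
rewrite vsprojK; last first.
  apply: (mem_hom (MHom (is_mhom_comp (homA_mhom f) _))); exact/hom_spaceP.
rewrite !comp_lfunE actE homA_mhom lfunE /=.
by have := val_homA_lact ((vsval f : 'Hom(Q, reg_mod A)) q) f' p; rewrite [homA_lact _ _ _]lfunE => ->.
Qed.

End Nakayama.

(** * Classes of projective modules *)
Section GrothendieckGroup.
Variables (K : fieldType) (A : falgType K) (n : nat) (P : 'I_n -> rmod A).
Local Notation hdim M N := (\dim (hom_space M N)).

(** Induction on the dimension, splitting [Q] until its summands are
    indecomposable; [c] is the class of [Q] in the basis of the [P_j]. *)
Lemma proj_class (hP : indec_projectives P) (Q : rmod A) : mod_proj Q ->
  exists c : 'I_n -> nat, forall X, hdim Q X = (\sum_j c j * hdim (P j) X)%N.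
Proof.
have [k] := ubnP (dim Q); elim: k Q => // k IH Q; rewrite ltnS => Qk Qp.
have [Q0|Q0] := pselect (mod_zero Q).
  exists (fun=> 0%N) => X; rewrite big1 //; apply/hdim_zeroP => f; apply/lfunP => x.
  by rewrite ((mod_zeroP Q).1 Q0 x) !linear0.
have [Qi|] := pselect (mod_indec Q).
  have [_ _ /(_ Q Qp Qi)[j iso]] := hP; exists (fun i => (i == j) : nat) => X.
  rewrite (hdim_isoL X iso) (bigD1 j) //= eqxx mul1n big1 ?addn0 // => i /negPf ->.
  by rewrite mul0n.
move=> /not_andP[//|/existsNP[V /existsNP[W /not_implyP[VW1 /not_implyP[VW0]]]]].
move=> /not_orP[V0 W0].
have WV1 : (W + V)%VS = fullv by rewrite addvC.
have WV0 : (W :&: V)%VS = 0%VS by rewrite capvC.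
have dimQ : (\dim V + \dim W = dim Q)%N by rewrite -dimv_disjoint_sum // VW1 dimvf.
have pos (S : {vspace Q}) : S <> 0%VS -> (0 < \dim S)%N.
  by move=> S0; rewrite lt0n dimv_eq0; apply/eqP.
have [p pE] := direct_summand_retraction VW1 VW0.
have [q qE] := direct_summand_retraction WV1 WV0.
have [||c cE] := IH (sub_mod V).
- have := pos W W0; have : dim (sub_mod V) = \dim V by []. move: dimQ Qk. lia.
- exact: mod_proj_retract Qp pE.
have [||d dE] := IH (sub_mod W).
- have := pos V V0; have : dim (sub_mod W) = \dim W by []. move: dimQ Qk. lia.
- exact: mod_proj_retract Qp qE.
exists (fun j => c j + d j)%N => X; rewrite (hdim_direct_sum X VW1 VW0) cE dE -big_split.
by apply: eq_bigr => j _; rewrite /= mulnDl.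
Qed.

End GrothendieckGroup.

(** * Chain maps up to homotopy *)
Section HomotopyCategory.
Variables (K : fieldType) (A : falgType K).
Local Notation rmod := (rmod A).
Local Notation complex := (complex A).
Implicit Types (B C D E : complex).

Fact cid_cmap C : @is_cmap _ _ C C (fun i => idm (C i)).
Proof. by move=> i j; rewrite /= comp_lfun1l comp_lfun1r. Qed.
Definition cidm C : cmap C C := CMap (@cid_cmap C).

Fact ccomp_cmap C D E (g : cmap D E) (f : cmap C D) :
  @is_cmap _ _ C E (fun i => compm (g i) (f i)).
Proof. by move=> i j; rewrite /= -comp_lfunA cmapP !comp_lfunA cmapP. Qed.
Definition ccomp C D E (g : cmap D E) (f : cmap C D) : cmap C E :=
  CMap (ccomp_cmap g f).

Lemma homotopic_refl C D (f : forall i, 'Hom(C i, D i)) : homotopic f f.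
Proof.
exists (fun i j => zerom (C i) (D j)) => i.
by rewrite subrr /= comp_lfun0r comp_lfun0l addr0.
Qed.

Lemma homotopic_eq C D (f g : forall i, 'Hom(C i, D i)) :
  (forall i, f i = g i) -> homotopic f g.
Proof.
move=> E; exists (fun i j => zerom (C i) (D j)) => i.
by rewrite E subrr /= comp_lfun0r comp_lfun0l addr0.
Qed.

Lemma homotopic_lin C D k (f g f' g' : forall i, 'Hom(C i, D i)) :
  homotopic f g -> homotopic f' g' ->
  homotopic (fun i => k *: f i + f' i) (fun i => k *: g i + g' i).
Proof.
move=> [h hE] [h' hE']; exists (fun i j => linm k (h i j) (h' i j)) => i.
rewrite opprD addrACA -scalerBr hE hE' /= !(comp_lfunDl, comp_lfunDr).
by rewrite -!(comp_lfunZl, comp_lfunZr) scalerDr addrACA.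
Qed.

Lemma homotopic_sym C D (f g : forall i, 'Hom(C i, D i)) :
  homotopic f g -> homotopic g f.
Proof.
move=> [h hE]; exists (fun i j => linm (-1) (h i j) (zerom _ _)) => i.
rewrite -opprB hE /= !(comp_lfunDl, comp_lfunDr) -!(comp_lfunZl, comp_lfunZr).
by rewrite !(comp_lfun0l, comp_lfun0r) !addr0 !scaleN1r opprD.
Qed.

Lemma homotopic_trans C D (g f h : forall i, 'Hom(C i, D i)) :
  homotopic f g -> homotopic g h -> homotopic f h.
Proof.
move=> [s sE] [t tE]; exists (fun i j => linm 1 (s i j) (t i j)) => i.
rewrite -(subrKA (g i)) sE tE /= !scale1r !(comp_lfunDl, comp_lfunDr).
by rewrite addrACA.
Qed.

Lemma homotopic_compl C D E (u : cmap D E) (f g : forall i, 'Hom(C i, D i)) :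
  homotopic f g -> homotopic (fun i => u i \o f i)%VF (fun i => u i \o g i)%VF.
Proof.
move=> [h hE]; exists (fun i j => compm (u j) (h i j)) => i.
rewrite -comp_lfunNr -comp_lfunDr hE /= comp_lfunDr !comp_lfunA.
by rewrite (cmapP u).
Qed.

Lemma homotopic_compr B C D (u : cmap B C) (f g : forall i, 'Hom(C i, D i)) :
  homotopic f g -> homotopic (fun i => f i \o u i)%VF (fun i => g i \o u i)%VF.
Proof.
move=> [h hE]; exists (fun i j => compm (h i j) (u i)) => i.
by rewrite -comp_lfunNl -comp_lfunDl hE /= comp_lfunDl -!comp_lfunA (cmapP u).
Qed.

Definition heqv C D (f g : cmap C D) :=
  homotopic (fun i => f i : 'Hom(_, _)) (fun i => g i : 'Hom(_, _)).

Lemma heqv_comp C D E (g g' : cmap D E) (f f' : cmap C D) :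
  heqv g g' -> heqv f f' -> heqv (ccomp g f) (ccomp g' f').
Proof.
move=> gg ff; apply: (@homotopic_trans _ _ (fun i => g' i \o f i)%VF).
  exact: (homotopic_compr f gg).
exact: (homotopic_compl g' ff).
Qed.

Lemma heqv_refl C D (f : cmap C D) : heqv f f.
Proof. exact: homotopic_refl. Qed.
Lemma heqv_sym C D (f g : cmap C D) : heqv f g -> heqv g f.
Proof. exact: homotopic_sym. Qed.
Lemma heqv_trans C D (g f h : cmap C D) : heqv f g -> heqv g h -> heqv f h.
Proof. exact: homotopic_trans. Qed.
Lemma heqv_eq C D (f g : cmap C D) :
  (forall i, (f i : 'Hom(_, _)) = g i) -> heqv f g.
Proof. exact: homotopic_eq. Qed.

End HomotopyCategory.

(** * Functoriality of cohomology *)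
Section Cohomology.
Variables (K : fieldType) (A : falgType K) (k : int).
Local Notation complex := (complex A).
Implicit Types C D E : complex.

Definition cocycles C := ker_sub (cdiff C k (k + 1)).
Definition coboundaries C := preim_sub (sub_incl (cocycles C)) (img_sub (cdiff C (k - 1) k)).

(** [coh_class] takes cocycles to their classes, and the linear map [coh_rep]
    is a section of it; it need not commute with the action of [A]. *)
Definition coh_rep C : 'Hom(cohomology k C, C k) :=
  (linfun (@vsval K _ (cocycles C)) \o linfun (@vsval K _ (coboundaries C)^C%VS))%VF.
Definition coh_class C : 'Hom(C k, cohomology k C) :=
  (factor_proj (coboundaries C) \o linfun (@vsproj K _ (cocycles C)))%VF.

Lemma coh_rep_cocycle C u : cdiff C k (k + 1) (coh_rep C u) = 0.
Proof.
rewrite comp_lfunE !lfunE /=.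
apply/eqP; rewrite -memv_ker; exact: (@subvsP K (C k) (cocycles C) _).
Qed.

Lemma coh_classE C z (zZ : cdiff C k (k + 1) z = 0) :
  coh_class C z = factor_proj (coboundaries C) (vsproj (cocycles C) z).
Proof.
rewrite -(lfunE (@vsproj K _ (cocycles C))).
exact: (comp_lfunE (factor_proj (coboundaries C)) (linfun (@vsproj K _ (cocycles C)))).
Qed.

Lemma coh_class_rep C u : coh_class C (coh_rep C u) = u.
Proof.
rewrite coh_classE ?coh_rep_cocycle // /coh_rep.
rewrite [X in vsproj _ X]comp_lfunE (lfunE (@vsval K _ (cocycles C))) /=.
rewrite (lfunE (@vsval K _ (coboundaries C)^C%VS)) /= vsvalK.
exact: (@factor_lfunK _ _ _ (coboundaries C) u).
Qed.

Lemma coh_class_eq0 C z : cdiff C k (k + 1) z = 0 ->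
  (coh_class C z = 0 <-> z \in limg (cdiff C (k - 1) k)).
Proof.
move=> zZ; rewrite coh_classE //.
have zZ' : z \in (cocycles C : {vspace _}) by rewrite memv_ker zZ.
suff -> : (z \in limg (cdiff C (k - 1) k)) =
    (factor_proj (coboundaries C) (vsproj (cocycles C) z) == 0).
  by split=> [->|/eqP].
rewrite -memv_ker lker_factor_proj /= -memv_preim.
by rewrite lfunE /= vsprojK.
Qed.

Lemma coh_class_act C z a : cdiff C k (k + 1) z = 0 ->
  coh_class C (ract (C k) a z) = ract (cohomology k C) a (coh_class C z).
Proof.
move=> zZ; rewrite !coh_classE // ?mhomP ?zZ ?linear0 //.
rewrite -[RHS]mhomP; congr (factor_proj _ _); apply: vsval_inj.
rewrite [RHS]val_sub_ract !vsprojK // memv_ker ?mhomP zZ ?linear0 //.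
Qed.

Definition coh_map C D (f : 'Hom(C k, D k)) : 'Hom(cohomology k C, cohomology k D) :=
  (coh_class D \o f \o coh_rep C)%VF.

Lemma coh_mapE C D (f : 'Hom(C k, D k)) u :
  @coh_map C D f u = coh_class D (f (coh_rep C u)).
Proof.
apply: etrans (comp_lfunE _ _ _) _; exact: (comp_lfunE (coh_class D) f).
Qed.

Definition coh_compatible C D (f : 'Hom(C k, D k)) :=
  (forall z, cdiff C k (k + 1) z = 0 -> cdiff D k (k + 1) (f z) = 0) /\
  (forall z, z \in limg (cdiff C (k - 1) k) -> f z \in limg (cdiff D (k - 1) k)).

Lemma cmap_compatible C D (f : cmap C D) : @coh_compatible C D (f k).
Proof.
split=> [z zZ|_ /memv_imgP[y _ ->]].
  by rewrite -comp_lfunE -cmapP comp_lfunE zZ linear0.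
by rewrite -comp_lfunE cmapP comp_lfunE memv_img ?memvf.
Qed.

Lemma coh_map_class C D (f : 'Hom(C k, D k)) z : @coh_compatible C D f ->
  cdiff C k (k + 1) z = 0 -> @coh_map C D f (coh_class C z) = coh_class D (f z).
Proof.
move=> [fZ fB] zZ; rewrite !coh_mapE; set w := coh_rep C _.
have yZ : cdiff C k (k + 1) (w - z) = 0 by rewrite linearB /= coh_rep_cocycle zZ subrr.
rewrite -(subrK z w) 2!linearD /= (_ : coh_class D _ = 0) ?add0r //.
apply/coh_class_eq0; first exact: fZ.
by apply/fB/coh_class_eq0 => //; rewrite linearB /= coh_class_rep subrr.
Qed.

Lemma coh_map_ext C (X : rmod A) (f g : 'Hom(cohomology k C, X)) :
  (forall z, cdiff C k (k + 1) z = 0 -> f (coh_class C z) = g (coh_class C z)) -> f = g.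
Proof.
move=> H; apply/lfunP => u; rewrite -[u]coh_class_rep; apply: H.
exact: coh_rep_cocycle.
Qed.

Lemma coh_map_mhom C D (f : mhom (C k) (D k)) :
  @coh_compatible C D f -> is_mhom (@coh_map C D f).
Proof.
move=> fc a u; rewrite -[u]coh_class_rep; have zZ := coh_rep_cocycle u.
move: (coh_rep C u) zZ => z zZ.
rewrite -coh_class_act // !coh_map_class // ?mhomP ?zZ ?linear0 //.
by rewrite coh_class_act //; apply: fc.1.
Qed.

Lemma coh_map_comp C D E (g : 'Hom(D k, E k)) (f : 'Hom(C k, D k)) :
  @coh_compatible D E g -> @coh_compatible C D f ->
  @coh_map C E (g \o f)%VF = (@coh_map D E g \o @coh_map C D f)%VF.
Proof.
move=> gc fc; apply: coh_map_ext => z zZ; rewrite comp_lfunE !coh_map_class //.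
- by rewrite comp_lfunE.
- exact: fc.1.
- split=> y; rewrite comp_lfunE => ?; [apply/gc.1/fc.1|apply/gc.2/fc.2]; done.
Qed.

Lemma coh_map_id C : @coh_map C C \1%VF = \1%VF.
Proof.
apply: coh_map_ext => z zZ; rewrite coh_map_class ?id_lfunE //.
by split=> y; rewrite id_lfunE.
Qed.

Lemma coh_map_linear C D : linear (@coh_map C D).
Proof.
by move=> c f g; rewrite /coh_map comp_lfunDr comp_lfunDl -comp_lfunZr -comp_lfunZl.
Qed.
HB.instance Definition _ C D := GRing.isSemilinear.Build K _ _ _ (@coh_map C D)
  (GRing.semilinear_linear (@coh_map_linear C D)).

Lemma coh_map_null C D (f : 'Hom(C k, D k)) :
  (forall z, cdiff C k (k + 1) z = 0 -> f z \in limg (cdiff D (k - 1) k)) ->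
  @coh_map C D f = 0.
Proof.
move=> H; apply/lfunP => u; rewrite zero_lfunE coh_mapE.
set z := coh_rep C u; have zZ : cdiff C k (k + 1) z = 0 by exact: coh_rep_cocycle.
apply/coh_class_eq0; last exact: H.
have /memv_imgP[y _ ->] := H z zZ.
by rewrite -comp_lfunE cdiff2 zero_lfunE.
Qed.

Lemma coh_map_homotopic C D (f g : forall i, 'Hom(C i, D i)) :
  homotopic f g -> @coh_map C D (f k) = @coh_map C D (g k).
Proof.
move=> [h hE]; apply/eqP; rewrite -subr_eq0 -linearB /=; apply/eqP/coh_map_null => z zZ.
by rewrite hE add_lfunE !comp_lfunE zZ linear0 addr0 memv_img ?memvf.
Qed.
End Cohomology.

(** * The Nakayama functor on complexes *)
Section NakayamaFunctor.
Variables (K : fieldType) (A : falgType K).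
Local Notation rmod := (rmod A).
Local Notation complex := (complex A).
Implicit Types P Q X : rmod.

(** The Nakayama functor on all linear maps, so that it can be applied to
    sums without first packaging them as module homomorphisms. *)
Definition nak_pre_fun P Q (d : 'Hom(P, Q)) (f : homA Q) : homA P :=
  vsproj _ ((vsval f : 'Hom(Q, reg_mod A)) \o d)%VF.
Fact nak_pre_linear P Q d : linear (@nak_pre_fun P Q d).
Proof.
by move=> k x y; rewrite /nak_pre_fun linearP comp_lfunDl -comp_lfunZl linearP.
Qed.
HB.instance Definition _ P Q d := GRing.isSemilinear.Build K _ _ _ (@nak_pre_fun P Q d)
  (GRing.semilinear_linear (@nak_pre_linear P Q d)).
Definition nak_lfun P Q (d : 'Hom(P, Q)) : 'Hom(nak_mod P, nak_mod Q) :=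
  dual_lfun (linfun (nak_pre_fun d)).

Lemma nak_lfun_mhom P Q (d : mhom P Q) : nak_lfun d = nak_hom d.
Proof. by []. Qed.

Lemma nak_lfun_linear P Q : linear (@nak_lfun P Q).
Proof.
move=> k x y; apply/lfunP => eta; apply/lfunP => f.
rewrite !(add_lfunE, scale_lfunE, dual_lfunE, comp_lfunE) !lfunE /=.
rewrite -linearZ -linearD; congr (eta _).
by rewrite /nak_pre_fun comp_lfunDr -comp_lfunZr linearP.
Qed.
HB.instance Definition _ P Q := GRing.isSemilinear.Build K _ _ _ (@nak_lfun P Q)
  (GRing.semilinear_linear (@nak_lfun_linear P Q)).

Lemma nak_hom_comp P Q X (g : mhom Q X) (f : mhom P Q) :
  (nak_hom (compm g f) : 'Hom(_, _)) = (nak_hom g \o nak_hom f)%VF.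
Proof.
apply/lfunP => eta; apply/lfunP => h; rewrite comp_lfunE !nak_homE; congr (eta _).
by apply: vsval_inj; rewrite !val_homA_pre comp_lfunA.
Qed.

Lemma nak_lfun_comp P Q X (g : mhom Q X) (f : mhom P Q) :
  nak_lfun (g \o f)%VF = (nak_lfun g \o nak_lfun f)%VF.
Proof. exact: (nak_hom_comp g f). Qed.

Lemma nak_lfun_id P : nak_lfun (\1%VF : 'Hom(P, P)) = \1%VF.
Proof.
apply/lfunP => eta; apply/lfunP => h; rewrite id_lfunE dual_lfunE comp_lfunE lfunE /=.
by congr (eta _); rewrite /nak_pre_fun comp_lfun1r vsvalK.
Qed.

Implicit Types C D E : complex.

Fact nak_cmap_cmap C D (f : cmap C D) :
  @is_cmap _ _ (nak_complex C) (nak_complex D) (fun i => nak_hom (f i)).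
Proof.
move=> i j; have := congr1 (@nak_lfun (C i) (D j)) (cmapP f i j).
by rewrite (nak_lfun_comp (f j) (cdiff C i j)) (nak_lfun_comp (cdiff D i j) (f i)).
Qed.
Definition nak_cmap C D (f : cmap C D) : cmap (nak_complex C) (nak_complex D) :=
  CMap (nak_cmap_cmap f).

Lemma nak_homotopic C D (f g : forall i, 'Hom(C i, D i)) : homotopic f g ->
  @homotopic _ _ (nak_complex C) (nak_complex D)
    (fun i => nak_lfun (f i)) (fun i => nak_lfun (g i)).
Proof.
move=> [h hE]; exists (fun i j => nak_hom (h i j)) => i.
by rewrite -linearB /= hE linearD /= !nak_lfun_comp.
Qed.
End NakayamaFunctor.

(** * Additive functors on the homotopy category *)
Section HomotopyFunctors.
Variables (K : fieldType) (A : falgType K).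
Local Notation complex := (complex A).

(** Additive functors on the homotopy category, with values in modules; they
    are defined on all families of linear maps, so that sums and homotopies apply
    to them directly, but functorial on chain maps only. *)
Record hfunctor := HFunctor {
  hobj :> complex -> rmod A;
  hmap : forall C D : complex, (forall i, 'Hom(C i, D i)) -> 'Hom(hobj C, hobj D);
  hmap_mhom : forall (C D : complex) (f : cmap C D), is_mhom (@hmap C D (fun i => f i));
  hmap_id : forall C : complex, @hmap C C (fun i => \1%VF) = \1%VF;
  hmap_comp : forall (C D E : complex) (g : cmap D E) (f : cmap C D),
    @hmap C E (fun i => (g i \o f i)%VF) = (@hmap D E (fun i => g i) \o @hmap C D (fun i => f i))%VF;
  hmap_sum : forall (C D : complex) (I : finType) (f : I -> forall i, 'Hom(C i, D i)),
    @hmap C D (fun i => \sum_x f x i) = \sum_x @hmap C D (f x);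
  hmap_homotopic : forall (C D : complex) (f g : forall i, 'Hom(C i, D i)),
    homotopic f g -> @hmap C D f = @hmap C D g }.

Definition H0_functor : hfunctor.
Proof.
exists (@H0 K A) (fun (C D : complex) (f : forall i : int, 'Hom(C i, D i)) => @coh_map K A 0 C D (f 0)).
- by move=> C D f; apply/coh_map_mhom/cmap_compatible.
- by move=> C; exact: coh_map_id.
- by move=> C D E g f; apply: coh_map_comp; apply: cmap_compatible.
- by move=> C D I f; rewrite linear_sum.
- by move=> C D f g fg; exact: (coh_map_homotopic 0 fg).
Defined.

Definition Hm1nu_functor : hfunctor.
Proof.
exists (@Hm1nu K A) (fun (C D : complex) (f : forall i : int, 'Hom(C i, D i)) =>
  @coh_map K A (-1) (nak_complex C) (nak_complex D) (nak_lfun (f (-1)))).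
- move=> C D f; apply: (@coh_map_mhom _ _ _ (nak_complex C) (nak_complex D) (nak_hom (f (-1)))).
  exact: (cmap_compatible (-1) (nak_cmap f)).
- by move=> C; rewrite nak_lfun_id; exact: coh_map_id.
- move=> C D E g f; rewrite nak_lfun_comp.
  apply: (@coh_map_comp _ _ _ (nak_complex C) (nak_complex D) (nak_complex E)
    (nak_lfun (g (-1))) (nak_lfun (f (-1)))).
    exact: (cmap_compatible (-1) (nak_cmap g)).
  exact: (cmap_compatible (-1) (nak_cmap f)).
- by move=> C D I f; rewrite !linear_sum.
- by move=> C D f g fg; exact: (coh_map_homotopic (-1) (nak_homotopic fg)).
Defined.

End HomotopyFunctors.

(** * Fitting decompositions *)
Section LinearFitting.
Variables (K : fieldType) (V : vectType K) (e : 'End(V)).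

Fixpoint lpow n : 'End(V) := if n is n'.+1 then (lpow n' \o e)%VF else \1%VF.

Lemma lpowD m n : lpow (m + n) = (lpow m \o lpow n)%VF.
Proof.
elim: n => [|n IH]; first by rewrite addn0 comp_lfun1r.
by rewrite addnS /= IH comp_lfunA.
Qed.

(** The kernels of the powers of [e] can grow strictly at most [dim V] times. *)
Lemma lker_lpow_stable N : (dim V <= N)%N ->
  forall x, lpow N (lpow N x) = 0 -> lpow N x = 0.
Proof.
move=> VN.
have mono n : (lker (lpow n) <= lker (lpow n.+1))%VS.
  apply/subvP => x; rewrite !memv_ker -(addn1 n) addnC lpowD comp_lfunE => /eqP ->.
  by rewrite linear0.
have [n nV st] : exists2 n, (n <= dim V)%N & (lker (lpow n.+1) <= lker (lpow n))%VS.
  apply: contrapT => H.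
  have k n : (n <= (dim V).+1)%N -> (n <= \dim (lker (lpow n)))%N.
    elim: n => // n IH nV; apply: (leq_ltn_trans (IH (ltnW nV))).
    rewrite ltn_neqAle dimvS // andbT; apply/negP => /eqP eqd; apply: H.
    exists n => //; rewrite -(geq_leqif (dimv_leqif_sup (mono n))).
    by rewrite eqd.
  have := k _ (leqnn _); rewrite leqNgt ltnS.
  by rewrite -(dimvf V) dimvS ?subvf.
have stable d x : lpow (n + d) x = 0 -> lpow n x = 0.
  elim: d x => [|d IH] x; first by rewrite addn0.
  rewrite addnS -addSn lpowD comp_lfunE => h; apply: IH.
  rewrite lpowD comp_lfunE; apply/eqP; rewrite -memv_ker; apply: (subvP st).
  by rewrite memv_ker h.
have nN := leq_trans nV VN.
move=> x; rewrite -comp_lfunE -lpowD.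
have -> : (N + N = n + (N + N - n))%N by lia.
move=> /stable h; rewrite -(subnK nN) lpowD comp_lfunE h linear0 //.
Qed.

End LinearFitting.

Section ComplexFitting.
Variables (K : fieldType) (A : falgType K).
Local Notation complex := (complex A).
Local Notation kproj := (kproj A).
Implicit Types C D E : complex.

Section SubComplex.
Variables (C : complex) (V : forall i, submodule (C i)).
Hypothesis dV : forall i j x, x \in (V i : {vspace _}) -> cdiff C i j x \in (V j : {vspace _}).

Lemma sub_diff_exists i j : exists d : mhom (sub_mod (V i)) (sub_mod (V j)),
  (sub_incl (V j) \o d)%VF = (cdiff C i j \o sub_incl (V i))%VF.
Proof.
have [|d dE] := @mhom_lift_inj _ _ _ _ _ (sub_incl (V j))
  (compm (cdiff C i j) (sub_incl (V i))) (lker_sub_incl _); last by exists d.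
rewrite limg_sub_incl; apply/subvP => _ /memv_imgP[x _ ->].
by rewrite comp_lfunE sub_inclE; apply: dV; apply: subvsP.
Qed.

Definition sub_diff i j := sval (cid (sub_diff_exists i j)).
Lemma sub_diffE i j : (sub_incl (V j) \o sub_diff i j)%VF = (cdiff C i j \o sub_incl (V i))%VF.
Proof. exact: svalP (cid (sub_diff_exists i j)). Qed.

Lemma sub_incl_eq0 i M (f : 'Hom(M, sub_mod (V i))) : (sub_incl (V i) \o f)%VF = 0 -> f = 0.
Proof.
move=> E; apply/lfunP => x; rewrite zero_lfunE.
apply: ((lker_eq0P _).1 (lker_sub_incl (V i))).
by rewrite -[LHS](comp_lfunE (sub_incl (V i))) E zero_lfunE.
Qed.

Fact sub_diff_shape i j : j != i + 1 -> (sub_diff i j : 'Hom(_, _)) = 0.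
Proof. by move=> ne; apply: sub_incl_eq0; rewrite sub_diffE cdiff_shape // comp_lfun0l. Qed.

Fact sub_diff2 i j k : (sub_diff j k \o sub_diff i j)%VF = 0.
Proof.
apply: sub_incl_eq0.
by rewrite comp_lfunA sub_diffE -comp_lfunA sub_diffE comp_lfunA cdiff2 comp_lfun0l.
Qed.

Definition sub_cpx := Complex sub_diff_shape sub_diff2.
Definition sub_cpx_incl : cmap sub_cpx C :=
  @CMap _ _ sub_cpx C (fun i => sub_incl (V i)) sub_diffE.

Lemma sub_cpx_exists : exists (D : complex) (i : cmap D C),
  (forall k, lker (i k) = 0%VS) /\ (forall k, limg (i k) = V k).
Proof.
exists sub_cpx, sub_cpx_incl.
by split=> k; [exact: lker_sub_incl|exact: limg_sub_incl].
Qed.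

End SubComplex.

Lemma cmap_lift_inj C D E (i : cmap D E) (f : cmap C E) :
  (forall k, lker (i k) = 0%VS) -> (forall k, (limg (f k) <= limg (i k))%VS) ->
  exists f' : cmap C D, forall k, (i k \o f' k)%VF = f k.
Proof.
move=> i0 fi; pose f' k := sval (cid (mhom_lift_inj (i0 k) (fi k))).
have f'E k : (i k \o f' k)%VF = f k := svalP (cid (mhom_lift_inj (i0 k) (fi k))).
have f'P : is_cmap f'.
  move=> k l; apply/lfunP => x; apply/eqP; rewrite -subr_eq0; apply/eqP.
  apply: ((lker_eq0P _).1 (i0 l)); rewrite linearB /= !comp_lfunE.
  have fE m y : i m (f' m y) = f m y by rewrite -f'E comp_lfunE.
  have iE y : i l (cdiff D k l y) = cdiff E k l (i k y) by rewrite -!comp_lfunE cmapP.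
  have fd : f l (cdiff C k l x) = cdiff E k l (f k x) by rewrite -!comp_lfunE cmapP.
  by rewrite iE !fE fd subrr.
by exists (CMap f'P).
Qed.

Lemma cmap_inverse C (f : cmap C C) : (forall k, lker (f k) = 0%VS) ->
  exists g : cmap C C,
    (forall k, (f k \o g k)%VF = \1%VF) /\ (forall k, (g k \o f k)%VF = \1%VF).
Proof.
move=> f0; have f1 k : limg (f k) = fullv.
  apply/eqP; rewrite -(dimv_leqif_eq (subvf _)) limg_dim_eq //.
  by rewrite f0 capv0.
have [|g gE] := @cmap_lift_inj C C C f (cidm C) f0.
  by move=> k; rewrite f1 subvf.
exists g; split=> // k; apply/lfunP => x; apply/eqP; rewrite -subr_eq0; apply/eqP.
apply: ((lker_eq0P _).1 (f0 k)); rewrite linearB /= -[X in X - _](comp_lfunE (f k)).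
by rewrite comp_lfunA gE comp_lfun1l id_lfunE subrr.
Qed.

Fixpoint cpow C (e : cmap C C) n : cmap C C :=
  if n is n'.+1 then ccomp (cpow e n') e else cidm C.

Lemma cpowE C (e : cmap C C) n k : (cpow e n k : 'Hom(_, _)) = lpow (e k) n.
Proof. by elim: n => //= n ->. Qed.

Lemma kproj_dim_bound (C : kproj) : exists N, forall i, (dim (C i) <= N)%N.
Proof.
have [b bP] := kproj_bounded C.
exists (\sum_(k < b.+1) (dim (C k%:Z) + dim (C (- k%:Z)%R)))%N => i.
have [ib|ib] := ltnP b `|i|%N.
  by have := bP i ib; rewrite /mod_zero => /(congr1 (fun V => \dim V)); rewrite dimvf dimv0 => ->.
have ib' : (`|i| < b.+1)%N by [].
rewrite (bigD1 (Ordinal ib')) //=; apply: leq_trans (leq_addr _ _).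
case: (intP i) ib' => [|k|k] _ /=; rewrite ?leq_addr //.
  by rewrite -?abszN ?leq_addl.
Qed.

Lemma retract_kproj (C : kproj) (D : complex) (i : cmap D C) (p : cmap C D) :
  (forall k, (p k \o i k)%VF = \1%VF) ->
  (forall k, mod_proj (D k)) /\
  (exists b : nat, forall k : int, (b < `|k|)%N -> mod_zero (D k)).
Proof.
move=> pi; split=> [k|]; first exact: mod_proj_retract (@kproj_proj _ _ C k) (pi k).
have [b bP] := kproj_bounded C; exists b => k /bP/mod_zeroP C0.
by apply/mod_zeroP => x; rewrite -[x]id_lfunE -pi comp_lfunE (C0 (i k x)) linear0.
Qed.

(** In each degree the power s = e^(n+1) has lker (s s) = lker s, if n bounds the
    dimensions of all terms. So [C] is the direct sum of C1 = im s, on which s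
    restricts to an automorphism [q], and of C2 = ker s. *)
Lemma fitting (C : kproj) (e : cmap C C) :
  exists (n : nat) (C1 C2 : kproj) (i1 : cmap C1 C) (p1 : cmap C C1)
    (i2 : cmap C2 C) (p2 : cmap C C2) (q r : cmap C1 C1),
  [/\ (forall k, (p1 k \o i1 k)%VF = \1%VF) /\ (forall k, (p2 k \o i2 k)%VF = \1%VF),
     (forall k, (p2 k \o i1 k)%VF = 0) /\ (forall k, (p1 k \o i2 k)%VF = 0),
     forall k, (i1 k \o p1 k)%VF + (i2 k \o p2 k)%VF = \1%VF,
     forall k, (cpow e n.+1 k : 'Hom(_, _)) = (i1 k \o (q k \o p1 k))%VF &
     (forall k, (q k \o r k)%VF = \1%VF) /\ (forall k, (r k \o q k)%VF = \1%VF)].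
Proof.
have [N NP] := kproj_dim_bound C; have [s sdef] : exists s, s = cpow e N.+1 by exists (cpow e N.+1).
have ss k x : s k (s k x) = 0 -> s k x = 0.
  rewrite sdef cpowE; apply: lker_lpow_stable; exact: leq_trans (NP k) (leqnSn N).
pose V1 k := img_sub (s k); pose V2 k := ker_sub (s k).
have d1 i j x : x \in (V1 i : {vspace _}) -> cdiff C i j x \in (V1 j : {vspace _}).
  by move=> /memv_imgP[y _ ->]; rewrite -comp_lfunE -cmapP comp_lfunE memv_img ?memvf.
have d2 i j x : x \in (V2 i : {vspace _}) -> cdiff C i j x \in (V2 j : {vspace _}).
  by rewrite !memv_ker -!comp_lfunE cmapP comp_lfunE => /eqP ->; rewrite linear0.
have [D1 [i1 [i10 i1V]]] := sub_cpx_exists d1.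
have [D2 [i2 [i20 i2V]]] := sub_cpx_exists d2.
have [|s' s'E] := @cmap_lift_inj C D1 C i1 s i10; first by move=> k; rewrite i1V.
pose q := ccomp s' i1.
have q0 k : lker (q k) = 0%VS.
  apply/lker_eq0P => x; rewrite comp_lfunE => qx.
  apply: ((lker_eq0P _).1 (i10 k)).
  have : i1 k x \in limg (i1 k) by rewrite memv_img ?memvf.
  rewrite i1V => /memv_imgP[y _ yE]; rewrite yE; apply: ss.
  by rewrite -yE -(s'E k) comp_lfunE qx linear0.
have [r [qr rq]] := cmap_inverse q0.
pose p1 := ccomp r s'.
have pi1 k : (p1 k \o i1 k)%VF = \1%VF by rewrite /= -comp_lfunA; exact: rq.
have sE k : (s k : 'Hom(_, _)) = (i1 k \o (q k \o p1 k))%VF.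
  rewrite -(s'E k); congr (_ \o _)%VF.
  by rewrite comp_lfunA qr comp_lfun1l.
have f2P : @is_cmap _ _ C C (fun k => MHom (is_mhomB (mhomP (idm (C k))) (mhomP (ccomp i1 p1 k)))).
  move=> k l; rewrite /= comp_lfunDl comp_lfunDr comp_lfunNl comp_lfunNr.
  by rewrite comp_lfun1l comp_lfun1r; congr (_ - _); exact: (cmapP (ccomp i1 p1) k l).
pose f2 := CMap f2P.
have f2E k : (f2 k : 'Hom(_, _)) = \1%VF - (i1 k \o p1 k)%VF by [].
have [|p2 p2E] := @cmap_lift_inj C D2 C i2 f2 i20.
  move=> k; rewrite i2V; apply/subvP => _ /memv_imgP[x _ ->].
  have sx y : s k y = i1 k (q k (p1 k y)).
    by rewrite sE (comp_lfunE (i1 k)) (comp_lfunE (q k)).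
  rewrite memv_ker f2E add_lfunE opp_lfunE id_lfunE linearB /= subr_eq0 !sx.
  rewrite (comp_lfunE (i1 k)) -(comp_lfunE (p1 k) (i1 k)) pi1.
  by rewrite id_lfunE.
have p12 k : (p1 k \o i2 k)%VF = 0.
  apply/lfunP => x; rewrite zero_lfunE (comp_lfunE (p1 k)) (comp_lfunE (r k)).
  suff -> : s' k (i2 k x) = 0 by rewrite linear0.
  apply: ((lker_eq0P _).1 (i10 k)); rewrite -comp_lfunE s'E; apply/eqP.
  by rewrite -memv_ker -[lker _](i2V k) memv_img ?memvf.
have p21 k : (p2 k \o i1 k)%VF = 0.
  apply/lfunP => x; rewrite zero_lfunE; apply: ((lker_eq0P _).1 (i20 k)).
  rewrite -comp_lfunE comp_lfunA p2E f2E comp_lfunDl comp_lfunNl -comp_lfunA pi1.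
  by rewrite comp_lfun1l comp_lfun1r subrr zero_lfunE.
have pi2 k : (p2 k \o i2 k)%VF = \1%VF.
  apply/lfunP => x; apply/eqP; rewrite -subr_eq0; apply/eqP.
  apply: ((lker_eq0P _).1 (i20 k)); rewrite linearB /= -(comp_lfunE (i2 k)) comp_lfunA p2E.
  rewrite f2E comp_lfunDl comp_lfunNl -comp_lfunA p12 comp_lfun0r oppr0 addr0.
  by rewrite comp_lfun1l id_lfunE subrr.
have [C1p C1b] := retract_kproj pi1; have [C2p C2b] := retract_kproj pi2.
exists N, (KProj C1p C1b), (KProj C2p C2b), i1, p1, i2, p2, q, r.
by split=> // k; rewrite ?p2E ?f2E ?(addrC (i1 k \o _)%VF) ?subrK // -sE sdef.
Qed.

End ComplexFitting.

(** * Indecomposable complexes and radical maps *)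
Section Krull.
Variables (K : fieldType) (A : falgType K).
Local Notation complex := (complex A).
Local Notation kproj := (kproj A).

Lemma heqv_comp3 (B C D E : complex) (h : cmap D E) (g g' : cmap C D) (f : cmap B C) :
  heqv g g' -> heqv (ccomp h (ccomp g f)) (ccomp h (ccomp g' f)).
Proof.
move=> gg; apply: heqv_comp; first exact: heqv_refl.
by apply: heqv_comp => //; exact: heqv_refl.
Qed.

(** One of the summands of the Fitting decomposition is contractible. If it is
    the image, a power of [e] is null-homotopic; if it is the kernel, a power of
    [e] is a homotopy equivalence, and then so is [e]. *)
Lemma indecomposable_dichotomy (C : kproj) (e : cmap C C) : indecomposable C ->
  (exists n, homotopic (fun k => cpow e n k : 'Hom(_, _)) (fun k => 0)) \/
  (exists e' : cmap C C, heqv (ccomp e e') (cidm C) /\ heqv (ccomp e' e) (cidm C)).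
Proof.
move=> [_ Ci].
have [n [C1 [C2 [i1 [p1 [i2 [p2 [q [r [[pi1 pi2] [p21 p12] ip eq [qr rq]]]]]]]]]]] :=
  fitting e.
pose V (b : bool) := if b then C1 else C2.
pose inj (b : bool) : cmap (V b) C := if b return cmap (V b) C then i1 else i2.
pose pr (b : bool) : cmap C (V b) := if b return cmap C (V b) then p1 else p2.
have [|b] := Ci V.
  exists inj, pr; split=> [[]|[] [] //= _|] /=; try exact: homotopic_eq.
  by apply: homotopic_eq => k; rewrite big_bool /= ip.
case: b => /= zero; [left; exists n.+1|right].
  apply: (@homotopic_trans _ _ _ _ (fun k => i1 k \o ((\1 \o q k) \o p1 k))%VF).
    by apply: homotopic_eq => k; rewrite eq comp_lfun1l.
  have := homotopic_compl i1 (homotopic_compr p1 (homotopic_compr q zero)).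
  move/homotopic_trans; apply; apply: homotopic_eq => k.
  by rewrite !comp_lfun0l comp_lfun0r.
have ip1 : heqv (ccomp i1 p1) (cidm C).
  have := homotopic_compl i2 (homotopic_compr p2 zero).
  move=> /(homotopic_lin (-1))/(_ (homotopic_refl (fun k => \1%VF : 'Hom(C k, C k)))).
  move=> H; rewrite /heqv; apply: homotopic_trans (homotopic_trans H _);
    apply: homotopic_eq => k /=.
    by rewrite comp_lfun1l scaleN1r -(ip k) addrC addrK.
  by rewrite comp_lfun0l comp_lfun0r scaler0 add0r.
pose s := ccomp i1 (ccomp r p1).
have es k : (cpow e n.+1 k \o s k)%VF = (i1 k \o p1 k)%VF.
  rewrite eq /= -!comp_lfunA; congr (_ \o _)%VF; rewrite [X in (_ \o X)%VF]comp_lfunA.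
  by rewrite pi1 comp_lfun1l comp_lfunA qr comp_lfun1l.
have se k : (s k \o cpow e n.+1 k)%VF = (i1 k \o p1 k)%VF.
  rewrite eq /= -!comp_lfunA; congr (_ \o _)%VF; rewrite [X in (_ \o X)%VF]comp_lfunA.
  by rewrite pi1 comp_lfun1l comp_lfunA rq comp_lfun1l.
have commute k : (e k \o cpow e n k)%VF = (cpow e n k \o e k)%VF.
  by rewrite cpowE; have := lpowD (e k) 1 n; rewrite addnC lpowD /= !comp_lfun1l => <-.
have R : heqv (ccomp e (ccomp (cpow e n) s)) (cidm C).
  apply: (heqv_trans _ ip1); apply: heqv_eq => k.
  by rewrite /= comp_lfunA commute -es.
have L : heqv (ccomp (ccomp s (cpow e n)) e) (cidm C).
  by apply: (heqv_trans _ ip1); apply: heqv_eq => k; rewrite /= -comp_lfunA -se.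
exists (ccomp (cpow e n) s); split=> //.
(* the left and the right inverse of e agree up to homotopy *)
have LR : heqv (ccomp (cpow e n) s) (ccomp s (cpow e n)).
  apply: (@heqv_trans _ _ _ _ (ccomp (ccomp (ccomp s (cpow e n)) e) (ccomp (cpow e n) s))).
    apply: heqv_sym; apply: heqv_trans (heqv_comp L (heqv_refl _)) _.
    by apply: heqv_eq => k; rewrite /= comp_lfun1l.
  apply: (@heqv_trans _ _ _ _ (ccomp (ccomp s (cpow e n)) (ccomp e (ccomp (cpow e n) s)))).
    by apply: heqv_eq => k; rewrite /= !comp_lfunA.
  apply: heqv_trans (heqv_comp (heqv_refl _) R) _.
  by apply: heqv_eq => k; rewrite /= comp_lfun1r.
exact: heqv_trans (heqv_comp LR (heqv_refl e)) L.
Qed.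

(** The chain map e = i p is idempotent only up to homotopy. On the image [D] of
    a high power it is invertible and homotopic to its square, hence homotopic
    to the identity, and [V] is equivalent to [D]. As [D] is a strict direct
    summand of [C], it vanishes in the degrees where [C] does. *)
Lemma summand_equiv_subcomplex (C : kproj) (V : complex) (i : cmap V C) (p : cmap C V) :
  heqv (ccomp p i) (cidm V) ->
  exists D : kproj, cpx_iso V D /\ (forall k, mod_zero (C k) -> mod_zero (D k)).
Proof.
move=> pi; pose e := ccomp i p.
have [n [D [D2 [i1 [p1 [i2 [p2 [q [r [[pi1 _] _ _ eq [qr rq]]]]]]]]]]] := fitting e.
have pe m : heqv (ccomp p (cpow e m)) p.
  elim: m => [|m IH]; first by apply: heqv_eq => k; rewrite /= comp_lfun1r.
  apply: (@heqv_trans _ _ _ _ (ccomp (ccomp p (cpow e m)) e)).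
    by apply: heqv_eq => k; rewrite /= comp_lfunA.
  apply: heqv_trans (heqv_comp IH (heqv_refl e)) _.
  apply: (@heqv_trans _ _ _ _ (ccomp (ccomp p i) p)).
    by apply: heqv_eq => k; rewrite /= comp_lfunA.
  apply: heqv_trans (heqv_comp pi (heqv_refl p)) _.
  by apply: heqv_eq => k; rewrite /= comp_lfun1l.
have eE m : heqv (cpow e m.+1) e.
  apply: (@heqv_trans _ _ _ _ (ccomp i (ccomp p (cpow e m)))).
    by apply: heqv_eq => k; rewrite cpowE -(addn1 m) addnC lpowD /= cpowE comp_lfun1l comp_lfunA.
  apply: heqv_trans (heqv_comp (heqv_refl i) (pe m)) _; exact: heqv_refl.
have [s [seq se ps]] : exists s : cmap C C,
    [/\ forall k, (s k : 'Hom(_, _)) = (i1 k \o (q k \o p1 k))%VF, heqv s e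
     & heqv (ccomp p s) p].
  by exists (cpow e n.+1); split; [exact: eq|exact: eE|exact: pe].
have idem k : (s k \o (i1 k \o p1 k))%VF = s k.
  by rewrite seq -!comp_lfunA [X in (_ \o (_ \o X))%VF]comp_lfunA pi1 comp_lfun1l.
exists D; split; last first.
  move=> k /mod_zeroP C0; apply/mod_zeroP => x.
  by rewrite -[x]id_lfunE -pi1 comp_lfunE (C0 (i1 k x)) linear0.
have sq k : (p1 k \o (s k \o i1 k))%VF = q k.
  by rewrite seq -!comp_lfunA pi1 comp_lfun1r comp_lfunA pi1 comp_lfun1l.
have si1 k : (s k \o i1 k)%VF = (i1 k \o q k)%VF.
  by rewrite seq -!comp_lfunA pi1 comp_lfun1r.
exists (ccomp p1 i), (ccomp p i1); split.
  have H : heqv (ccomp (ccomp p s) (ccomp i1 (ccomp p1 i)))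
                (ccomp p (ccomp i1 (ccomp p1 i))) := heqv_comp ps (heqv_refl _).
  have H' : heqv (ccomp (ccomp p s) i) (ccomp p i) := heqv_comp ps (heqv_refl _).
  rewrite -/(heqv (ccomp (ccomp p i1) (ccomp p1 i)) (cidm V)).
  apply: (@heqv_trans _ _ _ _ (ccomp p (ccomp i1 (ccomp p1 i)))).
    by apply: heqv_eq => k; rewrite /= !comp_lfunA.
  apply: heqv_trans (heqv_sym H) _.
  apply: (@heqv_trans _ _ _ _ (ccomp (ccomp p s) i)); last exact: heqv_trans H' pi.
  apply: heqv_eq => k; rewrite -[RHS]/((p k \o s k) \o i k)%VF -[in RHS]idem.
  by rewrite -[LHS]/((p k \o s k) \o (i1 k \o (p1 k \o i k)))%VF !comp_lfunA.
have q1 : heqv q (cidm D).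
  have ss : heqv (ccomp s s) s.
    apply: heqv_trans (heqv_comp se se) (heqv_trans _ (heqv_sym se)).
    by apply: heqv_trans (eE 1%N); apply: heqv_eq => k; rewrite /= comp_lfun1l.
  have qq : heqv (ccomp q q) q.
    apply: (@heqv_trans _ _ _ _ (ccomp p1 (ccomp (ccomp s s) i1))).
      apply: heqv_eq => k; rewrite -[LHS]/(q k \o q k)%VF -{1}sq.
      rewrite -[RHS]/(p1 k \o ((s k \o s k) \o i1 k))%VF -!comp_lfunA.
      by rewrite [in RHS]si1.
    apply: heqv_trans (heqv_comp3 p1 (g' := s) i1 ss) _.
    by apply: heqv_eq => k; rewrite -sq.
  apply: (@heqv_trans _ _ _ _ (ccomp (ccomp q q) r)).
    by apply: heqv_eq => k; rewrite /= -comp_lfunA qr comp_lfun1r.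
  apply: heqv_trans (heqv_comp qq (heqv_refl r)) _.
  by apply: heqv_eq => k; rewrite /= qr.
rewrite -/(heqv (ccomp (ccomp p1 i) (ccomp p i1)) (cidm D)).
apply: heqv_trans q1.
have H : heqv (ccomp p1 (ccomp e i1)) (ccomp p1 (ccomp s i1)) :=
  heqv_comp3 p1 i1 (heqv_sym se).
apply: (@heqv_trans _ _ _ _ (ccomp p1 (ccomp e i1))).
  by apply: heqv_eq => k; rewrite /= !comp_lfunA.
by apply: heqv_trans H _; apply: heqv_eq => k; rewrite -sq.
Qed.

Section Radical.
Implicit Types M N : rmod A.

Lemma is_mhom_lpow M (e : mhom M M) n : is_mhom (lpow e n).
Proof. by elim: n => [|n IH] /=; [exact: is_mhom1|exact: is_mhom_comp (mhomP e)]. Qed.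

Lemma lpow_comp_swap (V W : vectType K) (f : 'Hom(V, W)) (g : 'Hom(W, V)) n :
  lpow (g \o f)%VF n.+1 = (g \o (lpow (f \o g)%VF n \o f))%VF.
Proof.
elim: n => [|n IH]; first by rewrite /= !comp_lfun1l.
rewrite [LHS]/= -/(lpow _ n.+1) IH /= -!comp_lfunA.
by [].
Qed.

(** The inverse is the geometric series in [e]. *)
Lemma one_minus_nilpotent M (e : mhom M M) n : lpow e n = 0 ->
  exists h : mhom M M, (h \o (\1 - (e : 'End(M))) = \1)%VF /\
    ((\1 - (e : 'End(M))) \o h = \1)%VF.
Proof.
move=> en.
have hP : is_mhom (\sum_(k < n) lpow e k) by apply: is_mhom_sum => k; exact: is_mhom_lpow.
have C m : (e \o lpow e m)%VF = (lpow e m \o e)%VF.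
  by have := lpowD e 1 m; rewrite addnC lpowD /= !comp_lfun1l => <-.
have T : \sum_(k < n) (lpow e k - lpow e k.+1) = \1%VF.
  transitivity (lpow e 0 - lpow e n); last by rewrite en subr0.
  elim: {en hP}n => [|m IH]; first by rewrite big_ord0 subrr.
  by rewrite big_ord_recr IH /= addrA subrK.
exists (MHom hP); rewrite /=; split.
  rewrite comp_lfunDr comp_lfun1r comp_lfunNr -[RHS]T sumrB; congr (_ - _).
  apply/lfunP => x; rewrite comp_lfunE !sum_lfunE; apply: eq_bigr => k _.
  by rewrite /= comp_lfunE.
rewrite comp_lfunDl comp_lfun1l comp_lfunNl -[RHS]T sumrB; congr (_ - _).
apply/lfunP => x; rewrite comp_lfunE !sum_lfunE linear_sum; apply: eq_bigr => k _.
by rewrite -[RHS]/((lpow e k \o e)%VF x) -(C k) comp_lfunE.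
Qed.

Lemma rad_hom_of_nilpotent M N (f : mhom M N) :
  (forall g : mhom N M, exists n, lpow (g \o f)%VF n = 0) -> rad_hom f.
Proof.
move=> H g; have [n gf] := H g.
exact: (@one_minus_nilpotent _ (compm g f) n).
Qed.
End Radical.

Section FullFunctors.
Variable Phi : hfunctor A.

Definition full_on (C D : complex) := forall f : mhom (Phi C) (Phi D),
  exists phi : cmap C D, hmap Phi (fun k => phi k : 'Hom(_, _)) = f.

Lemma full_on_iso (C D C' D' : complex) : cpx_iso C C' -> cpx_iso D D' ->
  full_on C' D' -> full_on C D.
Proof.
move=> [a [b [ba _]]] [c [d [dc _]]] full f.
have [phi phiE] := full (compm (MHom (hmap_mhom (h:=Phi) c))
  (compm f (MHom (hmap_mhom (h:=Phi) b)))).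
exists (ccomp d (ccomp phi a)).
have := hmap_homotopic Phi dc; rewrite hmap_comp hmap_id => dc1.
have := hmap_homotopic Phi ba; rewrite hmap_comp hmap_id => ba1.
rewrite (hmap_comp Phi d (ccomp phi a)) (hmap_comp Phi phi a) phiE /=.
by rewrite -!comp_lfunA ba1 comp_lfun1r comp_lfunA dc1 comp_lfun1l.
Qed.

Lemma hmap_cpow (C : complex) (e : cmap C C) n :
  hmap Phi (fun k => cpow e n k : 'Hom(_, _)) = lpow (hmap Phi (fun k => e k : 'Hom(_, _))) n.
Proof.
elim: n => [|n IH]; first exact: hmap_id.
by rewrite /= -IH -hmap_comp.
Qed.

Lemma hmap0 (C D : complex) : @hmap _ _ Phi C D (fun k => 0) = 0.
Proof.
have := @hmap_sum _ _ Phi C D 'I_0 (fun _ _ => 0); rewrite big_ord0 => <-.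
by congr hmap; apply: functional_extensionality_dep => k; rewrite big_ord0.
Qed.

(** Lift [f] and [g] to chain maps F and G. If neither G F nor F G is nilpotent up
    to homotopy, both are equivalences by [indecomposable_dichotomy], and then F
    is one too. *)
Lemma hmap_nilpotent (C D : kproj) : indecomposable C -> indecomposable D ->
  full_on C D -> full_on D C -> ~ cpx_iso C D ->
  forall (f : mhom (Phi C) (Phi D)) (g : mhom (Phi D) (Phi C)),
  exists n, lpow (g \o f)%VF n = 0.
Proof.
move=> Ci Di CD DC niso f g; have [F FE] := CD f; have [G GE] := DC g.
have H (n : nat) : homotopic (fun k => cpow (ccomp G F) n k : 'Hom(_, _)) (fun k => 0) ->
    lpow (g \o f)%VF n = 0.
  move=> /(hmap_homotopic Phi); rewrite hmap_cpow hmap0 => <-.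
  by rewrite (hmap_comp Phi G F) FE GE.
have [[n /H nil]|[e [GFe eGF]]] := indecomposable_dichotomy (ccomp G F) Ci; first by exists n.
have [[n nil]|[e' [FGe eFG]]] := indecomposable_dichotomy (ccomp F G) Di.
  exists n.+1; apply: H.
  have := homotopic_compl G (homotopic_compr F nil).
  move=> /homotopic_trans H; apply: homotopic_trans (H _ _); apply: homotopic_eq => k.
    rewrite !cpowE; exact: lpow_comp_swap.
  by rewrite comp_lfun0l comp_lfun0r.
exfalso; apply: niso; exists F, (ccomp G e'); split; last first.
  by apply: homotopic_trans FGe; apply: homotopic_eq => k; rewrite /= comp_lfunA.
(* the left and the right inverse of F agree up to homotopy *)
have LR : heqv (ccomp G e') (ccomp e G).
  apply: (@heqv_trans _ _ _ _ (ccomp (ccomp e (ccomp G F)) (ccomp G e'))).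
    apply: heqv_sym; apply: heqv_trans (heqv_comp eGF (heqv_refl _)) _.
    by apply: heqv_eq => k; rewrite /= comp_lfun1l.
  apply: (@heqv_trans _ _ _ _ (ccomp (ccomp e G) (ccomp (ccomp F G) e'))).
    by apply: heqv_eq => k; rewrite /= !comp_lfunA.
  apply: heqv_trans (heqv_comp (heqv_refl _) FGe) _.
  by apply: heqv_eq => k; rewrite /= comp_lfun1r.
rewrite -/(heqv (ccomp (ccomp G e') F) (cidm C)).
apply: heqv_trans (heqv_comp LR (heqv_refl F)) _; apply: heqv_trans eGF.
by apply: heqv_eq => k; rewrite /= comp_lfunA.
Qed.
End FullFunctors.

End Krull.

(** * Complexes concentrated in degrees -1 and 0 *)
Section TwoTerm.
Variables (K : fieldType) (A : falgType K).
Local Notation complex := (complex A).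
Local Notation kproj := (kproj A).
Local Notation hdim M N := (\dim (hom_space M N)).

Lemma hfunctor_iso (Phi : hfunctor A) (C D : complex) : cpx_iso C D -> mod_iso (Phi C) (Phi D).
Proof.
move=> [f [g [gf fg]]].
exists (MHom (hmap_mhom (h:=Phi) f)), (MHom (hmap_mhom (h:=Phi) g)) => /=.
have := hmap_homotopic Phi gf; rewrite hmap_comp hmap_id => ->.
by have := hmap_homotopic Phi fg; rewrite hmap_comp hmap_id => ->.
Qed.

Lemma proj_lift (Q M N : rmod A) (g : mhom M N) (f : mhom Q N) :
  mod_proj Q -> (limg f <= limg g)%VS -> exists h : mhom Q M, (g \o h)%VF = f.
Proof.
move=> Qp fg; have [g' gE g1] := mhom_corestrict g.
have [|f' fE] := @mhom_lift_inj _ _ _ _ _ (sub_incl (img_sub g)) f (lker_sub_incl _).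
  by rewrite limg_sub_incl.
have [h hE] := Qp _ _ g' f' g1; exists h.
by rewrite -fE -hE comp_lfunA gE.
Qed.

Section CohomologyEnds.
Variables (k : int) (C : complex).

Lemma coh_quotient : (forall z : C k, cdiff C k (k + 1) z = 0) ->
  exists p : mhom (C k) (cohomology k C), [/\ (p : 'Hom(_, _)) = coh_class k C,
    limg p = fullv & limg (cdiff C (k - 1) k) = lker p].
Proof.
move=> Z; have pP : is_mhom (coh_class k C) by move=> a z; apply: coh_class_act.
exists (MHom pP); split=> //=.
  by apply/limg_fullP => y; exists (coh_rep k C y); exact: coh_class_rep.
apply/vspaceP => z; rewrite memv_ker; apply/idP/eqP => H; exact/coh_class_eq0.
Qed.

Lemma coh_rep_class z : (cdiff C (k - 1) k : 'Hom(_, _)) = 0 ->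
  cdiff C k (k + 1) z = 0 -> coh_rep k C (coh_class k C z) = z.
Proof.
move=> d0 zZ; apply/eqP; rewrite -subr_eq0; apply/eqP.
set y := _ - z; have : coh_class k C y = 0.
  by rewrite linearB /= coh_class_rep subrr.
move=> /coh_class_eq0; rewrite d0 => H.
have /memv_imgP[x _ ->] : y \in limg (0 : 'Hom(C (k - 1), C k)).
  by apply: H; rewrite linearB /= coh_rep_cocycle zZ subrr.
by rewrite zero_lfunE.
Qed.

Lemma coh_inclusion : (cdiff C (k - 1) k : 'Hom(_, _)) = 0 ->
  exists j : mhom (cohomology k C) (C k), [/\ (j : 'Hom(_, _)) = coh_rep k C,
    lker j = 0%VS & limg j = lker (cdiff C k (k + 1))].
Proof.
move=> d0; have jP : is_mhom (coh_rep k C).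
  move=> a u; rewrite -{1}[u]coh_class_rep -coh_class_act ?coh_rep_cocycle //.
  by rewrite coh_rep_class // mhomP coh_rep_cocycle linear0.
exists (MHom jP); split=> //=.
  by apply/lker_eq0P => u; move/(congr1 (coh_class k C)); rewrite coh_class_rep linear0.
apply/vspaceP => z; rewrite memv_ker; apply/memv_imgP/eqP => [[u _ ->]|zZ].
  exact: coh_rep_cocycle.
by exists (coh_class k C z); rewrite ?memvf // coh_rep_class.
Qed.
End CohomologyEnds.

Lemma mhom_to_zero (M N : rmod A) (f g : 'Hom(M, N)) : mod_zero N -> f = g.
Proof. by move=> /mod_zeroP N0; apply/lfunP => x; rewrite [LHS]N0 [RHS]N0. Qed.

Lemma mhom_from_zero (M N : rmod A) (f g : 'Hom(M, N)) : mod_zero M -> f = g.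
Proof. by move=> /mod_zeroP M0; apply/lfunP => x; rewrite (M0 x) !linear0. Qed.

Definition concentrated (C : complex) := forall i : int, i != - 1 -> i != 0 -> mod_zero (C i).

Lemma nak_zero (M : rmod A) : mod_zero M -> mod_zero (nak_mod M).
Proof.
move=> M0; apply/mod_zeroP => x; apply/lfunP => f; rewrite zero_lfunE.
suff -> : f = 0 by rewrite linear0.
by apply: homA_inj => p; rewrite ((mod_zeroP M).1 M0 p) !linear0.
Qed.

Section Concentrated.
Variables (C : kproj) (C2 : concentrated C).
Local Notation d := (cdiff C (- 1) 0).

Lemma H0_presentation : exists p : mhom (C 0) (H0 C), [/\ (p : 'Hom(_, _)) = coh_class 0 C,
  limg p = fullv & limg d = lker p].
Proof.
apply: coh_quotient => z; have /mod_zeroP C1 : mod_zero (C (0 + 1)) by apply: C2.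
exact: C1.
Qed.

Lemma Hm1nu_copresentation : exists j : mhom (Hm1nu C) (nak_mod (C (- 1))),
  [/\ (j : 'Hom(_, _)) = coh_rep (-1) (nak_complex C), lker j = 0%VS
    & limg j = lker (nak_hom d)].
Proof.
apply: (@coh_inclusion (-1) (nak_complex C)).
by apply: mhom_from_zero; apply: nak_zero; apply: C2.
Qed.

Lemma hdim_Hm1nu X :
  (hdim X (Hm1nu C) + \dim (rcomp X d @: hom_space (C 0%R) X))%N = hdim (C (- 1)%R) X.
Proof.
have [j [_ j0 jE]] := Hm1nu_copresentation.
rewrite -(dim_nak_kernel X d (@kproj_proj _ _ C _) (@kproj_proj _ _ C _)); congr (_ + _)%N.
have := hdim_left_exact X j0 jE.
have := limg_ker_dim (lcomp X (nak_hom d)) (hom_space X (nak_mod (C (- 1)))).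
move=> e1 e2; apply/eqP.
by rewrite -(eqn_add2r (\dim (lcomp X (nak_hom d) @: hom_space X (nak_mod (C (- 1)%R))))) e1 -e2.
Qed.

(** The Euler characteristic of the complex Hom(C, X): its kernel is
    Hom(H0 C, X), and its cokernel is dual to Hom(X, Hm1nu C). *)
Lemma hdim_euler X :
  (hdim (H0 C) X + hdim (C (- 1)%R) X = hdim (C 0%R) X + hdim X (Hm1nu C))%N.
Proof.
have [p [_ p1 pE]] := H0_presentation.
by rewrite (hdim_right_exact X pE p1) -hdim_Hm1nu addnCA addnC addnAC.
Qed.
End Concentrated.

Lemma concentrated_cmap (C D : complex) (f1 : mhom (C (- 1)) (D (- 1))) (f0 : mhom (C 0) (D 0)) :
  concentrated C -> concentrated D ->
  (f0 \o cdiff C (- 1) 0)%VF = (cdiff D (- 1) 0 \o f1)%VF ->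
  exists f : cmap C D, f (- 1) = f1 /\ f 0 = f0.
Proof.
move=> C2 D2 E; pose f (i : int) : mhom (C i) (D i) :=
  match i with Posz 0 => f0 | Negz 0 => f1 | i' => zerom (C i') (D i') end.
have fP : is_cmap f.
  move=> i j; have [->|ne] := eqVneq j (i + 1); last first.
    by rewrite !cdiff_shape // comp_lfun0r comp_lfun0l.
  case: i => [[|n]|[|n]] //; first by apply: mhom_to_zero; apply: D2.
    by apply: mhom_from_zero; apply: C2.
  by apply: mhom_from_zero; apply: C2.
by exists (CMap fP).
Qed.

(** A map on H0 lifts to the projective presentations. *)
Lemma H0_full (C D : kproj) : concentrated C -> concentrated D ->
  full_on (H0_functor A) C D.
Proof.
move=> C2 D2 f; have [p [pE p1 pd]] := H0_presentation C2.
have [q [qE q1 qd]] := H0_presentation D2.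
have [f0 f0E] := @kproj_proj _ _ C 0 _ _ q (compm f p) q1.
have [|f1 f1E] := @proj_lift _ _ _ (cdiff D (- 1) 0) (compm f0 (cdiff C (- 1) 0))
    (@kproj_proj _ _ C (-1)).
  rewrite qd; apply/subvP => _ /memv_imgP[x _ ->]; rewrite memv_ker.
  rewrite -comp_lfunE /= comp_lfunA f0E /= -comp_lfunA comp_lfunE.
  have /eqP -> : (p \o cdiff C (- 1) 0)%VF x == 0.
    by rewrite comp_lfunE -memv_ker -pd memv_img ?memvf.
  by rewrite linear0.
have [phi [_ phi0]] := concentrated_cmap C2 D2 (esym f1E).
exists phi; apply: coh_map_ext => z zZ.
rewrite coh_map_class //; last exact: cmap_compatible.
by rewrite phi0 -qE -pE -(comp_lfunE q) f0E comp_lfunE.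
Qed.

(** A map on Hm1nu extends to the injective copresentations by the nu C(-1) and
    nu C(0); the extensions come from maps between the projectives because nu is
    fully faithful on those. *)
Lemma Hm1nu_full (C D : kproj) : concentrated C -> concentrated D ->
  full_on (Hm1nu_functor A) C D.
Proof.
move=> C2 D2 f; have [j [jE j0 jd]] := Hm1nu_copresentation C2.
have [l [lE l0 ld]] := Hm1nu_copresentation D2.
have Dp i : mod_proj (D i) by exact: kproj_proj.
have [|g gE] := @nak_mod_extend _ _ _ (Dp (-1)) _ _ j (compm l f); first by rewrite j0 sub0v.
have [|g0 g0E] := @nak_mod_extend _ _ _ (Dp 0) _ _ (nak_hom (cdiff C (- 1) 0))
    (compm (nak_hom (cdiff D (- 1) 0)) g).
  rewrite -jd; apply/subvP => _ /memv_imgP[x _ ->]; rewrite memv_ker comp_lfunE.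
  by rewrite -(comp_lfunE g) gE comp_lfunE -memv_ker -ld memv_img ?memvf.
have [f1 f1E] := nak_hom_full g (Dp (-1)).
have [f0 f0E] := nak_hom_full g0 (Dp 0).
have E : (f0 \o cdiff C (- 1) 0)%VF = (cdiff D (- 1) 0 \o f1)%VF.
  apply: (@nak_hom_inj _ _ _ _ (compm f0 (cdiff C (- 1) 0)) (compm (cdiff D (- 1) 0) f1)) => //.
  by rewrite !nak_hom_comp f0E f1E g0E.
have [phi [phi1 _]] := concentrated_cmap C2 D2 E.
exists phi; apply/lfunP => u; apply: etrans (coh_mapE _ u) _.
rewrite nak_lfun_mhom phi1 f1E -jE -(comp_lfunE g) gE; rewrite (comp_lfunE l f) lE.
exact: (@coh_class_rep _ _ _ (nak_complex D)).
Qed.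

Section Presilting.
Variables (U : complex) (C : kproj) (C2 : concentrated C).
Variables (a : cmap U C) (b : cmap C U).
Hypothesis ab : homotopic (fun i => a i \o b i)%VF (fun i => \1%VF).
Hypothesis pre : forall f : cmap U (shift 1 U),
  homotopic (fun i => f i : 'Hom(_, _)) (fun i => 0).
Local Notation d := (cdiff C (- 1) 0).

(** [h] is the component in degree -1 of a chain map C -> C[1]. Along the
    equivalence it becomes a chain map U -> U[1], which is null-homotopic; going
    back to [C] gives [s] and [t]. Only the degrees -1 and 0 are compared, where
    the indices i + 1 and i - 1 are closed terms that compute. *)
Lemma presilting_factor (h : mhom (C (- 1)) (C 0)) :
  exists (s : mhom (C (- 1)) (C (- 1))) (t : mhom (C 0) (C 0)),
    (h : 'Hom(_, _)) = (d \o s)%VF + (t \o d)%VF.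
Proof.
pose F (i : int) : mhom (U i) (shift 1 U i) :=
  match i with Negz 0 => compm (b 0) (compm h (a (- 1))) | i' => zerom (U i') (shift 1 U i') end.
have FP : is_cmap F.
  move=> i j; have [->|ne] := eqVneq j (i + 1); last first.
    by rewrite !cdiff_shape // comp_lfun0r comp_lfun0l.
  case: i => [n|[|[|n]]]; rewrite /= ?comp_lfun0r ?comp_lfun0l //.
    change (0 = (((-1) ^+ 1 *: (cdiff U 0 1 : 'Hom(_, _))) \o (b 0 \o (h \o a (- 1))))%VF).
    rewrite -comp_lfunZl !comp_lfunA -(cmapP b 0 1).
    have -> : (cdiff C 0 1 : 'Hom(_, _)) = 0 by apply: mhom_to_zero; apply: C2.
    by rewrite comp_lfun0r !comp_lfun0l scaler0.
  change (((b 0 \o (h \o a (- 1))) \o cdiff U (- 2) (- 1))%VF = 0).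
  rewrite -!comp_lfunA (cmapP a (- 2) (- 1)).
  have -> : (cdiff C (- 2) (- 1) : 'Hom(_, _)) = 0 by apply: mhom_from_zero; apply: C2.
  by rewrite comp_lfun0l !comp_lfun0r.
have [k kE] := pre (CMap FP); have [s sE] := ab.
have {kE} E : (b 0 \o (h \o a (- 1)))%VF =
    (((-1) ^+ 1 *: (cdiff U (- 1) 0 : 'Hom(_, _))) \o k (- 1)%R (- 1 - 1)%R)%VF
    + (k 0%R (- 1)%R \o cdiff U (- 1) 0)%VF.
  by rewrite -[LHS]subr0; exact: (kE (-1)).
pose s1 : mhom (C 0) (C (- 1)) := s 0%R (- 1)%R.
have E0 : (a 0 \o b 0)%VF = \1%VF + (d \o s1)%VF.
  apply/eqP; rewrite addrC -subr_eq; apply/eqP; apply: etrans (sE 0) _.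
  rewrite (_ : (s (0 + 1) 0 \o _)%VF = 0) ?addr0 //.
  have -> : (cdiff C 0 (0 + 1) : 'Hom(_, _)) = 0 by apply: mhom_to_zero; apply: C2.
  by rewrite comp_lfun0r.
have E1 : (a (- 1) \o b (- 1))%VF = \1%VF + (s1 \o d)%VF.
  apply/eqP; rewrite addrC -subr_eq; apply/eqP; apply: etrans (sE (- 1)) _.
  rewrite (_ : (cdiff C (- 1 - 1) (- 1) \o _)%VF = 0) ?add0r //.
  have -> : (cdiff C (- 1 - 1) (- 1) : 'Hom(_, _)) = 0 by apply: mhom_from_zero; apply: C2.
  by rewrite comp_lfun0l.
pose k1 : mhom (U (- 1)) (U (- 1)) := k (- 1)%R (- 1 - 1)%R.
pose k0 : mhom (U 0) (U 0) := k 0%R (- 1)%R.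
have {}E : (b 0 \o (h \o a (- 1)))%VF = (k0 \o cdiff U (- 1) 0)%VF - (cdiff U (- 1) 0 \o k1)%VF.
  by rewrite E expr1 scaleN1r comp_lfunNl addrC.
pose s' := MHom (is_mhomB (is_mhomN (mhomP (compm (a (- 1)) (compm k1 (b (- 1))))))
  (mhomP (compm s1 h))).
pose t' := MHom (is_mhomB (mhomP (compm (a 0) (compm k0 (b 0))))
  (is_mhomD (mhomP (compm h s1)) (mhomP (compm d (compm s1 (compm h s1)))))).
exists s', t'.
have : ((a 0 \o b 0) \o (h \o (a (- 1) \o b (- 1))))%VF =
   (a 0 \o ((b 0 \o (h \o a (- 1))) \o b (- 1)))%VF by rewrite !comp_lfunA.
rewrite E0 E1 E.
have aU : (a 0 \o cdiff U (- 1) 0)%VF = (d \o a (- 1))%VF := cmapP a (- 1) 0.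
have bU : (cdiff U (- 1) 0 \o b (- 1))%VF = (b 0 \o d)%VF := esym (cmapP b (- 1) 0).
rewrite !(comp_lfunDl, comp_lfunDr, comp_lfunNl, comp_lfunNr) -!comp_lfunA bU.
rewrite !comp_lfunA aU !comp_lfun1l !comp_lfun1r.
set HS := ((h \o s1) \o d)%VF; set SH := ((d \o s1) \o h)%VF.
set SHS := ((SH \o s1) \o d)%VF; set X := (_ \o d)%VF; set Y := (_ \o b (- 1))%VF.
move=> H; transitivity (X - Y - (HS + (SH + SHS))); first by rewrite -H -(addrA (h : 'Hom(_, _)) HS) addrK.
by rewrite !opprD [RHS](AC (2*(1*2)) ((3*1)*(4*(2*5)))).
Qed.

(** By [presilting_factor] each map C(-1) -> H0 C extends over the differential,
    so the cokernel that is dual to Hom(H0 C, Hm1nu C) vanishes. *)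
Lemma presilting_hdim : hdim (H0 C) (Hm1nu C) = 0%N.
Proof.
have := hdim_Hm1nu C2 (H0 C); set T := (_ @: _)%VS.
suff -> : T = hom_space (C (- 1)) (H0 C) by move=> /eqP; rewrite -[X in _ == X]add0n eqn_add2r => /eqP.
have [p [_ p1 pE]] := H0_presentation C2.
apply/vspaceP => k; apply/memv_imgP/idP => [[f /hom_mhom[f' <-] ->]|/hom_mhom[k' <-]].
  by rewrite rcompE; exact: (mem_hom (compm f' d)).
have [h hE] := @kproj_proj _ _ C (-1) _ _ p k' p1.
have [s [t stE]] := presilting_factor h.
exists (mfun (compm p t)); rewrite ?mem_hom // rcompE -hE stE comp_lfunDr !comp_lfunA.
suff -> : (p \o d)%VF = 0 by rewrite comp_lfun0l add0r.
apply/lfunP => x; rewrite zero_lfunE comp_lfunE; apply/eqP.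
by rewrite -memv_ker -pE memv_img ?memvf.
Qed.
End Presilting.

End TwoTerm.

(** * Semistable quotients of the top and submodules of the socle *)
Lemma exists_minimal (T : Type) (Q : T -> Prop) (m : T -> nat) :
  (exists x, Q x) -> exists x, Q x /\ forall y, Q y -> (m x <= m y)%N.
Proof.
move=> [x0 Q0]; have [k] := ubnP (m x0); elim: k x0 Q0 => // k IH x Qx xk.
have [H|/existsNP[y /not_implyP[Qy /negP]]] :=
  pselect (forall y, Q y -> (m x <= m y)%N); first by exists x.
by rewrite -ltnNge => yx; apply: (IH y) => //; apply: leq_trans yx _.
Qed.

Section Stability.
Variables (K : fieldType) (A : falgType K) (R : realType).
Variables (n : nat) (P : 'I_n -> rmod A).
Hypothesis Pp : forall j, mod_proj (P j).
Local Notation hdim M N := (\dim (hom_space M N)).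
Local Notation pairing := (pairing P).
Implicit Type theta : 'rV[R]_n.

Lemma surj_nonzero (M X : rmod A) (p : mhom M X) : limg p = fullv ->
  ~ mod_zero X -> (p : 'Hom(_, _)) <> 0.
Proof.
move=> /limg_fullP p1 X0 p0; apply: X0; apply/mod_zeroP => y.
by have [x <-] := p1 y; rewrite p0 zero_lfunE.
Qed.

Lemma img_nonzero (M X : rmod A) (p : mhom M X) :
  (p : 'Hom(_, _)) <> 0 -> ~ mod_zero (sub_mod (img_sub p)).
Proof.
move=> p0 /mod_zeroP z; apply: p0; apply/lfunP => x; rewrite zero_lfunE.
have px : p x \in limg p by rewrite memv_img ?memvf.
have := z (vsproj _ (p x)); move/(congr1 vsval); by rewrite vsprojK // => ->.
Qed.

Section Top.
Variables (theta : 'rV[R]_n) (M : rmod A) (I : finType) (Ms : I -> rmod A).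
Variables (inj : forall i, mhom (Ms i) M) (pr : forall i, mhom M (Ms i)).
Hypothesis sum1 : \sum_i (inj i \o pr i)%VF = \1%VF.

(** Take f : M -> X nonzero with f End(M) of minimal dimension, and [i] with f
    nonzero on M_i. If f r were nonzero for a radical r : M -> M_i, minimality
    would give f = f r e, so f r (1 - e r) = 0 with 1 - e r invertible, which is
    absurd. Hence f restricted to M_i factors through M_i / rad_image. The image
    pairs to something at most 0, because [X] does and because X modulo the
    image, a quotient of [M], pairs to something at least 0. *)
Lemma not_Tors_top (X : rmod A) (p : mhom M X) : Tbar P theta M ->
  limg p = fullv -> ~ mod_zero X -> pairing theta X <= 0 ->
  exists i, ~ Tors P theta (factor_mod (rad_image M (Ms i))).
Proof.
move=> /TbarP Tb p1 X0 pX.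
have [f [f0 fmin]] := @exists_minimal (mhom M X) (fun f => (f : 'Hom(_, _)) <> 0)
  (fun f => \dim (lcomp M f @: hom_space M M)) (ex_intro _ p (surj_nonzero p1 X0)).
have [i fi0] : exists i, (f \o inj i)%VF <> 0.
  apply: contrapT => /forallNP H; apply: f0; rewrite -[LHS]comp_lfun1r -sum1.
  apply/lfunP => x; rewrite comp_lfunE sum_lfunE linear_sum zero_lfunE big1 // => i _.
  have /contrapT/lfunP/(_ (pr i x)) := H i.
  by rewrite !comp_lfunE zero_lfunE.
exists i; pose fi := compm f (inj i); apply/not_TorsP.
have [q qE q1] := mhom_corestrict fi.
exists (sub_mod (img_sub fi)), q; split=> //; last 2 first.
- exact: img_nonzero.
- have e := short_exact_coker (lker_sub_incl (img_sub fi)).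
  have := Tb _ (compm (factor_proj (img_sub (sub_incl (img_sub fi)))) p).
  rewrite limg_comp p1 limg_factor_proj => /(_ erefl) /=.
  by move: pX; rewrite (pairing_exact Pp _ e); lra.
apply: vspan_min => _ [r [rr [y ->]]]; rewrite memv_ker; apply/eqP.
apply: ((lker_eq0P _).1 (lker_sub_incl (img_sub fi))); rewrite -(comp_lfunE (sub_incl _)) qE.
suff fr : (fi \o r)%VF = 0 by rewrite -comp_lfunE fr zero_lfunE.
apply: contrapT => g0; pose g := compm fi r.
have gf : (lcomp M g @: hom_space M M <= lcomp M f @: hom_space M M)%VS.
  apply/subvP => _ /memv_imgP[e /hom_mhom[e' <-] ->]; apply/memv_imgP.
  exists (mfun (compm (inj i) (compm r e'))); rewrite ?mem_hom // !lcompE /=.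
  by rewrite !comp_lfunA.
have /eqP E : (lcomp M g @: hom_space M M == lcomp M f @: hom_space M M)%VS.
  by rewrite -(dimv_leqif_eq gf) eqn_leq dimvS // fmin.
have : (f : 'Hom(_, _)) \in (lcomp M f @: hom_space M M)%VS.
  apply/memv_imgP; exists \1%VF; last by rewrite lcompE comp_lfun1r.
  exact: (mem_hom (idm M)).
rewrite -E => /memv_imgP[e /hom_mhom[e' <-]]; rewrite lcompE => fE.
have [h [_ hE]] := rr (compm e' (inj i)).
apply: g0; rewrite -[LHS]comp_lfun1r -hE comp_lfunA comp_lfunDr comp_lfun1r comp_lfunNr.
suff -> : ((fi \o r) \o (compm e' (inj i) \o r))%VF = (fi \o r)%VF.
  by rewrite subrr comp_lfun0l.
by rewrite [in RHS]/= [in RHS]fE /= !comp_lfunA.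
Qed.

End Top.

Section Socle.
Variables (theta : 'rV[R]_n) (N : rmod A) (I : finType) (Ns : I -> rmod A).
Variables (inj : forall i, mhom (Ns i) N) (pr : forall i, mhom N (Ns i)).
Hypothesis sum1 : \sum_i (inj i \o pr i)%VF = \1%VF.

(** Dual to [not_Tors_top], with f : Y -> N nonzero and End(N) f of minimal
    dimension. *)
Lemma not_Free_socle (Y : rmod A) (j : mhom Y N) : Fbar P theta N ->
  lker j = 0%VS -> ~ mod_zero Y -> 0 <= pairing theta Y ->
  exists i, ~ Free P theta (sub_mod (rad_kernel (Ns i) N)).
Proof.
move=> /FbarP Fb j0 Y0 pY.
have jn0 : (j : 'Hom(_, _)) <> 0.
  move=> jz; apply: Y0; apply/mod_zeroP => y; apply: ((lker_eq0P _).1 j0).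
  by rewrite jz zero_lfunE.
have [f [f0 fmin]] := @exists_minimal (mhom Y N) (fun f => (f : 'Hom(_, _)) <> 0)
  (fun f => \dim (rcomp N f @: hom_space N N)) (ex_intro _ j jn0).
have [i fi0] : exists i, (pr i \o f)%VF <> 0.
  apply: contrapT => /forallNP H; apply: f0; rewrite -[LHS]comp_lfun1l -sum1.
  apply/lfunP => x; rewrite comp_lfunE sum_lfunE zero_lfunE big1 // => i _.
  have /contrapT/lfunP/(_ x) := H i.
  by rewrite !comp_lfunE zero_lfunE => ->; rewrite linear0.
exists i; pose fi := compm (pr i) f; apply/not_FreeP.
exists (sub_mod (img_sub fi)), (sub_incl (img_sub fi)); split.
- exact: lker_sub_incl.
- rewrite limg_sub_incl; apply/subvP => _ /memv_imgP[y _ ->].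
  apply/rad_kernelP => r rr.
  suff rf : (r \o fi)%VF = 0 by rewrite -comp_lfunE rf zero_lfunE.
  apply: contrapT => g0; pose g := compm r fi.
  have gf : (rcomp N g @: hom_space N N <= rcomp N f @: hom_space N N)%VS.
    apply/subvP => _ /memv_imgP[e /hom_mhom[e' <-] ->]; apply/memv_imgP.
    exists (mfun (compm e' (compm r (pr i)))); rewrite ?mem_hom // !rcompE /=.
    by rewrite !comp_lfunA.
  have /eqP E : (rcomp N g @: hom_space N N == rcomp N f @: hom_space N N)%VS.
    by rewrite -(dimv_leqif_eq gf) eqn_leq dimvS // fmin.
  have : (f : 'Hom(_, _)) \in (rcomp N f @: hom_space N N)%VS.
    apply/memv_imgP; exists \1%VF; last by rewrite rcompE comp_lfun1l.
    exact: (mem_hom (idm N)).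
  rewrite -E => /memv_imgP[e /hom_mhom[e' <-]]; rewrite rcompE => fE.
  have [h [hE _]] := rr (compm (pr i) e').
  apply: fi0; rewrite -[LHS]comp_lfun1l -hE -comp_lfunA comp_lfunDl comp_lfun1l comp_lfunNl.
  suff -> : ((compm (pr i) e' \o r) \o (pr i \o f))%VF = (pr i \o f)%VF.
    by rewrite subrr comp_lfun0r.
  by rewrite [in RHS]fE /= !comp_lfunA.
- exact: img_nonzero.
have [q qE q1] := mhom_corestrict fi.
have := Fb _ (compm j (sub_incl (ker_sub q))); rewrite (_ : lker _ = 0%VS).
  by move=> /(_ erefl); move: pY; rewrite (pairing_exact Pp _ (short_exact_ker q1)); lra.
apply/lker_eq0P => x; rewrite comp_lfunE => /((lker_eq0P _).1 j0).
exact: ((lker_eq0P _).1 (lker_sub_incl _)).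
Qed.

End Socle.

Lemma pairing_ker_img theta (M N : rmod A) (f : mhom M N) :
  pairing theta M = pairing theta (sub_mod (ker_sub f)) + pairing theta (sub_mod (img_sub f)).
Proof.
have [q qE q1] := mhom_corestrict f.
rewrite (pairing_exact Pp _ (short_exact_ker q1)); congr (_ + _).
have qf : (ker_sub q : {vspace M}) = ker_sub f.
  apply/vspaceP => x /=; rewrite !memv_ker.
  have -> : f x = sub_incl (img_sub f) (q x).
    by move/lfunP: qE => /(_ x) <-; rewrite comp_lfunE.
  apply/eqP/eqP => [->|]; first by rewrite linear0.
  exact: ((lker_eq0P _).1 (lker_sub_incl _)).
apply: pairing_iso; apply: (@sub_iso _ _ _ _ (ker_sub f) (sub_incl (ker_sub q))).
  exact: lker_sub_incl.
by rewrite limg_sub_incl.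
Qed.

Lemma factor_proj_eq0 (M : rmod A) (V : submodule M) x :
  (factor_proj V x = 0) <-> x \in (V : {vspace M}).
Proof.
have <- : (x \in lker (factor_proj V)) = (x \in (V : {vspace M})) by rewrite lker_factor_proj.
by rewrite memv_ker; split=> [->|/eqP].
Qed.

(** Take [V] of minimal dimension with the first three properties. The kernel of
    a nonzero map V -> N would be a smaller choice: it contains the radical
    image, as Hom(M, N) = 0, and V modulo it is a submodule of [N], which pairs
    to something at most 0. *)
Lemma semistable_top_quotient theta (M N Mi : rmod A) : Fbar P theta N -> hdim M N = 0%N ->
  ~ Tors P theta (factor_mod (rad_image M Mi)) ->
  exists V : submodule Mi, [/\ (rad_image M Mi <= V)%VS, ~ mod_zero (factor_mod V),
    pairing theta (factor_mod V) <= 0 & hdim (sub_mod V) N = 0%N].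
Proof.
move=> /FbarP Fb /hdim_zeroP MN /not_TorsP[X [p [p1 Wp X0 pX]]].
set W := rad_image M Mi in Wp *.
pose Q (V : submodule Mi) := [/\ (W <= V)%VS, ~ mod_zero (factor_mod V) &
  pairing theta (factor_mod V) <= 0].
have Qp : Q (ker_sub p).
  have iso := @factor_iso _ _ _ _ (ker_sub p) p p1 erefl.
  by split=> //; rewrite ?(pairing_iso _ _ iso) // => /(mod_zero_iso iso).
have [V [[WV V0 pV] Vmin]] := @exists_minimal _ Q (fun V => \dim V) (ex_intro _ _ Qp).
exists V; split=> //; apply/hdim_zeroP => f; apply: contrapT => f0.
pose i := compm (sub_incl V) (sub_incl (ker_sub f)).
have i0 : lker i = 0%VS.
  apply/lker_eq0P => x; rewrite comp_lfunE => /((lker_eq0P _).1 (lker_sub_incl V)).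
  exact: ((lker_eq0P _).1 (lker_sub_incl (ker_sub f))).
have iP x : (x \in limg i) <-> exists2 v, f v = 0 & x = sub_incl V v.
  split=> [/memv_imgP[u _ ->]|[v fv ->]].
    exists (sub_incl (ker_sub f) u); last by rewrite comp_lfunE.
    by apply/eqP; rewrite -memv_ker -[lker f](limg_sub_incl (ker_sub f)) memv_img ?memvf.
  have : v \in limg (sub_incl (ker_sub f)) by rewrite limg_sub_incl memv_ker fv.
  by move=> /memv_imgP[u _ ->]; rewrite -(comp_lfunE (sub_incl V)) memv_img ?memvf.
have V'V : (limg i <= V)%VS.
  by apply/subvP => x /iP[v _ ->]; rewrite sub_inclE subvsP.
have Q' : Q (img_sub i).
  split.
  - apply: vspan_min => _ [r [rr [y ->]]]; apply/iP.
    have [|r' rE] := @mhom_lift_inj _ _ _ _ _ (sub_incl V) r (lker_sub_incl V).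
      rewrite limg_sub_incl; apply: subv_trans WV.
      by apply/subvP => _ /memv_imgP[z _ ->]; apply: sub_vspan; exists r; split=> //; exists z.
    exists (r' y); last by rewrite -rE comp_lfunE.
    by have := MN (compm f r'); move=> /lfunP/(_ y); rewrite comp_lfunE zero_lfunE.
  - move=> /mod_zeroP z; apply: V0; apply/mod_zeroP => y.
    have [x <-] := (limg_fullP _).1 (limg_factor_proj V) y; apply/factor_proj_eq0.
    by apply: (subvP V'V); apply/(factor_proj_eq0 (img_sub i)); apply: z.
  - have e1 := pairing_exact Pp theta (short_exact_coker i0).
    have e2 := pairing_exact Pp theta (short_exact_factor V).
    have e3 := pairing_ker_img theta f.
    have := Fb _ _ (lker_sub_incl (img_sub f)).
    by move: pV e1 e2 e3; rewrite /=; lra.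
have := Vmin _ Q'; rewrite leqNgt => /negP; apply.
rewrite ltn_neqAle dimvS // andbT (dimv_leqif_eq V'V); apply/eqP => E.
apply: f0; apply/lfunP => v; rewrite zero_lfunE.
have : sub_incl V v \in limg i by rewrite E sub_inclE subvsP.
move=> /iP[u fu uv]; suff -> : v = u by [].
by apply: vsval_inj; rewrite -!sub_inclE.
Qed.

(** Dual to [semistable_top_quotient]: take [V] of maximal dimension, and enlarge
    it by the preimage of the image of a nonzero map M -> Ni / V. *)
Lemma semistable_socle_sub theta (M N Ni : rmod A) : Tbar P theta M -> hdim M N = 0%N ->
  ~ Free P theta (sub_mod (rad_kernel Ni N)) ->
  exists V : submodule Ni, [/\ (V <= rad_kernel Ni N)%VS, ~ mod_zero (sub_mod V),
    0 <= pairing theta (sub_mod V) & hdim M (factor_mod V) = 0%N].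
Proof.
move=> /TbarP Tb /hdim_zeroP MN /not_FreeP[Y [j [j0 jW Y0 pY]]].
pose Q (V : submodule Ni) := [/\ (V <= rad_kernel Ni N)%VS, ~ mod_zero (sub_mod V) &
  0 <= pairing theta (sub_mod V)].
have Qj : Q (img_sub j).
  have iso := @sub_iso _ _ _ _ (img_sub j) j j0 erefl.
  split=> //; rewrite -?(pairing_iso _ _ iso) //.
  have [g [h [gh hg]]] := iso; move=> /mod_zeroP z; apply: Y0; apply/mod_zeroP => y.
  by rewrite -[y]id_lfunE -gh comp_lfunE (z (g y)) linear0.
have [V [[WV V0 pV] Vmin]] := @exists_minimal _ Q (fun V => dim Ni - \dim V)%N (ex_intro _ _ Qj).
exists V; split=> //; apply/hdim_zeroP => f; apply: contrapT => f0.
pose V' := preim_sub (factor_proj V) (img_sub f).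
have V'P x : (x \in (V' : {vspace _})) <-> factor_proj V x \in limg f.
  by rewrite -memv_preim.
have VV' : (V <= V')%VS.
  by apply/subvP => x /factor_proj_eq0 h; apply/V'P; rewrite h mem0v.
have Q' : Q V'.
  split.
  - apply/subvP => x /V'P xV; apply/rad_kernelP => r rr.
    have [|r' rE] := @mhom_factor_surj _ _ _ _ _ (factor_proj V) r (limg_factor_proj V).
      rewrite lker_factor_proj; apply/subvP => z /(subvP WV)/rad_kernelP/(_ r rr) rz.
      by rewrite memv_ker rz.
    rewrite -rE comp_lfunE; case/memv_imgP: xV => y _ ->.
    by have := MN (compm r' f); move=> /lfunP/(_ y); rewrite comp_lfunE zero_lfunE.
  - move=> /mod_zeroP z; apply: V0; apply/mod_zeroP => y.
    have yV' : vsval y \in (V' : {vspace _}) by apply: (subvP VV'); apply: subvsP.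
    have := congr1 vsval (z (vsproj _ (vsval y))); rewrite vsprojK // => yz.
    exact: vsval_inj.
  - have e1 := pairing_exact Pp theta (short_exact_factor V).
    have e2 := pairing_exact Pp theta (short_exact_factor V').
    have e3 := pairing_exact Pp theta (short_exact_factor (img_sub f)).
    have [|g gE] := @mhom_factor_surj _ _ _ _ _ (factor_proj V)
        (factor_proj V') (limg_factor_proj V).
      by rewrite !lker_factor_proj.
    have gE' x : g (factor_proj V x) = factor_proj V' x by rewrite -gE comp_lfunE.
    have g1 : limg g = fullv.
      apply/limg_fullP => y; have [x <-] := (limg_fullP _).1 (limg_factor_proj V') y.
      by exists (factor_proj V x).
    have gk : lker g = img_sub f.
      apply/vspaceP => y; have [x <-] := (limg_fullP _).1 (limg_factor_proj V) y.
      rewrite memv_ker gE'; apply/eqP/idP => [/factor_proj_eq0/V'P|h] //.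
      by apply/factor_proj_eq0/V'P.
    have := pairing_iso P theta (factor_iso g1 gk).
    have [q qE q1] := mhom_corestrict f.
    have := Tb _ _ q1; move: pV e1 e2 e3; rewrite /=; lra.
have V'd : (\dim V' <= dim Ni)%N by rewrite -dimvf dimvS ?subvf.
have := Vmin _ Q'; rewrite leqNgt => /negP; apply.
suff : (\dim V < \dim V')%N by move: V'd; lia.
rewrite ltn_neqAle dimvS // andbT (dimv_leqif_eq VV'); apply/eqP => E.
apply: f0; apply/lfunP => v; rewrite zero_lfunE.
have [x xE] := (limg_fullP _).1 (limg_factor_proj V) (f v).
rewrite -xE; apply/factor_proj_eq0; rewrite E; apply/V'P.
by rewrite xE memv_img ?memvf.
Qed.

End Stability.

(** * Pairing the g-vectors with semistable quotients and submodules *)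
Section Classes.
Variables (K : fieldType) (A : falgType K) (R : realType).
Variables (n : nat) (P : 'I_n -> rmod A).
Hypothesis Pp : forall j, mod_proj (P j).
Local Notation hdim M N := (\dim (hom_space M N)).
Local Notation pairing := (pairing P).

Lemma hdim_sub_le (Q M : rmod A) (V : submodule M) : (hdim Q (sub_mod V) <= hdim Q M)%N.
Proof.
have [f0 fg _] := short_exact_factor V.
by rewrite (hdim_left_exact Q f0 fg) leq_addr.
Qed.

Lemma hdim_factor_le (Q M : rmod A) (V : submodule M) : (hdim (factor_mod V) Q <= hdim M Q)%N.
Proof.
have [_ fg g1] := short_exact_factor V.
by rewrite (hdim_right_exact Q fg g1) leq_addr.
Qed.

Lemma hdim_sub_eq (Q M : rmod A) (V : submodule M) :
  (forall f : mhom Q M, (limg f <= V)%VS) -> hdim Q (sub_mod V) = hdim Q M.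
Proof.
move=> H; have [f0 fg _] := short_exact_factor V.
rewrite (hdim_left_exact Q f0 fg).
suff -> : \dim (lcomp Q (factor_proj V) @: hom_space Q M) = 0%N by rewrite addn0.
apply/eqP; rewrite dimv_eq0 -subv0; apply/subvP => _ /memv_imgP[h /hom_mhom[h' <-] ->].
rewrite lcompE memv0; apply/eqP/lfunP => x; rewrite comp_lfunE zero_lfunE.
by apply/factor_proj_eq0; apply: (subvP (H h')); rewrite memv_img ?memvf.
Qed.

Lemma hdim_factor_eq (Q M : rmod A) (V : submodule M) :
  (forall f : mhom M Q, (V <= lker f)%VS) -> hdim (factor_mod V) Q = hdim M Q.
Proof.
move=> H; have [_ fg g1] := short_exact_factor V.
rewrite (hdim_right_exact Q fg g1).
suff -> : \dim (rcomp Q (sub_incl V) @: hom_space M Q) = 0%N by rewrite addn0.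
apply/eqP; rewrite dimv_eq0 -subv0; apply/subvP => _ /memv_imgP[h /hom_mhom[h' <-] ->].
rewrite rcompE memv0; apply/eqP/lfunP => x; rewrite comp_lfunE zero_lfunE.
apply/eqP; rewrite -memv_ker; apply: (subvP (H h')).
by rewrite sub_inclE subvsP.
Qed.

Variables (M N : rmod A) (I : finType) (Ms Ns : I -> rmod A).
Variables (inM : forall i, mhom (Ms i) M) (prM : forall i, mhom M (Ms i)).
Variables (inN : forall i, mhom (Ns i) N) (prN : forall i, mhom N (Ns i)).
Hypothesis retM : forall i, (prM i \o inM i)%VF = \1%VF.
Hypothesis retN : forall i, (prN i \o inN i)%VF = \1%VF.
Hypothesis MN : hdim M N = 0%N.
Hypothesis radM : forall i j (f : mhom (Ms j) (Ms i)), j != i -> rad_hom (compm f (prM j)).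
Hypothesis radN : forall i j (f : mhom (Ns i) (Ns j)), j != i -> rad_hom (compm (inN j) f).
Variable g : I -> 'rV[R]_n.
Hypothesis euler : forall i X,
  pairing (g i) X = (hdim (Ms i) X)%:R - (hdim X (Ns i))%:R.

Lemma hdim_Ns_eq0 X i : hdim X N = 0%N -> hdim X (Ns i) = 0%N.
Proof.
move=> /hdim_zeroP H; apply/hdim_zeroP => f.
have E : (inN i \o f)%VF = 0 := H (compm (inN i) f).
by rewrite -[LHS]comp_lfun1l -(retN i) -comp_lfunA E comp_lfun0r.
Qed.

Lemma hdim_Ms_eq0 X i : hdim M X = 0%N -> hdim (Ms i) X = 0%N.
Proof.
move=> /hdim_zeroP H; apply/hdim_zeroP => f.
have E : (f \o prM i)%VF = 0 := H (compm f (prM i)).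
by rewrite -[LHS]comp_lfun1r -(retM i) comp_lfunA E comp_lfun0l.
Qed.

Lemma hdim_Ms_Ns i j : hdim (Ms i) (Ns j) = 0%N.
Proof. exact/hdim_Ms_eq0/hdim_Ns_eq0. Qed.

(** For j <> i all terms of the Euler characteristic vanish except
    dim Hom(M_j, M_i) - dim Hom(M_j, V), and every map M_j -> M_i has its image
    in the radical image, hence in [V]. *)
Lemma top_quotient_values i (V : submodule (Ms i)) (X := factor_mod V) :
  (rad_image M (Ms i) <= V)%VS -> ~ mod_zero X -> hdim (sub_mod V) N = 0%N ->
  0 < pairing (g i) X /\ forall j, j != i -> pairing (g j) X = 0.
Proof.
move=> WV X0 VN; split=> [|j ji].
  rewrite euler; have -> : hdim X (Ns i) = 0%N.
    by apply/eqP; rewrite -leqn0 -(hdim_Ms_Ns i i) hdim_factor_le.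
  rewrite subr0 ltr0n lt0n; apply/eqP => /hdim_zeroP H.
  exact: (surj_nonzero (limg_factor_proj V) X0) (H (factor_proj V)).
have e := pairing_exact Pp (g j) (short_exact_factor V).
have := esym e; rewrite !euler hdim_Ms_Ns (hdim_Ns_eq0 j VN).
rewrite (hdim_sub_eq (Q := Ms j)) => [|f]; last first.
  apply: subv_trans WV; apply/subvP => _ /memv_imgP[x _ ->]; apply: sub_vspan.
  exists (compm f (prM j)); split; first exact: radM.
  exists (inM j x); rewrite comp_lfunE -(comp_lfunE (prM j)) retM.
  by rewrite id_lfunE.
lra.
Qed.

(** For j <> i every map N_i -> N_j is radical, so it kills [V] and factors
    through N_i / V. *)
Lemma socle_sub_values i (V : submodule (Ns i)) (X := sub_mod V) :
  (V <= rad_kernel (Ns i) N)%VS -> ~ mod_zero X -> hdim M (factor_mod V) = 0%N ->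
  pairing (g i) X < 0 /\ forall j, j != i -> pairing (g j) X = 0.
Proof.
move=> WV X0 MV; have M0 j : hdim (Ms j) X = 0%N.
  by apply/eqP; rewrite -leqn0 -(hdim_Ms_Ns j i) hdim_sub_le.
split=> [|j ji].
  rewrite euler M0 sub0r oppr_lt0 ltr0n lt0n; apply/eqP => /hdim_zeroP H.
  apply: X0; apply/mod_zeroP => x; apply: ((lker_eq0P _).1 (lker_sub_incl V)).
  by rewrite (H (sub_incl V)) zero_lfunE.
have e := pairing_exact Pp (g j) (short_exact_factor V).
have := esym e; rewrite !euler hdim_Ms_Ns (hdim_Ms_eq0 j MV).
rewrite (hdim_factor_eq (Q := Ns j)) => [|f]; last first.
  apply: subv_trans WV _; apply/subvP => x /rad_kernelP/(_ _ (radN f ji)).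
  move=> /(congr1 (prN j)); rewrite comp_lfunE -(comp_lfunE (prN j)) retN id_lfunE.
  by rewrite linear0 memv_ker => ->.
lra.
Qed.

End Classes.

(** * Hyperplanes and small perturbations *)
Section Geometry.
Variables (R : realType) (n : nat).
Implicit Types (x y v theta : 'rV[R]_n) (F C : set 'rV[R]_n).

Definition dot theta x : R := \sum_j theta 0 j * x 0 j.
Lemma dotDl k u v x : dot (k *: u + v) x = k * dot u x + dot v x.
Proof.
rewrite /dot mulr_sumr -big_split; apply: eq_bigr => j _ /=.
by rewrite !mxE mulrDl mulrA.
Qed.
Lemma dotDr k u x y : dot u (k *: x + y) = k * dot u x + dot u y.
Proof.
rewrite /dot mulr_sumr -big_split; apply: eq_bigr => j _ /=.
by rewrite !mxE mulrDr mulrCA.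
Qed.
Lemma dot0l x : dot 0 x = 0.
Proof. by rewrite /dot big1 // => j _; rewrite mxE mul0r. Qed.
Lemma dot0r u : dot u 0 = 0.
Proof. by rewrite /dot big1 // => j _; rewrite mxE mulr0. Qed.
Lemma dot_delta x k : dot (delta_mx 0 k) x = x 0 k.
Proof.
rewrite /dot (bigD1 k) //= big1 ?addr0 => [|j jk]; rewrite mxE !eqxx /= ?mul1r //.
by rewrite (negPf jk) mul0r.
Qed.

Lemma dot_span F x : (forall theta, F theta -> dot theta x = 0) ->
  forall theta, theta \in vspan F -> dot theta x = 0.
Proof.
move=> H; apply: vspan_ind => [|k u v hu hv|]; [exact: dot0l| |exact: H].
by rewrite dotDl hu hv mulr0 addr0.
Qed.

Lemma dot_span_r (S : set 'rV[R]_n) u : (forall x, S x -> dot u x = 0) ->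
  forall x, x \in vspan S -> dot u x = 0.
Proof.
move=> H; apply: vspan_ind => [|k x y hx hy|]; [exact: dot0r| |exact: H].
by rewrite dotDr hx hy mulr0 addr0.
Qed.

(** Both forms vanish on the span of [F], so each is determined by its value at
    one coordinate vector outside of this span. *)
Lemma normal_proportional F x y : (\dim (vspan F)).+1 = n -> x != 0 ->
  (forall theta, F theta -> dot theta x = 0) ->
  (forall theta, F theta -> dot theta y = 0) -> exists c, y = c *: x.
Proof.
move=> dF x0 Fx Fy.
have [k xk] : exists k, x 0 k != 0.
  apply: contrapT => /forallNP H; move/eqP: x0; apply; apply/rowP => k.
  by rewrite mxE; apply: contrapT => /eqP/(H k).
pose a : 'rV[R]_n := delta_mx 0 k; exists (y 0 k / x 0 k); apply/rowP => l.
have aF : a \notin vspan F.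
  by apply: contra xk => /(dot_span Fx); rewrite dot_delta => ->.
have full : (vspan F + <[a]>)%VS = fullv.
  have lt : (\dim (vspan F) < \dim (vspan F + <[a]>))%N.
    rewrite ltn_neqAle dimvS ?addvSl // andbT.
    rewrite (dimv_leqif_eq (addvSl _ _)); apply: contra aF => /eqP ->.
    by rewrite memvE addvSr.
  apply/eqP; rewrite -(dimv_leqif_eq (subvf _)) eqn_leq dimvS ?subvf //=.
  apply: leq_trans lt; rewrite dF dimvf; exact/eq_leq/mul1n.
have /memv_addP[f Ff [_ /vlineP[c ->] E]] : delta_mx 0 l \in (vspan F + <[a]>)%VS.
  by rewrite full memvf.
rewrite mxE -(dot_delta y l) -(dot_delta x l) E addrC !dotDl.
by rewrite (dot_span Fx Ff) (dot_span Fy Ff) !addr0 !dot_delta; field.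
Qed.

Lemma small_scaling (s : seq (R * R)) :
  exists2 t : R, 0 < t & forall ab, ab \in s -> ab.1 != 0 -> t * `|ab.2| <= `|ab.1|.
Proof.
elim: s => [|[a b] s [t t0 H]]; first by exists 1.
have [->|a0] := eqVneq a 0.
  by exists t => // ab; rewrite inE => /orP[/eqP ->|]; [rewrite eqxx|exact: H].
pose u := `|a| / (1 + `|b|).
have b0 : 0 < 1 + `|b| by rewrite ltr_pwDl.
have u0 : 0 < u by rewrite divr_gt0 ?normr_gt0.
exists (Num.min t u) => [|ab]; first by rewrite lt_min t0.
rewrite inE => /orP[/eqP -> _ /=|abs ab0]; last first.
  apply: le_trans (H _ abs ab0); rewrite ler_wpM2r // ge_min lexx //.
apply: (@le_trans _ _ (u * `|b|)); first by rewrite ler_wpM2r // ge_min lexx orbT.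
by rewrite /u mulrAC ler_pdivrMr // ler_wpM2l // lerDr.
Qed.

End Geometry.

(** * Generic points of the facets *)
Section FacetsOfD.
Variables (K : fieldType) (A : falgType K) (R : realType).
Variables (n : nat) (P : 'I_n -> rmod A) (M N : rmod A).
Local Notation hdim M N := (\dim (hom_space M N)).
Local Notation pairing := (pairing P).
Implicit Types (theta v : 'rV[R]_n) (F : set 'rV[R]_n).

Definition dimvec (X : rmod A) : 'rV[R]_n := \row_j (hdim (P j) X)%:R.

Lemma pairingE theta X : pairing theta X = dot theta (dimvec X).
Proof. by apply: eq_bigr => j _; rewrite mxE. Qed.

Definition Dcone_of : set 'rV[R]_n := [set theta | Tbar P theta M /\ Fbar P theta N].
Local Notation D := Dcone_of.

Definition quotient_of (X : rmod A) := exists p : mhom M X, limg p = fullv.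
Definition subobject_of (Y : rmod A) := exists j : mhom Y N, lker j = 0%VS.

Lemma Dcone_ofP theta : D theta <->
  (forall X, quotient_of X -> 0 <= dot theta (dimvec X)) /\
  (forall Y, subobject_of Y -> dot theta (dimvec Y) <= 0).
Proof.
split=> [[/TbarP T /FbarP Fb]|[T Fb]].
  by split=> X [p pP]; rewrite -pairingE; [exact: T pP|exact: Fb pP].
split; [apply/TbarP|apply/FbarP] => X p pP; rewrite pairingE; [apply: T|apply: Fb];
  by exists p.
Qed.

Lemma Dcone_of0 : D 0.
Proof. by apply/Dcone_ofP; split=> X _; rewrite dot0l. Qed.

Lemma Dcone_of_add theta theta' : D theta -> D theta' -> D (theta + theta').
Proof.
move=> /Dcone_ofP[T Fb] /Dcone_ofP[T' Fb']; apply/Dcone_ofP.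
by split=> X H; rewrite -[theta]scale1r dotDl mul1r; [exact: addr_ge0 (T _ H) (T' _ H)|
  rewrite -oppr_ge0 opprD addr_ge0 // oppr_ge0; [exact: Fb|exact: Fb']].
Qed.

(** On [D] each form in question has constant sign, so it vanishes at
    theta + theta' if and only if it vanishes at both. Hence, if the forms that
    vanish at theta span a space of minimal dimension, adding any theta' in [F]
    does not change this span, and all forms in it vanish at theta'. *)
Lemma generic_point F : face D F -> exists theta, F theta /\
  forall X, quotient_of X \/ subobject_of X -> pairing theta X = 0 ->
  forall theta', F theta' -> pairing theta' X = 0.
Proof.
move=> [l [_ FE]].
pose S theta := vspan [set x | exists X,
  [/\ quotient_of X \/ subobject_of X, pairing theta X = 0 & x = dimvec X]].
have F0 : exists theta, F theta by exists 0; rewrite FE; split; [exact: Dcone_of0|exact: linear0].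
have [theta [Ft tmin]] := exists_minimal (fun theta => \dim (S theta)) F0.
exists theta; split=> // X occ tX theta' Ft'.
have key Z : quotient_of Z \/ subobject_of Z -> pairing (theta + theta') Z = 0 ->
    pairing theta Z = 0 /\ pairing theta' Z = 0.
  move: Ft Ft'; rewrite !FE => -[/Dcone_ofP[T1 F1] _] [/Dcone_ofP[T2 F2] _] oZ.
  rewrite !pairingE -[theta in dot (theta + _)]scale1r dotDl mul1r.
  by case: oZ => H; [have := T1 _ H; have := T2 _ H|have := F1 _ H; have := F2 _ H]; lra.
have Fs : F (theta + theta').
  move: Ft Ft'; rewrite !FE => -[d1 l1] [d2 l2]; split; first exact: Dcone_of_add.
  by rewrite linearD /= l1 l2 addr0.
pose th := theta + theta'.
have SS : (S th <= S theta)%VS.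
  apply: vspan_min => _ [Z [oZ pZ ->]]; apply: sub_vspan; exists Z; split=> //.
  by have [] := key Z oZ pZ.
have /eqP E : (S th == S theta)%VS.
  by rewrite -(dimv_leqif_eq SS) eqn_leq dimvS //= tmin.
rewrite pairingE; apply: (dot_span_r (S := [set x | exists X,
  [/\ quotient_of X \/ subobject_of X, pairing (theta + theta') X = 0 & x = dimvec X]])).
  by move=> _ [Z [oZ pZ ->]]; rewrite -pairingE; have [] := key Z oZ pZ.
by rewrite -[vspan _]/(S th) E; apply: sub_vspan; exists X.
Qed.

Lemma quotient_dim X : quotient_of X -> (dim X <= dim M)%N.
Proof.
move=> [p p1]; rewrite -!dimvf -p1 -(limg_ker_dim p fullv) leq_addl //.
Qed.

Lemma subobject_dim Y : subobject_of Y -> (dim Y <= dim N)%N.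
Proof.
move=> [j j0]; rewrite -!dimvf -(limg_dim_eq (f := j)) ?j0 ?capv0 //.
by rewrite dimvS ?subvf.
Qed.

(** The quotients of [M] and the submodules of [N] have finitely many dimension
    vectors, so a common [t] exists. *)
Lemma strict_interior theta v :
  (forall X, quotient_of X -> ~ mod_zero X -> 0 < pairing theta X) ->
  (forall Y, subobject_of Y -> ~ mod_zero Y -> pairing theta Y < 0) ->
  exists2 t : R, 0 < t & D (t *: v + theta) /\ D (- t *: v + theta).
Proof.
move=> T Fb; pose B := ((\sum_j dim (P j)) * (dim M + dim N)).+1.
have bound X j : quotient_of X \/ subobject_of X -> (hdim (P j) X < B)%N.
  move=> oX; rewrite ltnS; apply: (@leq_trans (dim (P j) * dim X)).
    by rewrite -[X in (_ <= X)%N]/(dim 'Hom(P j, X)) -dimvf dimvS ?subvf.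
  apply: leq_mul; first by rewrite (bigD1 j) //= leq_addr.
  case: oX => [/quotient_dim h|/subobject_dim h]; apply: leq_trans h _.
    exact: leq_addr.
  exact: leq_addl.
pose vec (u : {ffun 'I_n -> 'I_B}) : 'rV[R]_n := \row_j (u j : nat)%:R.
have [t t0 tP] := small_scaling [seq (dot theta (vec u), dot v (vec u)) | u : {ffun 'I_n -> 'I_B}].
have {}tP X : quotient_of X \/ subobject_of X -> pairing theta X != 0 ->
    t * `|dot v (dimvec X)| <= `|dot theta (dimvec X)|.
  move=> oX; rewrite pairingE => h.
  apply: (tP (dot theta (dimvec X), dot v (dimvec X))) => //.
  apply/mapP; exists [ffun j => Ordinal (bound X j oX)]; rewrite ?mem_enum //.
  suff -> : vec [ffun j => Ordinal (bound X j oX)] = dimvec X by [].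
  by apply/rowP => j; rewrite !mxE ffunE.
have key s X : `|s| = t -> quotient_of X \/ subobject_of X -> pairing theta X != 0 ->
    `|s * dot v (dimvec X)| <= `|dot theta (dimvec X)|.
  by move=> st oX h; rewrite normrM st; exact: tP.
exists t => //.
have half s : `|s| = t -> D (s *: v + theta).
  move=> st; apply/Dcone_ofP; split=> X oX; rewrite dotDl -(pairingE theta).
    have [X0|X0] := pselect (mod_zero X).
      by rewrite -pairingE !pairing_zero // mulr0 addr0.
    have h := T X oX X0; have := key s X st (or_introl oX) (lt0r_neq0 h).
    rewrite -(pairingE theta) (gtr0_norm h) ler_norml => /andP[]; lra.
  have [X0|X0] := pselect (mod_zero X).
    by rewrite -pairingE !pairing_zero // mulr0 addr0.
  have h := Fb X oX X0; have := key s X st (or_intror oX) (ltr0_neq0 h).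
  rewrite -(pairingE theta) (ltr0_norm h) ler_norml => /andP[]; lra.
by split; apply: half; rewrite ?normrN gtr0_norm.
Qed.

(** Otherwise theta is an interior point of [D]. The form that cuts out [F] then
    vanishes everywhere, so F = D spans the whole space. *)
Lemma facet_touches F theta : facet D F -> F theta ->
  (exists X, [/\ quotient_of X, ~ mod_zero X & pairing theta X <= 0]) \/
  (exists Y, [/\ subobject_of Y, ~ mod_zero Y & 0 <= pairing theta Y]).
Proof.
move=> [[l [l0 FE]] dF] Ft; apply: contrapT => /not_orP[H1 H2].
have l_zero v : l v = 0 /\ v \in vspan F.
  have T X : quotient_of X -> ~ mod_zero X -> 0 < pairing theta X.
    by move=> qX X0; rewrite ltNge; apply/negP => h; apply: H1; exists X.
  have Fb Y : subobject_of Y -> ~ mod_zero Y -> pairing theta Y < 0.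
    by move=> qX X0; rewrite ltNge; apply/negP => h; apply: H2; exists Y.
  have [t t0 [Dp Dm]] := strict_interior v T Fb.
  have lt : l theta = 0 by move: Ft; rewrite FE => -[].
  have := l0 _ Dp; have := l0 _ Dm; rewrite !linearD !linearZ /= lt !addr0.
  rewrite -![_ *: l v]/(_ * l v : R) mulNr oppr_ge0 !(pmulr_rge0, pmulr_rle0) //.
  move=> le0 ge0; have lv : l v = 0 by apply/eqP; rewrite eq_le le0 ge0.
  split=> //; have Fp : F (t *: v + theta).
    by rewrite FE; split=> //; rewrite linearD linearZ /= lt lv scaler0 addr0.
  rewrite -(scalerK (lt0r_neq0 t0) v) memvZ // -(addrK theta (t *: v)).
  by rewrite memvB // sub_vspan.
have full : vspan F = fullv by apply/vspaceP => v; rewrite memvf (l_zero v).2.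
have : \dim (vspan F) = n by rewrite full dimvf; exact: mul1n.
by move: dF => /[swap] ->; lia.
Qed.

End FacetsOfD.

(** * Facets and walls *)
Section FacetPartition.
Variables (K : fieldType) (A : falgType K) (R : realType).
Variables (n : nat) (P : 'I_n -> rmod A).
Hypothesis Pp : forall j, mod_proj (P j).
Local Notation hdim M N := (\dim (hom_space M N)).
Local Notation pairing := (pairing P).
Variables (M N : rmod A) (I : finType) (Ms Ns : I -> rmod A).
Variables (inM : forall i, mhom (Ms i) M) (prM : forall i, mhom M (Ms i)).
Variables (inN : forall i, mhom (Ns i) N) (prN : forall i, mhom N (Ns i)).
Hypothesis retM : forall i, (prM i \o inM i)%VF = \1%VF.
Hypothesis retN : forall i, (prN i \o inN i)%VF = \1%VF.
Hypothesis sumM : \sum_i (inM i \o prM i)%VF = \1%VF.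
Hypothesis sumN : \sum_i (inN i \o prN i)%VF = \1%VF.
Hypothesis MN : hdim M N = 0%N.
Hypothesis radM : forall i j (f : mhom (Ms j) (Ms i)), j != i -> rad_hom (compm f (prM j)).
Hypothesis radN : forall i j (f : mhom (Ns i) (Ns j)), j != i -> rad_hom (compm (inN j) f).
Variable g : I -> 'rV[R]_n.
Hypothesis euler : forall i X,
  pairing (g i) X = (hdim (Ms i) X)%:R - (hdim X (Ns i))%:R.
Local Notation D := (@Dcone_of K A R n P M N).

(** With the modules of U and U_i for [M], [N] and [Ms i], [Ns i], these are the
    sets [boundary]. *)
Definition wall (i : I) (eps : bool) : set 'rV[R]_n :=
  [set theta | D theta /\ if eps then ~ Tors P theta (factor_mod (rad_image M (Ms i)))
                          else ~ Free P theta (sub_mod (rad_kernel (Ns i) N))].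

Lemma quotient_of_Ms i X (p : mhom (Ms i) X) : limg p = fullv -> quotient_of M X.
Proof.
move=> /limg_fullP p1; exists (compm p (prM i)); apply/limg_fullP => y.
have [x <-] := p1 y; exists (inM i x); rewrite comp_lfunE -(comp_lfunE (prM i)) retM.
by rewrite id_lfunE.
Qed.

Lemma subobject_of_Ns i Y (j : mhom Y (Ns i)) : lker j = 0%VS -> subobject_of N Y.
Proof.
move=> /lker_eq0P j0; exists (compm (inN i) j); apply/lker_eq0P => y; rewrite comp_lfunE => H.
apply: j0; rewrite -[LHS]id_lfunE -(retN i) comp_lfunE H linear0 //.
Qed.

Lemma Dcone_of_ge0 theta X : D theta -> quotient_of M X -> 0 <= pairing theta X.
Proof. by move=> /Dcone_ofP[T _] q; rewrite pairingE; exact: T. Qed.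

Lemma Dcone_of_le0 theta X : D theta -> subobject_of N X -> pairing theta X <= 0.
Proof. by move=> /Dcone_ofP[_ T] q; rewrite pairingE; exact: T. Qed.

(** A generic point of [F] lies on some wall, which is witnessed by a module that
    pairs to 0 with it. By genericity this module pairs to 0 with all of [F]. *)
Lemma facet_in_wall F : facet D F -> exists i eps, F `<=` wall i eps.
Proof.
move=> fF; have [theta [Ft gen]] := generic_point fF.1.
have FD t : F t -> D t by have [[l [_ ->]] _] := fF; case.
have [Tb Fb] := FD _ Ft.
have [[X [[p p1] X0 pX]]|[Y [[j j0] Y0 pY]]] := facet_touches fF Ft.
  have [i /not_TorsP[Z [q [q1 Wq Z0 qZ]]]] := not_Tors_top Pp sumM Tb p1 X0 pX.
  have Zq := quotient_of_Ms q1.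
  have Z0' : pairing theta Z = 0.
    by apply/eqP; rewrite eq_le qZ (Dcone_of_ge0 (FD _ Ft) Zq).
  exists i, true => t Ft'; split; first exact: FD.
  by apply/not_TorsP; exists Z, q; split=> //; rewrite (gen _ (or_introl Zq) Z0' t Ft').
have [i /not_FreeP[Z [q [q0 Wq Z0 qZ]]]] := not_Free_socle Pp sumN Fb j0 Y0 pY.
have Zq := subobject_of_Ns q0.
have Z0' : pairing theta Z = 0.
  by apply/eqP; rewrite eq_le qZ (Dcone_of_le0 (FD _ Ft) Zq).
exists i, false => t Ft'; split; first exact: FD.
by apply/not_FreeP; exists Z, q; split=> //; rewrite (gen _ (or_intror Zq) Z0' t Ft').
Qed.

(** The dimension vector of [X] is orthogonal to a facet through a generic theta
    and sees only the g-vector of index [i], with a sign given by [eps]. *)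
Lemma wall_normal theta i (eps : bool) : wall i eps theta -> exists X : rmod A,
  [/\ quotient_of M X \/ subobject_of N X, pairing theta X = 0,
      (if eps then 0 < pairing (g i) X else pairing (g i) X < 0)
    & forall j, j != i -> pairing (g j) X = 0].
Proof.
case: eps => -[Dt]; have [Tb Fb] := Dt.
  move=> /(semistable_top_quotient Pp Fb MN)[V [WV V0 pV VN]]; exists (factor_mod V).
  have q := quotient_of_Ms (limg_factor_proj V).
  have [gi gj] := top_quotient_values Pp retM retN MN radM euler WV V0 VN.
  by split=> //; [left|apply/eqP; rewrite eq_le pV Dcone_of_ge0].
move=> /(semistable_socle_sub Pp Tb MN)[V [WV V0 pV VN]]; exists (sub_mod V).
have q := subobject_of_Ns (lker_sub_incl V).
have [gi gj] := socle_sub_values Pp retM retN MN radN euler WV V0 VN.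
by split=> //; [right|apply/eqP; rewrite eq_le pV Dcone_of_le0].
Qed.

(** The modules from [wall_normal] for both walls have dimension vectors that are
    orthogonal to [F]; being nonnegative, they are positively proportional. The
    pairings with the g-vectors then identify the walls. *)
Lemma facet_in_one_wall F i i' eps eps' : facet D F ->
  F `<=` wall i eps -> F `<=` wall i' eps' -> (i, eps) = (i', eps').
Proof.
move=> fF W W'; have [theta [Ft gen]] := generic_point fF.1.
have [X [oX X0 Xi Xj]] := wall_normal (W _ Ft).
have [X' [oX' X0' Xi' Xj']] := wall_normal (W' _ Ft).
have x0 : dimvec R P X != 0.
  apply/eqP => x0; move: Xi; rewrite pairingE x0 dot0r.
  by case: (eps); rewrite ltxx.
have [||c cE] := normal_proportional fF.2 x0 (y := dimvec R P X').
- by move=> t Ft'; rewrite -pairingE; apply: gen Ft'.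
- by move=> t Ft'; rewrite -pairingE; apply: gen Ft'.
have pc t : pairing t X' = c * pairing t X.
  by rewrite !pairingE cE -[c *: _]addr0 dotDr dot0r addr0.
have c0 : 0 <= c.
  have [k xk] : exists k, dimvec R P X 0 k != 0.
    apply: contrapT => /forallNP H; move/eqP: x0; apply; apply/rowP => k.
    by rewrite [RHS]mxE; apply: contrapT => /eqP/(H k).
  have : dimvec R P X' 0 k = c * dimvec R P X 0 k by rewrite cE mxE.
  have xk0 : 0 < dimvec R P X 0 k by rewrite lt0r xk mxE ler0n.
  move=> E; rewrite -(pmulr_lge0 _ xk0) -E mxE; exact: ler0n.
have ii : i = i'.
  apply/eqP; rewrite eq_sym; apply: contraT => ne.
  by move: Xi'; rewrite pc (Xj _ ne) mulr0; case: (eps'); rewrite ltxx.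
move: Xi'; rewrite -ii pc; case: eps {W} Xi; case: eps' {W'} => // gi gi'; exfalso; nra.
Qed.

End FacetPartition.

(** * Two-term presilting complexes *)
Section Silting.
Variables (K : fieldType) (A : falgType K).
Local Notation complex := (complex A).
Local Notation kproj := (kproj A).
Local Notation hdim M N := (\dim (hom_space M N)).

Lemma functor_direct_sum (Phi : hfunctor A) (I : finType) (U : complex) (V : I -> complex) :
  is_direct_sum U V ->
  exists (i : forall x, mhom (Phi (V x)) (Phi U)) (p : forall x, mhom (Phi U) (Phi (V x))),
    (forall x, (p x \o i x)%VF = \1%VF) /\ \sum_x (i x \o p x)%VF = \1%VF.
Proof.
move=> [inj [pr [h1 _ h3]]].
exists (fun x => MHom (hmap_mhom (h:=Phi) (inj x))), (fun x => MHom (hmap_mhom (h:=Phi) (pr x))).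
split=> [x|] /=.
  by have := hmap_homotopic Phi (h1 x); rewrite hmap_comp hmap_id.
have := hmap_homotopic Phi h3; rewrite hmap_id => <-.
rewrite (hmap_sum Phi (fun x k => inj x k \o pr x k)%VF).
by apply: eq_bigr => x _; rewrite hmap_comp.
Qed.

(** Only [U] itself comes with a model in degrees -1 and 0; its summands get
    theirs from [summand_equiv_subcomplex]. *)
Lemma two_term_summand (U : kproj) (I : finType) (V : I -> kproj) : two_term U ->
  is_direct_sum U V -> forall x, exists D : kproj, cpx_iso (V x) D /\ concentrated D.
Proof.
move=> [C [[a [b [ba ab]]] C2]] [inj [pr [h1 _ _]]] x.
have [|D [iso D0]] := @summand_equiv_subcomplex _ _ C (V x) (ccomp a (inj x)) (ccomp (pr x) b).
  apply: (@heqv_trans _ _ _ _ (ccomp (pr x) (ccomp (ccomp b a) (inj x)))).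
    by apply: heqv_eq => k; rewrite /= !comp_lfunA.
  have ba' : heqv (ccomp b a) (cidm U) := ba.
  apply: heqv_trans (heqv_comp3 (pr x) (inj x) ba') _.
  have h1' : heqv (ccomp (pr x) (inj x)) (cidm (V x)) := h1 x.
  apply: heqv_trans h1'; apply: heqv_eq => k.
  by rewrite /= comp_lfun1l.
by exists D; split=> // k k1 k0; apply: D0; apply: C2.
Qed.

Lemma gvector_exists (R : realType) (n : nat) (P : 'I_n -> rmod A) (V D : kproj) :
  indec_projectives P -> cpx_iso V D -> concentrated D ->
  exists g : 'rV[R]_n, forall X,
    pairing P g X = (hdim (H0 V) X)%:R - (hdim X (Hm1nu V))%:R.
Proof.
move=> hP VD D2.
have [c cE] := proj_class hP (@kproj_proj _ _ D 0).
have [d dE] := proj_class hP (@kproj_proj _ _ D (-1)).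
exists (\row_j ((c j)%:R - (d j)%:R)) => X.
have := hdim_euler D2 X; rewrite cE dE.
rewrite -(hdim_isoL X (hfunctor_iso (H0_functor A) VD)).
rewrite -(hdim_isoR X (hfunctor_iso (Hm1nu_functor A) VD)) => /(congr1 (fun k => k%:R : R)).
rewrite !natrD => E.
have -> : pairing P (\row_j ((c j)%:R - (d j)%:R)) X =
   (\sum_j c j * hdim (P j) X)%N%:R - (\sum_j d j * hdim (P j) X)%N%:R :> R.
  rewrite !natr_sum -sumrB; apply: eq_bigr => j _.
  by rewrite mxE mulrBl !natrM.
apply/eqP; rewrite subr_eq addrAC eq_sym subr_eq; apply/eqP; exact: E.
Qed.

(** Nilpotency of (p g) f and of (g f) p are equivalent, see [lpow_comp_swap]. *)
Lemma rad_hom_comp_proj (Phi : hfunctor A) (U V W : kproj) (p : mhom (Phi U) (Phi V))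
  (f : mhom (Phi V) (Phi W)) :
  (forall (g : mhom (Phi W) (Phi V)), exists n, lpow (g \o f)%VF n = 0) ->
  rad_hom (compm f p).
Proof.
move=> H; apply: rad_hom_of_nilpotent => g; have [n nil] := H (compm p g).
exists n.+1; have -> : (g \o compm f p)%VF = ((g \o f) \o p)%VF by exact: comp_lfunA.
have {}nil : lpow (p \o (g \o f))%VF n = 0 by rewrite comp_lfunA.
by rewrite lpow_comp_swap nil comp_lfun0l comp_lfun0r.
Qed.

Lemma rad_hom_comp_incl (Phi : hfunctor A) (U V W : kproj) (i : mhom (Phi W) (Phi U))
  (f : mhom (Phi V) (Phi W)) :
  (forall (g : mhom (Phi W) (Phi V)), exists n, lpow (g \o f)%VF n = 0) ->
  rad_hom (compm i f).
Proof.
move=> H; apply: rad_hom_of_nilpotent => g; have [n nil] := H (compm g i).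
by exists n; rewrite /= comp_lfunA.
Qed.

End Silting.

Theorem theorem1p4 (K : fieldType) (A : falgType K) (R : realType)
  (n : nat) (P : 'I_n -> rmod A) (hP : indec_projectives P)
  (U : kproj A) (hU : two_psilt U)
  (m : nat) (Us : 'I_m -> kproj A)
  (hUs : forall i, indecomposable (Us i)) (hsum : is_direct_sum U Us) :
  (forall F : set 'rV[R]_n, facet (Dcone P U) F ->
     exists! ie : 'I_m * bool, facet_part P U (Us ie.1) ie.2 F) /\
  (facet (Dcone (R := R) P U) =
     \bigcup_(i in [set: 'I_m])
       (facet_part P U (Us i) true `|` facet_part P U (Us i) false)) /\
  trivIset [set: 'I_m * bool]
    (fun ie => facet_part (R := R) P U (Us ie.1) ie.2).
Proof.
have Pp j : mod_proj (P j) by have [/(_ j)[]] := hP.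
have [Ub Ut Up] := hU.
have [D DP] : exists D : 'I_m -> kproj A,
    forall i, cpx_iso (Us i) (D i) /\ concentrated (D i).
  have H := two_term_summand Ut hsum.
  by exists (fun i => sval (cid (H i))) => i; exact: svalP (cid (H i)).
have [inM [prM [retM sumM]]] := functor_direct_sum (H0_functor A) hsum.
have [inN [prN [retN sumN]]] := functor_direct_sum (Hm1nu_functor A) hsum.
have [g gE] : exists g : 'I_m -> 'rV[R]_n, forall i X, pairing P (g i) X =
    (\dim (hom_space (H0 (Us i)) X))%:R - (\dim (hom_space X (Hm1nu (Us i))))%:R.
  have H i := gvector_exists R hP (DP i).1 (DP i).2.
  by exists (fun i => sval (cid (H i))) => i; exact: svalP (cid (H i)).
have MN : \dim (hom_space (H0 U) (Hm1nu U)) = 0%N.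
  have [C [UC C2]] := Ut; have [a [b [_ ab]]] := UC.
  rewrite (hdim_isoL _ (hfunctor_iso (H0_functor A) UC)).
  rewrite (hdim_isoR _ (hfunctor_iso (Hm1nu_functor A) UC)).
  by apply: (presilting_hdim C2 ab) => f; apply: Up.
have niso i j : j != i -> ~ cpx_iso (Us j) (Us i).
  by move=> ji /(Ub m Us hUs hsum)/eqP; rewrite (negPf ji).
have nilM i j (f : mhom (H0 (Us j)) (H0 (Us i))) (h : mhom (H0 (Us i)) (H0 (Us j))) :
    j != i -> exists k, lpow (h \o f)%VF k = 0.
  move=> ji; apply: (hmap_nilpotent (hUs j) (hUs i) _ _ (niso i j ji) (Phi := H0_functor A)).
    apply: full_on_iso (DP j).1 (DP i).1 _; exact: H0_full (DP j).2 (DP i).2.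
  apply: full_on_iso (DP i).1 (DP j).1 _; exact: H0_full (DP i).2 (DP j).2.
have nilN i j (f : mhom (Hm1nu (Us i)) (Hm1nu (Us j))) (h : mhom (Hm1nu (Us j)) (Hm1nu (Us i))) :
    j != i -> exists k, lpow (h \o f)%VF k = 0.
  rewrite eq_sym => ij.
  apply: (hmap_nilpotent (hUs i) (hUs j) _ _ (niso j i ij) (Phi := Hm1nu_functor A)).
    apply: full_on_iso (DP i).1 (DP j).1 _; exact: Hm1nu_full (DP i).2 (DP j).2.
  apply: full_on_iso (DP j).1 (DP i).1 _; exact: Hm1nu_full (DP j).2 (DP i).2.
have radM i j (f : mhom (H0 (Us j)) (H0 (Us i))) : j != i -> rad_hom (compm f (prM j)).
  move=> ji; apply: (@rad_hom_comp_proj _ _ (H0_functor A) U (Us j) (Us i)) => h.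
  exact: nilM.
have radN i j (f : mhom (Hm1nu (Us i)) (Hm1nu (Us j))) : j != i -> rad_hom (compm (inN j) f).
  move=> ji; apply: (@rad_hom_comp_incl _ _ (Hm1nu_functor A) U (Us i) (Us j)) => h.
  exact: nilN.
have ex F : facet (Dcone P U) F -> exists i eps, facet_part (R := R) P U (Us i) eps F.
  move=> fF; have [i [eps W]] := facet_in_wall Pp retM retN sumM sumN fF.
  by exists i, eps.
have uniq F ie ie' : facet_part (R := R) P U (Us ie.1) ie.2 F ->
    facet_part P U (Us ie'.1) ie'.2 F -> ie = ie'.
  case: ie ie' => [i e] [i' e'] [fF W] [_ W'].
  exact: (facet_in_one_wall Pp retM retN MN radM radN gE fF W W').
split; last split.
- move=> F /ex[i [eps H]]; exists (i, eps); split=> // ie' H'.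
  exact: (uniq F (i, eps) ie' H H').
- apply/seteqP; split=> F; last by move=> [i _ [[]|[]]].
  by move=> /ex[i [[] H]]; exists i => //; [left|right].
- by move=> ie ie' _ _ [F [H H']]; exact: (uniq F ie ie' H H').
Qed.
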